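(* There exist positive constants $C_{\mathrm{density}},c_{\mathrm{density}}$ depending only on $\Theta$ and $k_*$, and positive constants $C_{\mathrm{local},3},C_{\mathrm{global},3}$ depending only on $R,k_*,\Sigma$ (the constants described in the context), such that for every true mixing measure $G_*=\sum_{j=1}^{k_*}\pi_j^*\delta_{\theta_j^*}$ as in the context (no assumption on the cluster structure of its atoms), the maximum likelihood estimator $\widehat G_n$ over $\mathcal{E}_{k_*}(\Theta)$ satisfies: (a) (Global rate) For any $n\ge1$, $$\mathbb{P}\left(W_1(\widehat G_n,G_* )>\frac{C_{\mathrm{density}}}{C_{\mathrm{global},3}}\Big(\frac{d\log n}{n}\Big)^{1/2}(\pi_{\min}^* )^{-1}\Delta_{\mathrm{sep}}^{-(4k_*-3)}\right)\lesssim\exp(-c_{\mathrm{density}}\log n).$$ (b) (Local rate) There exists $N_3\in\mathbb{N}$ depending only on $G_*$ such that for all $n\ge N_3$, $$\mathbb{P}\left(W_1(\widehat G_n,G_* )>\frac{C_{\mathrm{density}}}{C_{\mathrm{local},3}}\Big(\frac{d\log n}{n}\Big)^{1/2}\Delta_{\mathrm{sep}}^{-(4k_*-3)}\right)\lesssim\exp(-c_{\mathrm{density}}\log n).$$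
   Context: Setting. $\Sigma$ is a known, fixed symmetric positive-definite $d\times d$ matrix with eigenvalues in $[\lambda_{\min},\lambda_{\max}]$, $0<\lambda_{\min}\le\lambda_{\max}$; $f(\cdot\mid\theta,\Sigma)$ is the density of the Gaussian $N(\theta,\Sigma)$ on $\mathbb{R}^d$. $\Theta\subset\mathbb{R}^d$ is compact and contained in the closed ball of radius $R>0$ centred at $0$. For a discrete probability measure $G=\sum_i\pi_i\delta_{\theta_i}$ put $p_G(x)=\sum_i\pi_i f(x\mid\theta_i,\Sigma)$. The true mixing measure is $G_*=\sum_{j=1}^{k_*}\pi_j^*\delta_{\theta_j^*}$ with $k_*\ge 2$, $\theta_j^*\in\Theta$, $\pi_j^*>0$, $\sum_j\pi_j^*=1$. Put $\Delta_{\mathrm{sep}}=\min_{j\ne l}\|\theta_j^*-\theta_l^*\|$ (Euclidean norm) and $\pi_{\min}^*=\min_j\pi_j^*$; both are assumed positive. $\mathcal{E}_{k_*}(\Theta)=\{\sum_{i=1}^{k_*}\pi_i\delta_{\theta_i}:\theta_i\in\Theta,\ 0\le\pi_i\le1,\ \sum_i\pi_i=1\}$. $d_H(p,q)=\big(\tfrac12\int(\sqrt p-\sqrt q)^2dx\big)^{1/2}$. $W_1$ is the 1-Wasserstein distance with respect to the Euclidean norm. Estimator. $X_1,\dots,X_n$ are i.i.d. with density $p_{G_*}$, and $\widehat G_n\in\arg\max_{G\in\mathcal{E}_{k_*}(\Theta)}\frac1n\sum_{i=1}^n\log p_G(X_i)$. Probabilities are under the true law. $\lesssim$ means inequality up to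 a positive multiplicative constant independent of $n$ and $G_*$. Constants. $C_{\mathrm{density}},c_{\mathrm{density}}$ are those of the density estimation bound $\mathbb{P}(d_H(p_{\widehat G_n},p_{G_*})>C_{\mathrm{density}}[d\log(n)/n]^{1/2})\lesssim n^{-c_{\mathrm{density}}}$. $C_{\mathrm{global},3}$ is the constant in the lower bound $d_H(p_G,p_{G_*})\ge C_{\mathrm{global},3}\pi_{\min}^*\Delta_{\mathrm{sep}}^{4k_*-3}W_1(G,G_* )$ for all $G\in\mathcal{E}_{k_*}(\Theta)$, and $C_{\mathrm{local},3}$ the constant in $d_H(p_G,p_{G_*})\ge C_{\mathrm{local},3}\Delta_{\mathrm{sep}}^{4k_*-3}W_1(G,G_* )$ for those $G=\sum_{i=1}^{k_*}\pi_i\delta_{\theta_i}\in\mathcal{E}_{k_*}(\Theta)$ such that $\|\theta_i-\theta_j^*\|\le\Delta_{\mathrm{sep}}/4$ for all $j$ and all $i\in\mathcal{V}_j=\{i:\|\theta_i-\theta_j^*\|\le\|\theta_i-\theta_\ell^*\|\ \forall\ell\ne j\}$.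
   Formalization: In the lower bound defining C_{local,3}, every cell V_j is also required to be nonempty; without this no constant depending only on R, k_*, Σ works (G_*=(1-e)δ_0+eδ_1 against a symmetric two-atom G with the same first two moments). Claims (a) and (b) are unchanged. *)

(* Defs.v *)
(* Gaussian location mixtures on R^d = 'rV[R]_d and the maximum likelihood
   estimator of their mixing measure, over MathComp-Analysis. *)
From HB Require Import structures.
From mathcomp Require Import all_boot all_order all_algebra.
From mathcomp Require Import all_classical all_reals all_analysis.

Set Implicit Arguments.
Unset Strict Implicit.
Unset Printing Implicit Defensive.

Import Order.TTheory GRing.Theory Num.Theory.
Import numFieldNormedType.Exports.

Local Open Scope classical_set_scope.
Local Open Scope ring_scope.

(* The library puts a topology but no sigma-algebra on matrices: row vectors
   get the sigma-algebra generated by the coordinates, as tuples do.  It is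
   the Borel sigma-algebra of R^n. *)
Definition rV_display : measure_display := default_measure_display.

Section rV_measurable.
Context {R : realType} (n : nat).

Definition rV_coord (i : 'I_n) (v : 'rV[R]_n) : measurableTypeR R := v ord0 i.

Let rV_set0 : g_sigma_preimage rV_coord set0.
Proof. exact: sigma_algebra0. Qed.

Let rV_setC A : g_sigma_preimage rV_coord A -> g_sigma_preimage rV_coord (~` A).
Proof. exact: sigma_algebraC. Qed.

Let rV_bigcup (F : (set 'rV[R]_n)^nat) :
  (forall i, g_sigma_preimage rV_coord (F i)) ->
  g_sigma_preimage rV_coord (\bigcup_i (F i)).
Proof. exact: sigma_algebra_bigcup. Qed.

HB.instance Definition _ := @isMeasurable.Build rV_display
  'rV[R]_n (g_sigma_preimage rV_coord) rV_set0 rV_setC rV_bigcup.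

End rV_measurable.

Section rV_measurable_theory.
Context {R : realType}.

Lemma measurable_rV_coord n (i : 'I_n) :
  measurable_fun [set: 'rV[R]_n] (rV_coord i).
Proof.
move=> _ Y mY; rewrite setTI; apply: sub_sigma_algebra => /=.
rewrite -bigcup_seq/=; exists i => /=; first by rewrite mem_index_enum.
by exists Y => //; rewrite setTI.
Qed.

Lemma measurable_fun_rVP d (T : measurableType d) n (f : T -> 'rV[R]_n) :
  (forall i, measurable_fun [set: T] (rV_coord i \o f)) ->
  measurable_fun [set: T] f.
Proof.
move=> mf _ A mA; rewrite setTI.
suff : g_sigma_preimage (@rV_coord R n) `<=` [set B | measurable (f @^-1` B)].
  by apply.
apply: smallest_sub => [|B].
  split => [|B mB|F mF] /=.
  - by rewrite preimage_set0.
  - by rewrite setTD preimage_setC; exact: measurableC.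
  - by rewrite preimage_bigcup; exact: bigcupT_measurable.
rewrite -bigcup_seq/= => -[i _ [C mC <-]] /=.
by rewrite setTI; have := mf i measurableT C mC; rewrite setTI.
Qed.

Definition rV_cons n (p : measurableTypeR R * 'rV[R]_n) : 'rV[R]_n.+1 :=
  row_mx (const_mx p.1 : 'rV[R]_1) p.2.

Definition rV_uncons n (v : 'rV[R]_n.+1) : measurableTypeR R * 'rV[R]_n :=
  (v ord0 ord0, \row_j v ord0 (lift ord0 j)).

Lemma rV_cons0 n p : rV_coord ord0 (@rV_cons n p) = p.1.
Proof.
have := row_mxEl (const_mx p.1 : 'rV[R]_1) p.2 ord0 ord0; rewrite [RHS]mxE => <-.
by congr (rV_cons p _ _); exact: val_inj.
Qed.

Lemma rV_consS n p (j : 'I_n) :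
  rV_coord (lift ord0 j) (@rV_cons n p) = rV_coord j p.2.
Proof.
rewrite /rV_coord -(row_mxEr (const_mx p.1 : 'rV[R]_1) p.2 ord0 j).
by congr (rV_cons p _ _); exact: val_inj.
Qed.

Lemma rV_consK n : cancel (@rV_cons n) (@rV_uncons n).
Proof.
move=> p; rewrite [RHS]surjective_pairing /rV_uncons; congr (_, _).
  exact: rV_cons0.
apply/rowP => j; rewrite mxE; exact: rV_consS.
Qed.

Lemma rV_unconsK n : cancel (@rV_uncons n) (@rV_cons n).
Proof.
move=> v; apply/rowP => i; rewrite -[LHS]/(rV_coord i _).
case: (unliftP ord0 i) => [j|] ->; last exact: rV_cons0.
by rewrite rV_consS /rV_coord mxE.
Qed.

Lemma measurable_rV_cons n : measurable_fun setT (@rV_cons n).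
Proof.
apply: measurable_fun_rVP => i; case: (unliftP ord0 i) => [j|] ->; last first.
  by rewrite (_ : _ \o _ = fst) //; apply/funext => p; exact: rV_cons0.
rewrite (_ : _ \o _ = rV_coord j \o snd); last first.
  by apply/funext => p; exact: rV_consS.
by apply: measurableT_comp => //; exact: measurable_rV_coord.
Qed.

Lemma measurable_rV_uncons n : measurable_fun setT (@rV_uncons n).
Proof.
apply: measurable_fun_pair; first exact: (@measurable_rV_coord n.+1 ord0).
apply: measurable_fun_rVP => i.
rewrite (_ : _ \o _ = rV_coord (lift ord0 i)); last first.
  by apply/funext => v; rewrite /rV_coord /= mxE.
exact: measurable_rV_coord.
Qed.

End rV_measurable_theory.

Section lebesgue_rV.
Context {R : realType}.

Section step.
Context (n : nat) (mu : {sigma_finite_measure set 'rV[R]_n -> \bar R}).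

Definition lebesgue_rVS : set 'rV[R]_n.+1 -> \bar R :=
  pushforward (@lebesgue_measure R \x mu)%E (@rV_cons R n).

Let preim_meas A : measurable A -> measurable (@rV_cons R n @^-1` A).
Proof. by move=> mA; rewrite -[X in measurable X]setTI; exact: measurable_rV_cons. Qed.

Let lebesgue_rVS0 : lebesgue_rVS set0 = 0%E.
Proof. by rewrite /lebesgue_rVS /pushforward preimage_set0 measure0. Qed.

Let lebesgue_rVS_ge0 A : (0 <= lebesgue_rVS A)%E.
Proof. by rewrite /lebesgue_rVS /pushforward; exact: measure_ge0. Qed.

Let lebesgue_rVS_sigma_additive : semi_sigma_additive lebesgue_rVS.
Proof.
move=> F mF tF mUF; rewrite /lebesgue_rVS /pushforward preimage_bigcup.
apply: measure_semi_sigma_additive.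
- by move=> k; exact: preim_meas.
- apply/trivIsetP => i j _ _ ij; rewrite -preimage_setI.
  by move/trivIsetP : tF => /(_ _ _ _ _ ij) ->//; rewrite preimage_set0.
- by rewrite -preimage_bigcup; exact: preim_meas.
Qed.

HB.instance Definition _ := isMeasure.Build _ _ _ lebesgue_rVS
  lebesgue_rVS0 lebesgue_rVS_ge0 lebesgue_rVS_sigma_additive.

Let prod_sigma_finite : sigma_finite setT (@lebesgue_measure R \x mu)%E.
Proof.
have /sigma_finiteP[F [TF ndF Foo]] := sigma_finiteT (@lebesgue_measure R).
have /sigma_finiteP[G [TG ndG Goo]] := sigma_finiteT mu.
exists (fun k => F k `*` G k).
  rewrite -setXTT TF TG predeqE => -[x y]; split.
    move=> [/= [i _ Fix] [j _ Gjy]]; exists (maxn i j) => //; split.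
    - by move: x Fix; exact/subsetPset/ndF/leq_maxl.
    - by move: y Gjy; exact/subsetPset/ndG/leq_maxr.
  by move=> [i _ []/= ? ?]; split; exists i.
move=> k; have [? ?] := Foo k; have [? ?] := Goo k.
split; first exact: measurableX.
by rewrite product_measure1E// lte_mul_pinfty// ge0_fin_numE.
Qed.

Let lebesgue_rVS_sigma_finite : sigma_finite setT lebesgue_rVS.
Proof.
have [H UH mH] := prod_sigma_finite.
exists (fun k => @rV_uncons R n @^-1` H k).
  by rewrite -preimage_bigcup -UH preimage_setT.
move=> k; have [mHk Hoo] := mH k; split.
  by have := @measurable_rV_uncons R n measurableT _ mHk; rewrite setTI.
rewrite /lebesgue_rVS /pushforward -comp_preimage.
by rewrite (_ : _ \o _ = id) ?preimage_id //; apply/funext/rV_consK.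
Qed.

HB.instance Definition _ := Measure_isSigmaFinite.Build _ _ _ lebesgue_rVS
  lebesgue_rVS_sigma_finite.

End step.

(* Lebesgue measure on R^n, through R^(n+1) = R x R^n. *)
Fixpoint lebesgue_rV (n : nat) : {sigma_finite_measure set 'rV[R]_n -> \bar R} :=
  match n with
  | 0 => \d_(0 : 'rV[R]_0)
  | m.+1 => lebesgue_rVS (lebesgue_rV m)
  end.

End lebesgue_rV.
Arguments lebesgue_rV {R} n.

Lemma lebesgue_rV_box (R : realType) n (A : 'I_n -> set (measurableTypeR R)) :
  (forall i, measurable (A i)) ->
  lebesgue_rV n [set v | forall i, A i (rV_coord i v)] =
  (\prod_(i < n) lebesgue_measure (A i))%E.
Proof.
elim: n A => [|n IH] A mA.
  rewrite big_ord0 /= (_ : [set _ | _] = setT) ?diracT//.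
  by rewrite predeqE => v; split => // _ [].
rewrite big_ord_recl -(IH (fun i => A (lift ord0 i))) // -product_measure1E//.
  rewrite /= /lebesgue_rVS /pushforward; congr product_measure1.
  rewrite predeqE => p; split => [Ap|[A0 AS] i] /=.
    split=> /= [|i]; first by have := Ap ord0; rewrite rV_cons0.
    by have := Ap (lift ord0 i); rewrite rV_consS.
  by case: (unliftP ord0 i) => [j|] ->; rewrite ?rV_consS ?rV_cons0 //; exact: AS.
rewrite (_ : [set _ | _] =
    \bigcap_(i in [set: 'I_n]) (rV_coord i @^-1` A (lift ord0 i))); last first.
  by rewrite predeqE => v; split => [Av i _|Av i]; exact: Av.
apply: fin_bigcap_measurable => [|i _]; first exact: finite_finset.
by rewrite -[X in measurable X]setTI; exact: measurable_rV_coord.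
Qed.

Section mixtures.
Context {R : realType} {d : nat}.
Implicit Types (x y : 'rV[R]_d) (Sigma : 'M[R]_d) (Theta : set 'rV[R]_d).

(* Euclidean norm; the library's norm `|x| on row vectors is the sup norm. *)
Definition enorm x : R := Num.sqrt (\sum_(i < d) x ord0 i ^+ 2).

Definition covariance_matrix Sigma (lmin lmax : R) : Prop :=
  [/\ Sigma^T = Sigma,
      forall v : 'rV[R]_d, v != 0 -> 0 < (v *m Sigma *m v^T) ord0 ord0 &
      forall a : R, eigenvalue Sigma a -> lmin <= a <= lmax].

Definition gauss_density Sigma (theta x : 'rV[R]_d) : R :=
  (Num.sqrt ((2 * pi) ^+ d * \det Sigma))^-1 *
  expR (- 2^-1 * ((x - theta) *m invmx Sigma *m (x - theta)^T) ord0 ord0).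

(* A discrete measure sum_i weight i * delta_(atom i), given by its k
   (possibly repeated, possibly weightless) atoms. *)
Record mixing k := Mixing { weight : 'I_k -> R ; atom : 'I_k -> 'rV[R]_d }.

Definition mixing_measure k (G : mixing k) (A : set 'rV[R]_d) : \bar R :=
  (\sum_(i < k) (weight G i)%:E * \d_(atom G i) A)%E.

Definition mix_density Sigma k (G : mixing k) x : R :=
  \sum_(i < k) weight G i * gauss_density Sigma (atom G i) x.

Definition mix_class k Theta : set (mixing k) :=
  [set G | [/\ forall i, Theta (atom G i),
               forall i, 0 <= weight G i <= 1 &
               \sum_(i < k) weight G i = 1]].

Definition sep k (G : mixing k) : R :=
  inf [set enorm (atom G j.1 - atom G j.2) | j in [set j | j.1 != j.2]].

Definition min_weight k (G : mixing k) : R := inf (range (weight G)).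

Definition true_mixing k Theta (G : mixing k) : Prop :=
  [/\ forall j, Theta (atom G j), forall j, 0 < weight G j,
      \sum_(j < k) weight G j = 1 & 0 < sep G].

Definition voronoi k (Gs G : mixing k) (j : 'I_k) : set 'I_k :=
  [set i | forall l, l != j ->
     enorm (atom G i - atom Gs j) <= enorm (atom G i - atom Gs l)].

(* Every cell is required to contain an atom of G: if empty cells were allowed,
   the local lower bound on the Hellinger distance would fail.  In dimension 1
   take Gs = (1 - e) delta_0 + e delta_1 and G uniform on the two points
   e - s, e + s with s^2 = e - e^2: the first two moments agree, the Hellinger
   distance is O(e), but W1 is of order sqrt e. *)
Definition local_nbhd k (Gs G : mixing k) : Prop :=
  forall j, voronoi Gs G j !=set0 /\
    forall i, voronoi Gs G j i -> enorm (atom G i - atom Gs j) <= sep Gs / 4.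

Definition coupling (mu nu : set 'rV[R]_d -> \bar R)
    (g : probability ('rV[R]_d * 'rV[R]_d)%type R) : Prop :=
  forall A, measurable A ->
    g (A `*` setT) = mu A /\ g (setT `*` A) = nu A.

Definition wasserstein1 (mu nu : set 'rV[R]_d -> \bar R) : \bar R :=
  ereal_inf [set (\int[g]_z (enorm (z.1 - z.2))%:E)%E | g in coupling mu nu].

Definition W1 k (G H : mixing k) : \bar R :=
  wasserstein1 (mixing_measure G) (mixing_measure H).

Definition hellinger (p q : 'rV[R]_d -> R) : R :=
  Num.sqrt (2^-1 *
    (\int[lebesgue_rV d]_x (Num.sqrt (p x) - Num.sqrt (q x)) ^+ 2)%R).

Definition dH Sigma k (G H : mixing k) : R :=
  hellinger (mix_density Sigma G) (mix_density Sigma H).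

Definition independent dO (O : measurableType dO) (P : probability O R) n
    (X : 'I_n -> {RV P >-> 'rV[R]_d}) : Prop :=
  forall (J : {set 'I_n}) (A : 'I_n -> set 'rV[R]_d),
    (forall i, measurable (A i)) ->
    P (\bigcap_(i in [set` J]) (X i @^-1` A i)) =
    (\prod_(i in J) P (X i @^-1` A i))%E.

Definition iid_sample dO (O : measurableType dO) (P : probability O R) n
    (X : 'I_n -> {RV P >-> 'rV[R]_d}) (p : 'rV[R]_d -> R) : Prop :=
  independent X /\
  forall i (A : set 'rV[R]_d), measurable A ->
    distribution P (X i) A = (\int[lebesgue_rV d]_(x in A) (p x)%:E)%E.

Definition log_lik Sigma k n (x : 'I_n -> 'rV[R]_d) (G : mixing k) : R :=
  n%:R^-1 * \sum_(i < n) ln (mix_density Sigma G (x i)).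

Definition is_mle Sigma Theta k n (x : 'I_n -> 'rV[R]_d) (Gh : mixing k) : Prop :=
  mix_class Theta Gh /\
  forall G : mixing k, mix_class Theta G -> log_lik Sigma x G <= log_lik Sigma x Gh.

(* For n i.i.d. observations from the mixture with mixing measure Gs, on any
   probability space, every maximum likelihood estimator over the k-atom
   mixing measures on Theta satisfies the event E with probability at most b.
   An argmax selection need not be measurable, hence the outer probability;
   it is the probability whenever the event is measurable
   (measurable_mu_extE). *)
Definition mle_prob_le Sigma Theta k (Gs : mixing k) n
    (E : set (mixing k)) (b : R) : Prop :=
  forall dO (O : measurableType dO) (P : probability O R)
    (X : 'I_n -> {RV P >-> 'rV[R]_d}) (Gh : O -> mixing k),
  iid_sample X (mix_density Sigma Gs) ->
  (forall w, is_mle Sigma Theta (fun i => X i w) (Gh w)) ->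
  ((P^*)%mu [set w | E (Gh w)] <= b%:E)%E.

Definition rate n : R := Num.sqrt (d%:R * ln n%:R / n%:R).

End mixtures.
Arguments mixing R d k : clear implicits.
Arguments rate R d n : clear implicits.

(* Main.v *)
Require Import Defs.
From HB Require Import structures.
From mathcomp Require Import all_boot all_order all_algebra.
From mathcomp Require Import all_classical all_reals all_analysis.
From mathcomp Require Import measurable_realfun ring lra.

(** The Hellinger distance h = dH(G, H) is compared with W1(G, H) by means of
    exponential test functions, and the estimator is controlled by a finite net
    and Chernoff's bound.

    From h to moments.  A Gaussian of centre theta multiplied by exp (s . x) has an
    integral equal to exp (s . theta) times a factor that depends on s only
    ([gauss_laplace]).  Hence the integral of exp (s . x) against p_G is, up to that
    factor, the moment of exp (s . theta) under G, and by Cauchy-Schwarz the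
    moments of G and H differ by at most C h ([laplace_dist_le_dH]).  In the
    coordinates z = exp theta, which are bi-Lipschitz on a ball, exponential sums in
    theta become polynomials in z, so that h controls the difference of the
    moments of all polynomials in z of bounded degree and coefficients.

    From moments to atoms.  Let z_l be the atoms of H, let q_l be their weights, and
    let Delta be their separation.  The polynomials prod_l |v - z_l|^2,
    prod_(l <> j) |v - z_l|^2 and (w . (v - z_j)) prod_(l <> j) |v - z_l|^2 isolate
    the contribution of one atom.  There are two cases.

    - Some z_j has no atom of G within Delta / 4.  At the atoms of G the second
      polynomial is then bounded by C Delta^-2 times the first one, so its moment
      under G is at most C Delta^-2 h, while under H it is at least
      q_j Delta^(2k - 2), up to a constant.  Therefore h >= c q_j Delta^(2k), and
      2k <= 4k - 3 ([missed_atom_bound], [dH_ge_missed]).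

    - Otherwise the atoms of G and H are in bijection.  Let u_j be the displacement
      of the j-th atom and p_j its weight in G.  The first polynomial bounds
      p_j |u_j|^2 by C h Delta^-(2k - 2).  This controls the cross terms in the
      moment of the third one, which then bounds p_j |u_j| by C h Delta^-(4k - 4).
      Finally the second one bounds |p_j - q_j| by C h Delta^-(4k - 3), a factor
      Delta being lost because its logarithm varies at speed 1 / Delta
      ([matched_bound]).  A transport plan turns these bounds into one on W1
      ([W1_le_matched], [dH_ge_matched]).

    The second case is the local bound, which needs no weights ([dH_ge_covering]).
    Together with the first case, in which W1 is at most a constant, it gives the
    global one ([dH_ge_W1]).

    The estimator.  The mixing measures on Theta are split into cells of mesh n^-2
    in each of the k (d + 1) parameters.  On the cube of size n, which the sample
    leaves with probability O(n exp (- n)), each density of a cell is at most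
    exp (A / n) times an envelope built from any one member G' of the cell
    ([mix_le_envelope], [gauss_ratio]).  If the estimator falls into the cell, the
    likelihood ratio of the envelope to the truth is bounded below.  The
    expectation of the square root of this ratio is at most
    (1 - dH(G', H)^2 + O(1 / n))^n ([envelope_affinity], [likelihood_ratio_tail]), so
    a cell with a member at distance above C (d log n / n)^(1/2) has probability
    O(n^-(C^2 d)).  Choosing C^2 d = 2 k (d + 1) + 1, the sum over the
    O(n^(2 k (d + 1))) cells is O(1 / n) ([mle_dH_rate]).

    Part (a) combines this rate with the global bound.  For (b), when n is large
    the rate is below the lower bound on dH in the first case, so only the second
    case occurs and the local bound applies. *)

Set Implicit Arguments.
Unset Strict Implicit.
Unset Printing Implicit Defensive.

Import Order.TTheory GRing.Theory Num.Theory.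
Import numFieldNormedType.Exports.

Local Open Scope classical_set_scope.
Local Open Scope ring_scope.

(** * Integration on row vectors *)

Section integration_rV.
Context {R : realType}.
Local Notation mu := (@lebesgue_measure R).

Lemma measurable_rV_entry n (i : 'I_n) :
  measurable_fun setT (fun v : 'rV[R]_n => v ord0 i).
Proof. exact: measurable_rV_coord. Qed.

Lemma ge0_integral_rVS n (f : 'rV[R]_n.+1 -> \bar R) :
  measurable_fun setT f -> (forall x, 0 <= f x)%E ->
  (\int[lebesgue_rV n.+1]_x f x =
   \int[mu]_a \int[lebesgue_rV n]_v f (rV_cons (a, v)))%E.
Proof.
move=> mf f0.
have mc := @measurable_rV_cons R n.
pose mcf : {mfun _ >-> _} := HB.pack (@rV_cons R n) (isMeasurableFun.Build _ _ _ _ _ mc).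
transitivity (\int[pushforward (mu \x lebesgue_rV n)%E mcf]_x f x)%E.
  by apply: eq_measure_integral.
rewrite ge0_integral_pushforward//= preimage_setT.
rewrite (fubini_tonelli1 (f \o @rV_cons R n))//.
  exact: measurableT_comp.
by move=> x; exact: f0.
Qed.

Lemma measurable_section_rV n (f : 'rV[R]_n.+1 -> \bar R) (a : measurableTypeR R) :
  measurable_fun setT f -> measurable_fun setT (fun v => f (rV_cons (a, v))).
Proof.
move=> mf; apply: measurableT_comp => //.
exact: (measurableT_comp (@measurable_rV_cons R n) (pair1_measurable a)).
Qed.

(** The shifted measure agrees with Lebesgue measure on half-open intervals,
    which determine the latter. *)
Lemma lebesgue_measure_shift (t : R) (f : R -> \bar R) :
  measurable_fun setT f -> (forall x, 0 <= f x)%E ->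
  (\int[mu]_x f (x + t)%R = \int[mu]_x f x)%E.
Proof.
move=> mf f0.
pose sh (x : measurableTypeR R) : measurableTypeR R := x + t.
have msh : measurable_fun setT sh by exact: measurable_funD.
pose shf : {mfun _ >-> _} := HB.pack sh (isMeasurableFun.Build _ _ _ _ _ msh).
transitivity (\int[pushforward mu shf]_x f x)%E.
  by rewrite ge0_integral_pushforward.
apply: eq_measure_integral => A mA _; apply/esym/lebesgue_measure_unique => //.
move=> _ [[a b]] _ <- /=; rewrite /pushforward.
rewrite (_ : shf @^-1` _ = `]a - t, b - t]%classic); last first.
  by apply/seteqP; split => x; rewrite /= !in_itv/= /sh ltrBlDr lerBrDr.
rewrite !lebesgue_measure_itv/= !lte_fin ltrD2r.
by case: ifP => // _; rewrite -!EFinD; congr EFin; ring.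
Qed.

Lemma rV_consD n (a b : R) (v w : 'rV[R]_n) :
  rV_cons (a, v) + rV_cons (b, w) = rV_cons (a + b, v + w).
Proof.
apply/rowP => i; rewrite mxE -3![_ ord0 i]/(rV_coord i _).
by case: (unliftP ord0 i) => [j|] ->; rewrite ?rV_cons0 ?rV_consS ?{1}/rV_coord ?mxE.
Qed.

Lemma measurable_rVD n (t : 'rV[R]_n) : measurable_fun setT (fun x : 'rV[R]_n => x + t).
Proof.
apply: measurable_fun_rVP => i.
rewrite (_ : _ \o _ = fun x : 'rV[R]_n => x ord0 i + t ord0 i); last first.
  by apply/funext => x; rewrite /rV_coord /= mxE.
by apply: measurable_funD => //; exact: measurable_rV_entry.
Qed.

Lemma integral_rV_shift n (t : 'rV[R]_n) (f : 'rV[R]_n -> \bar R) :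
  measurable_fun setT f -> (forall x, 0 <= f x)%E ->
  (\int[lebesgue_rV n]_x f (x + t)%R = \int[lebesgue_rV n]_x f x)%E.
Proof.
elim: n t f => [|n IH] t f mf f0.
  by apply: eq_integral => x _; congr f; apply/rowP => -[].
have -> : t = rV_cons (rV_uncons t) by rewrite rV_unconsK.
move: (rV_uncons t) => [b w].
rewrite (ge0_integral_rVS (n:=n)); last 2 first.
- exact: (measurableT_comp mf (measurable_rVD _)).
- by move=> x; exact: f0.
rewrite (ge0_integral_rVS mf f0).
pose F a := (\int[lebesgue_rV n]_v f (rV_cons (a, v)))%E.
transitivity (\int[mu]_a F (a + b)%R)%E.
  apply: eq_integral => a _; under eq_integral do rewrite rV_consD.
  exact: (IH w (fun v => f (rV_cons (a + b, v))) (measurable_section_rV (a + b) mf) (fun _ => f0 _)).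
apply: (lebesgue_measure_shift b (f := F)); last first.
  by move=> a; exact: integral_ge0.
apply: (measurable_fun_fubini_tonelli_F (f \o @rV_cons R n)).
  exact: (measurableT_comp mf (@measurable_rV_cons R n)).
by move=> x; exact: f0.
Qed.

Lemma integral_rV_prod n (f : 'I_n -> R -> R) :
  (forall i, measurable_fun setT (f i)) -> (forall i x, 0 <= f i x) ->
  (\int[lebesgue_rV n]_x (\prod_i f i (x ord0 i))%:E =
   \prod_i \int[mu]_x (f i x)%:E)%E.
Proof.
elim: n f => [|n IH] f mf f0.
  rewrite big_ord0 /=; under eq_integral do rewrite big_ord0.
  by rewrite integral_dirac// diracT mul1e.
have mF (m : nat) (g : 'I_m -> R -> R) : (forall i, measurable_fun setT (g i)) ->
    measurable_fun setT (fun x : 'rV[R]_m => (\prod_i g i (x ord0 i))%:E).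
  move=> mg; apply/measurable_EFinP; apply: measurable_prod => i _.
  by apply: measurableT_comp => //; exact: measurable_rV_entry.
rewrite (ge0_integral_rVS (n:=n)); [|exact: mF|by move=> x; rewrite lee_fin prodr_ge0].
rewrite big_ord_recl -(IH (fun i => f (lift ord0 i)))//.
rewrite -ge0_integralZr//; last 3 first.
- by apply/measurable_EFinP; exact: mf.
- by move=> x _; rewrite lee_fin.
- by apply: integral_ge0 => x _; rewrite lee_fin prodr_ge0.
apply: eq_integral => a _.
rewrite -ge0_integralZl//; last 3 first.
  - exact: (mF _ (fun i => f (lift ord0 i))).
  - by move=> x _; rewrite lee_fin prodr_ge0.
  - by rewrite lee_fin.
apply: eq_integral => v _; rewrite big_ord_recl EFinM.
congr (_%:E * _%:E)%E; first by congr f; exact: rV_cons0.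
by apply: eq_bigr => i _; congr f; exact: rV_consS.
Qed.

End integration_rV.

(** * Gaussian integrals *)

Section gaussian_integral.
Context {R : realType}.
Local Notation mu := (@lebesgue_measure R).

(** This is the integral of the normal density of variance 1 / (2 a), freed of
    its normalization. *)
Lemma integral_exp_sqr (a : R) : 0 < a ->
  exists2 c, 0 < c & (\int[mu]_x (expR (- a * x ^+ 2))%:E = c%:E)%E.
Proof.
move=> a0; pose s := Num.sqrt (2 * a)^-1.
have s2 : s ^+ 2 = (2 * a)^-1 by rewrite sqr_sqrtr// invr_ge0 mulr_ge0// ltW.
have sN0 : s != 0 by rewrite gt_eqF// sqrtr_gt0 invr_gt0 mulr_gt0.
have pk := normal_peak_gt0 sN0.
have := integral_normal_pdf (0 : R) s.
under eq_integral do rewrite normal_pdfE// /normal_fun EFinM.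
rewrite ge0_integralZl//; last 2 first.
- by apply/measurable_EFinP; exact: (measurable_normal_fun 0 s).
- by rewrite lee_fin ltW.
rewrite (_ : (fun _ => _) = fun x => (expR (- a * x ^+ 2))%:E); last first.
  apply/funext => x; congr (expR _)%:E; rewrite subr0 s2.
  by rewrite mulrC -mulr_natr; field; rewrite gt_eqF.
set I := (\int[mu]_x _)%E => pI; exists (normal_peak s)^-1; first by rewrite invr_gt0.
move: pI; case: I => [r| |] //=.
- by rewrite -EFinM => -[h]; congr EFin; rewrite -(mulr1 (_^-1)) -h mulKf ?gt_eqF.
- by rewrite gt0_muley ?lte_fin.
- by rewrite gt0_muleNy ?lte_fin.
Qed.

Lemma integral_rV_exp_sqr n (a : R) : 0 < a ->
  exists2 c, 0 < c &
    (\int[lebesgue_rV n]_x (expR (- a * \sum_i x ord0 i ^+ 2))%:E = c%:E)%E.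
Proof.
move=> a0; have [c c0 hc] := integral_exp_sqr a0.
exists (c ^+ n); first exact: exprn_gt0.
under eq_integral do rewrite mulr_sumr expR_sum.
rewrite (@integral_rV_prod _ _ (fun _ x => expR (- a * x ^+ 2))); last 2 first.
- move=> _; apply: measurableT_comp => //; apply: measurable_funM => //.
- by move=> _ x; exact: expR_ge0.
by rewrite (eq_bigr (fun=> c%:E)) // prodEFin prodr_const card_ord.
Qed.

End gaussian_integral.

(** * Quadratic forms of positive definite matrices *)

Section covariance.
Context {R : realType} {d : nat}.
Implicit Types (x y s : 'rV[R]_d) (A S : 'M[R]_d).

Definition dotrv s x : R := \sum_i s ord0 i * x ord0 i.

Definition qform A x : R := (x *m A *m x^T) ord0 ord0.

Definition sqnorm x : R := \sum_i x ord0 i ^+ 2.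

Lemma dotrvE s x : dotrv s x = (s *m x^T) ord0 ord0.
Proof. by rewrite mxE; apply: eq_bigr => i _; rewrite mxE. Qed.

Lemma sqnormE x : sqnorm x = (x *m x^T) ord0 ord0.
Proof. by rewrite -dotrvE; apply: eq_bigr => i _; rewrite expr2. Qed.

Lemma dotrvDl s t x : dotrv (s + t) x = dotrv s x + dotrv t x.
Proof. by rewrite /dotrv -big_split; apply: eq_bigr => i _; rewrite mxE mulrDl. Qed.

Lemma dotrv0l x : dotrv 0 x = 0.
Proof. by apply: big1 => i _; rewrite mxE mul0r. Qed.

Lemma qformE A x : qform A x = \sum_i \sum_j x ord0 i * A i j * x ord0 j.
Proof.
rewrite /qform mxE exchange_big/=; apply: eq_bigr => j _.
by rewrite !mxE mulr_suml; apply: eq_bigr => i _.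
Qed.

Lemma sqnorm_ge0 x : 0 <= sqnorm x.
Proof. by apply: sumr_ge0 => i _; exact: sqr_ge0. Qed.

Lemma sqr_entry_le x i : x ord0 i ^+ 2 <= sqnorm x.
Proof.
rewrite /sqnorm (bigD1 i)//= lerDl; apply: sumr_ge0 => j _; exact: sqr_ge0.
Qed.

Lemma qform_le A : exists2 b, 0 < b & forall x, qform A x <= b * sqnorm x.
Proof.
exists (1 + \sum_i \sum_j `|A i j|).
  by rewrite ltr_wpDr//; do 2 (apply: sumr_ge0 => ? _).
move=> x; rewrite mulrDl mul1r ler_wpDl ?sqnorm_ge0//.
rewrite qformE mulr_suml; apply: ler_sum => i _.
rewrite mulr_suml; apply: ler_sum => j _.
have hi := sqr_entry_le x i; have hj := sqr_entry_le x j.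
rewrite (le_trans (ler_norm _))// !normrM mulrAC mulrC ler_wpM2l//.
rewrite -[_ ^+ 2]real_normK ?num_real// in hi.
rewrite -[_ ^+ 2]real_normK ?num_real// in hj.
by have := sqr_ge0 (`|x ord0 i| - `|x ord0 j|); rewrite sqrrB; lra.
Qed.

Section positive_definite.
Variable S : 'M[R]_d.
Hypothesis symS : S^T = S.
Hypothesis posS : forall v : 'rV[R]_d, v != 0 -> 0 < qform S v.

Lemma posdef_unit : S \in unitmx.
Proof.
rewrite -row_free_unit; apply: inj_row_free => v vS.
apply/eqP; apply/negPn/negP => /posS.
by rewrite /qform vS mul0mx mxE ltxx.
Qed.

Lemma posdef_ge0 x : 0 <= qform S x.
Proof.
have [->|/posS/ltW//] := eqVneq x 0.
by rewrite /qform mul0mx mul0mx mxE.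
Qed.

(** Completing the square in the exponent of a tilted Gaussian. *)
Lemma qform_inv_shift s x :
  qform (invmx S) (x - s *m S) =
  qform (invmx S) x - 2 * dotrv s x + qform S s.
Proof.
have uS := posdef_unit.
have iT : (invmx S)^T = invmx S by rewrite trmx_inv symS.
have -> : qform (invmx S) (x - s *m S) = qform (invmx S) x
   - (x *m invmx S *m (s *m S)^T) ord0 ord0 - (s *m S *m invmx S *m x^T) ord0 ord0
   + (s *m S *m invmx S *m (s *m S)^T) ord0 ord0.
  rewrite /qform linearB/= !mulmxBl !mulmxBr !mxE; ring.
rewrite mulmxK// trmx_mul symS !mulmxA mulmxKV// dotrvE.
have -> : (x *m s^T) ord0 ord0 = (s *m x^T) ord0 ord0.
  by rewrite -[in RHS](trmxK s) -trmx_mul [RHS]mxE.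
rewrite /qform; ring.
Qed.

(** The value of the inverse form at x is the value of S at x S^-1: complete the
    square there. *)
Lemma posdef_inv_ge0 x : 0 <= qform (invmx S) x.
Proof.
have := qform_inv_shift (x *m invmx S) x.
rewrite mulmxKV ?posdef_unit// subrr.
have -> : qform (invmx S) 0 = 0 by rewrite /qform !mul0mx mxE.
have := posdef_ge0 (x *m invmx S).
have -> : dotrv (x *m invmx S) x = qform (invmx S) x by rewrite dotrvE.
lra.
Qed.

(** Expanding the inverse form at x - t x S, which is nonnegative, gives a lower
    bound that the upper bound b on S turns into |x|^2 / b for t = 1 / b. *)
Lemma qform_inv_ge : exists2 a, 0 < a & forall x, a * sqnorm x <= qform (invmx S) x.
Proof.
have [b b0 hb] := qform_le S; exists b^-1; first by rewrite invr_gt0.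
move=> x; have := posdef_inv_ge0 (x - (b^-1 *: x) *m S).
rewrite qform_inv_shift.
have -> : dotrv (b^-1 *: x) x = b^-1 * sqnorm x.
  by rewrite dotrvE sqnormE -scalemxAl mxE.
have -> : qform S (b^-1 *: x) = b^-1 * (b^-1 * qform S x).
  by rewrite /qform linearZ/= -scalemxAl -scalemxAl -scalemxAr !mxE.
have : b^-1 * (b^-1 * qform S x) <= b^-1 * sqnorm x.
  by apply: ler_wpM2l; rewrite ?invr_ge0 ?(ltW b0)// mulrC ler_pdivrMr// mulrC.
lra.
Qed.

(** The characteristic polynomial of - S is monic, hence positive far to the
    right, and has no root t >= 0, since x (- S) = t x would make the form
    nonpositive at x.  By the intermediate value theorem it is positive at 0,
    where its value is det S. *)
Lemma posdef_det_gt0 : 0 < \det S.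
Proof.
pose p := char_poly (- S).
have p0 : p.[0] = \det S.
  by rewrite horner_coef0 char_poly_det -[- S]scaleN1r detZ mulrA -exprMn mulrNN mul1r expr1n mul1r.
have nr t : 0 <= t -> ~~ root p t.
  move=> t0; apply/negP; rewrite -eigenvalue_root_char => /eigenvalueP[v vS v0].
  have := posS v0; rewrite /qform -(opprK S) mulmxN vS mulNmx -scalemxAl.
  rewrite 2!mxE -sqnormE oppr_gt0 ltNge mulr_ge0 ?sqnorm_ge0//.
rewrite -p0 ltNge; apply/negP => p00.
have [b hb] := monic_Cauchy_bound (char_poly_monic (- S)).
have bb : b <= Num.max b 0 by rewrite le_max lexx.
have b0 : 0 <= Num.max b 0 by rewrite le_max lexx orbT.
have [|t /andP[t0 _]] := poly_ivt b0 (p := p).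
  by rewrite p00 ltW// hb.
by apply/negP; exact: nr.
Qed.

End positive_definite.

End covariance.

(** * Laplace transforms of Gaussian mixtures *)

Section gaussian.
Context {R : realType} {d : nat}.
Variable S : 'M[R]_d.
Hypothesis symS : S^T = S.
Hypothesis posS : forall v : 'rV[R]_d, v != 0 -> 0 < qform S v.
Implicit Types (x s theta : 'rV[R]_d).
Local Notation lam := (@lebesgue_rV R d).
Local Notation gauss := (gauss_density S).

Lemma gaussE theta x : gauss theta x =
  (Num.sqrt ((2 * pi) ^+ d * \det S))^-1 *
  expR (- 2^-1 * qform (invmx S) (x - theta)).
Proof. by []. Qed.

Lemma gauss_gt0 theta x : 0 < gauss theta x.
Proof.
rewrite mulr_gt0 ?expR_gt0// invr_gt0 sqrtr_gt0 mulr_gt0 ?posdef_det_gt0//.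
by rewrite exprn_gt0// mulr_gt0 ?pi_gt0.
Qed.

Lemma measurable_dotrv s : measurable_fun setT (dotrv s).
Proof.
apply: measurable_sum => i; apply: measurable_funM => //.
exact: measurable_rV_entry.
Qed.

Lemma measurable_gauss theta : measurable_fun setT (gauss theta).
Proof.
apply: measurable_funM => //; apply: measurableT_comp => //.
apply: measurable_funM => //.
apply: (@measurableT_comp _ _ _ _ _ _ (qform (invmx S)) _ (fun x => x - theta)); last first.
  exact: measurable_rVD.
rewrite (_ : qform _ = fun x => \sum_i \sum_j x ord0 i * invmx S i j * x ord0 j).
  apply: measurable_sum => i; apply: measurable_sum => j.
  by apply: measurable_funM; [apply: measurable_funM|]; rewrite //; exact: measurable_rV_entry.
by apply/funext => x; exact: qformE.
Qed.

(** The mass is 1, but its value is kept symbolic: the lower bounds on the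
    Hellinger distance need only that it is positive and finite, and in the
    statistical part a sample with density [mix_density] forces it to be 1. *)
Definition gauss_mass : R := \int[lam]_x gauss 0 x.

Lemma measurable_sqnorm : measurable_fun setT (@sqnorm R d).
Proof.
apply: measurable_sum => i; apply: measurable_funX; exact: measurable_rV_entry.
Qed.

Let peak_gt0 : 0 < (Num.sqrt ((2 * pi) ^+ d * \det S))^-1.
Proof.
rewrite invr_gt0 sqrtr_gt0 mulr_gt0 ?posdef_det_gt0//.
by rewrite exprn_gt0// mulr_gt0 ?pi_gt0.
Qed.

(** The quadratic form of the inverse covariance lies between two multiples of
    the squared norm, whose exponentials factor over the coordinates. *)
Lemma gauss_mass_bounds :
  (\int[lam]_x (gauss 0 x)%:E = gauss_mass%:E)%E /\ 0 < gauss_mass.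
Proof.
have [a a0 ha] := qform_inv_ge symS posS.
have [b b0 hb] := qform_le (invmx S).
have cmp (c : R) : 0 < c -> exists2 r, 0 < r &
    (\int[lam]_x ((Num.sqrt ((2 * pi) ^+ d * \det S))^-1 * expR (- c * sqnorm x))%:E = r%:E)%E.
  move=> c0; have [r r0 hr] := integral_rV_exp_sqr d c0.
  exists ((Num.sqrt ((2 * pi) ^+ d * \det S))^-1 * r); first by rewrite mulr_gt0.
  under eq_integral do rewrite EFinM; rewrite ge0_integralZl//.
  - by rewrite hr.
  - apply/measurable_EFinP; apply: measurableT_comp => //; apply: measurable_funM => //.
    exact: measurable_sqnorm.
have mexp c : measurable_fun setT (fun x : 'rV[R]_d =>
    ((Num.sqrt ((2 * pi) ^+ d * \det S))^-1 * expR (- c * sqnorm x))%:E).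
  apply/measurable_EFinP; apply: measurable_funM => //.
  apply: measurableT_comp => //; apply: measurable_funM => //.
  exact: measurable_sqnorm.
have [|u u0 hu] := cmp (2^-1 * a); first by lra.
have [|l l0 hl] := cmp (2^-1 * b); first by lra.
have g0 x : (0 <= (gauss 0 x)%:E)%E by rewrite lee_fin ltW ?gauss_gt0.
have mg : measurable_fun setT (fun x => (gauss 0 x)%:E).
  by apply/measurable_EFinP; exact: measurable_gauss.
have up : (\int[lam]_x (gauss 0 x)%:E <= u%:E)%E.
  rewrite -hu; apply: ge0_le_integral => // x _.
  rewrite lee_fin gaussE subr0 ler_wpM2l ?(ltW peak_gt0)// ler_expR.
  by have := ha x; lra.
have lo : (l%:E <= \int[lam]_x (gauss 0 x)%:E)%E.
  rewrite -hl; apply: ge0_le_integral => //.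
  move=> x _; rewrite lee_fin gaussE subr0 ler_wpM2l ?(ltW peak_gt0)// ler_expR.
  by have := hb x; lra.
have fin : (\int[lam]_x (gauss 0 x)%:E)%E \is a fin_num.
  rewrite ge0_fin_numE; first exact: (le_lt_trans up (ltry _)).
  exact: integral_ge0.
rewrite /gauss_mass /Rintegral fineK//; split => //.
by rewrite -lte_fin fineK// (lt_le_trans _ lo)// lte_fin.
Qed.

Lemma gauss_mass_gt0 : 0 < gauss_mass.
Proof. by have [] := gauss_mass_bounds. Qed.

Lemma integral_gauss theta : (\int[lam]_x (gauss theta x)%:E = gauss_mass%:E)%E.
Proof.
have [<- _] := gauss_mass_bounds.
rewrite -(integral_rV_shift theta).
- by apply: eq_integral => x _; rewrite !gaussE addrK subr0.
- by apply/measurable_EFinP; exact: measurable_gauss.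
- by move=> x; rewrite lee_fin ltW ?gauss_gt0.
Qed.

(** Multiplying a Gaussian by the exponential of a linear form moves its centre by
    s S and rescales it; hence its integral depends on the centre through
    exp (s . theta) only. *)
Lemma gauss_tilt s theta x :
  expR (dotrv s x) * gauss theta x =
  expR (dotrv s theta + 2^-1 * qform S s) * gauss (theta + s *m S) x.
Proof.
rewrite !gaussE opprD addrA qform_inv_shift// mulrCA [RHS]mulrCA -!expRD.
congr (_ * expR _); have : dotrv s x = dotrv s theta + dotrv s (x - theta).
  by rewrite /dotrv -big_split/=; apply: eq_bigr => i _; rewrite !mxE; ring.
move=> ->; move: (qform _ _) (dotrv s theta) (dotrv s _) (qform S s) => q u v w.
by field.
Qed.

Lemma gauss_laplace s theta :
  (\int[lam]_x (expR (dotrv s x) * gauss theta x)%:E =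
   (expR (dotrv s theta + 2^-1 * qform S s) * gauss_mass)%:E)%E.
Proof.
under eq_integral do rewrite gauss_tilt EFinM.
rewrite ge0_integralZl//.
- by rewrite integral_gauss.
- by apply/measurable_EFinP; exact: measurable_gauss.
- by move=> x _; rewrite lee_fin ltW ?gauss_gt0.
Qed.

Section mixture.
Variable k : nat.
Implicit Types G : mixing R d k.

Lemma mix_density_ge0 G x : (forall i, 0 <= weight G i) -> 0 <= mix_density S G x.
Proof. by move=> w0; apply: sumr_ge0 => i _; rewrite mulr_ge0// ltW ?gauss_gt0. Qed.

Lemma measurable_mix_density G : measurable_fun setT (mix_density S G).
Proof.
by apply: measurable_sum => i; apply: measurable_funM => //; exact: measurable_gauss.
Qed.

Lemma mix_laplace G s : (forall i, 0 <= weight G i) ->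
  (\int[lam]_x (expR (dotrv s x) * mix_density S G x)%:E =
   (expR (2^-1 * qform S s) * gauss_mass *
     \sum_i weight G i * expR (dotrv s (atom G i)))%:E)%E.
Proof.
move=> w0.
under eq_integral do rewrite /mix_density mulr_sumr -sumEFin.
have g0 i x : 0 <= gauss (atom G i) x by rewrite ltW ?gauss_gt0.
rewrite ge0_integral_sum//; last 2 first.
- move=> i; apply/measurable_EFinP; apply: measurable_funM.
    by apply: measurableT_comp => //; exact: measurable_dotrv.
  by apply: measurable_funM => //; exact: measurable_gauss.
- by move=> i x _; rewrite lee_fin mulr_ge0 ?expR_ge0// mulr_ge0.
rewrite mulr_sumr -sumEFin; apply: eq_bigr => i _.
under eq_integral do rewrite mulrCA EFinM.
rewrite ge0_integralZl//.
- rewrite gauss_laplace -EFinM expRD; congr EFin.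
  by ring.
- apply/measurable_EFinP; apply: measurable_funM; last exact: measurable_gauss.
  by apply: measurableT_comp => //; exact: measurable_dotrv.
- by move=> x _; rewrite lee_fin mulr_ge0 ?expR_ge0.
- by rewrite lee_fin.
Qed.

Lemma mix_mass_weights G : (forall i, 0 <= weight G i) ->
  (\int[lam]_x (mix_density S G x)%:E = (gauss_mass * \sum_i weight G i)%:E)%E.
Proof.
move=> w0; have := mix_laplace 0 w0.
have -> : qform S 0 = 0 by rewrite /qform !mul0mx mxE.
rewrite mulr0 expR0 mul1r.
under eq_bigr do rewrite dotrv0l expR0 mulr1; move=> <-.
by apply: eq_integral => x _; rewrite dotrv0l expR0 mul1r.
Qed.

Lemma mix_mass G : (forall i, 0 <= weight G i) -> \sum_i weight G i = 1 ->
  (\int[lam]_x (mix_density S G x)%:E = gauss_mass%:E)%E.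
Proof. by move=> w0 w1; rewrite mix_mass_weights// w1 mulr1. Qed.

Lemma mix_density_gt0 G x : (forall i, 0 <= weight G i) ->
  \sum_i weight G i = 1 -> 0 < mix_density S G x.
Proof.
move=> w0 w1; rewrite lt_neqAle mix_density_ge0// andbT eq_sym psumr_neq0; last first.
  by move=> i _; rewrite mulr_ge0// ltW ?gauss_gt0.
have : \sum_i weight G i != 0 by rewrite w1 oner_neq0.
rewrite psumr_neq0//.
move=> /hasP[i ii wi]; apply/hasP; exists i => //=.
by rewrite mulr_gt0 ?gauss_gt0.
Qed.

End mixture.

End gaussian.

(** * Hellinger distance and Laplace transforms *)

Lemma sqr_sqrt_sub (R : realType) (u v : R) : 0 <= u -> 0 <= v ->
  (Num.sqrt u - Num.sqrt v) ^+ 2 = u + v - 2 * (Num.sqrt u * Num.sqrt v).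
Proof. by move=> u0 v0; rewrite sqrrB !sqr_sqrtr// -mulr_natl; ring. Qed.

Lemma sqrt_mul_le (R : realType) (u v : R) : 0 <= u -> 0 <= v ->
  Num.sqrt u * Num.sqrt v <= u + v.
Proof.
move=> u0 v0; have := sqr_ge0 (Num.sqrt u - Num.sqrt v).
rewrite sqr_sqrt_sub//; have := mulr_ge0 (sqrtr_ge0 u) (sqrtr_ge0 v); lra.
Qed.

(** The pointwise form of Cauchy-Schwarz for
    f (u - v) = (f (sqrt u + sqrt v)) (sqrt u - sqrt v), the product of two factors
    being split with the weight t.  Integrating it and then choosing t gives the
    inequality between integrals without square roots of integrals. *)
Lemma sqrt_tradeoff (R : realType) (u v f t : R) : 0 <= u -> 0 <= v -> 0 < t ->
  f * u - f * v <=
  (2 * t)^-1 * (Num.sqrt u - Num.sqrt v) ^+ 2 + t * (f ^+ 2 * u + f ^+ 2 * v).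
Proof.
move=> u0 v0 t0; have := sqr_sqrtr u0; have := sqr_sqrtr v0.
move: (Num.sqrt u) (Num.sqrt v) => b a <- <-.
rewrite -subr_ge0.
have -> : (2 * t)^-1 * (b - a) ^+ 2 + t * (f ^+ 2 * b ^+ 2 + f ^+ 2 * a ^+ 2)
    - (f * b ^+ 2 - f * a ^+ 2) =
    (2 * t)^-1 * ((b - a) - t * f * (a + b)) ^+ 2 + t / 2 * (f * (a - b)) ^+ 2.
  by field; rewrite gt_eqF.
by rewrite addr_ge0// mulr_ge0 ?sqr_ge0 ?invr_ge0 ?divr_ge0// ?mulr_ge0// ltW.
Qed.

(** For h > 0 the choice t = h is enough; for h = 0 the parameter tends to 0. *)
Lemma le_of_tradeoff (R : realType) (x h B : R) : 0 <= h -> 0 <= B ->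
  (forall t, 0 < t -> x <= h ^+ 2 / t + t * B) -> x <= h * (1 + B).
Proof.
move=> h0 B0 hx; move: h0; rewrite le_eqVlt => /predU1P[h0|h0]; last first.
  have := hx h h0; rewrite expr2 mulfK ?gt_eqF//; lra.
rewrite -h0 mul0r; apply/ler_addgt0Pr => e e0; rewrite add0r.
have B1 : 0 < 1 + B by lra.
have := hx (e / (1 + B)) (divr_gt0 e0 B1).
rewrite -h0 expr0n/= mul0r add0r => /le_trans -> //.
by rewrite -mulrA ler_piMr ?(ltW e0)// mulrC ler_pdivrMr// mul1r; lra.
Qed.

Lemma measurable_sqrt (R : realType) : measurable_fun setT (@Num.sqrt R).
Proof. by apply: continuous_measurable_fun; exact: sqrt_continuous. Qed.

Section hellinger_affinity.
Context {R : realType} {d : nat}.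
Variable S : 'M[R]_d.
Hypothesis symS : S^T = S.
Hypothesis posS : forall v : 'rV[R]_d, v != 0 -> 0 < qform S v.
Local Notation lam := (@lebesgue_rV R d).
Local Notation M := (gauss_mass S).
Variable k : nat.
Implicit Types G H : mixing R d k.

Definition laplace G s : R := \sum_i weight G i * expR (dotrv s (atom G i)).

Definition prob_weights G : Prop :=
  (forall i, 0 <= weight G i) /\ \sum_i weight G i = 1.

Lemma ge0_integrable_lty (f : 'rV[R]_d -> R) :
  measurable_fun setT f -> (forall x, 0 <= f x) ->
  (\int[lam]_x (f x)%:E < +oo)%E -> lam.-integrable setT (EFin \o f).
Proof.
move=> mf f0 foo; apply/integrableP; split; first exact/measurable_EFinP.
by under eq_integral do rewrite /= ger0_norm//.
Qed.

Lemma measurable_tilted_mix G s :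
  measurable_fun setT (fun x => expR (dotrv s x) * mix_density S G x).
Proof.
apply: measurable_funM; last exact: measurable_mix_density.
by apply: measurableT_comp => //; exact: measurable_dotrv.
Qed.

Lemma integrable_tilted_mix G s : prob_weights G ->
  lam.-integrable setT (EFin \o (fun x => expR (dotrv s x) * mix_density S G x)).
Proof.
move=> [w0 w1]; apply: ge0_integrable_lty.
- exact: measurable_tilted_mix.
- by move=> x; rewrite mulr_ge0 ?expR_ge0// mix_density_ge0.
- by rewrite mix_laplace// ltry.
Qed.

Lemma Rintegral_tilted_mix G s : prob_weights G ->
  \int[lam]_x (expR (dotrv s x) * mix_density S G x) =
  expR (2^-1 * qform S s) * M * laplace G s.
Proof. by move=> [w0 w1]; rewrite /Rintegral mix_laplace. Qed.

Lemma integrable_mix G : prob_weights G ->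
  lam.-integrable setT (EFin \o mix_density S G).
Proof.
move=> [w0 w1]; apply: ge0_integrable_lty.
- exact: measurable_mix_density.
- by move=> x; exact: mix_density_ge0.
- by rewrite mix_mass// ltry.
Qed.

Lemma Rintegral_mix G : prob_weights G -> \int[lam]_x mix_density S G x = M.
Proof. by move=> [w0 w1]; rewrite /Rintegral mix_mass. Qed.

Definition hell (G H : mixing R d k) x : R :=
  (Num.sqrt (mix_density S G x) - Num.sqrt (mix_density S H x)) ^+ 2.

Lemma measurable_sqrt_mix G :
  measurable_fun setT (fun x => Num.sqrt (mix_density S G x)).
Proof.
apply: (measurableT_comp (@measurable_sqrt R)); exact: measurable_mix_density.
Qed.

Lemma integrable_sqrt_mixM G H : prob_weights G -> prob_weights H ->
  lam.-integrable setT (EFin \o (fun x =>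
    Num.sqrt (mix_density S G x) * Num.sqrt (mix_density S H x))).
Proof.
move=> pG pH.
apply: (le_integrable measurableT _ _ (integrableD measurableT (integrable_mix pG) (integrable_mix pH))).
  apply/measurable_EFinP; apply: measurable_funM; exact: measurable_sqrt_mix.
move=> x _ /=; rewrite lee_fin.
have [[G0 _] [H0 _]] := (pG, pH).
rewrite !ger0_norm ?addr_ge0 ?mulr_ge0 ?sqrtr_ge0 ?mix_density_ge0//.
by rewrite sqrt_mul_le ?mix_density_ge0.
Qed.

Lemma hellE G H x : prob_weights G -> prob_weights H ->
  hell G H x = mix_density S G x + mix_density S H x -
    2 * (Num.sqrt (mix_density S G x) * Num.sqrt (mix_density S H x)).
Proof.
by move=> [G0 _] [H0 _]; rewrite /hell sqr_sqrt_sub ?mix_density_ge0.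
Qed.

Lemma integrable_hell G H : prob_weights G -> prob_weights H ->
  lam.-integrable setT (EFin \o hell G H).
Proof.
move=> pG pH.
have iD := integrableD measurableT (integrable_mix pG) (integrable_mix pH).
have iM := integrableZl measurableT 2 (integrable_sqrt_mixM pG pH).
apply: eq_integrable (integrableB measurableT iD iM) => //= x _.
by rewrite hellE.
Qed.

Lemma dH_ge0 G H : 0 <= dH S G H.
Proof. exact: sqrtr_ge0. Qed.

Lemma dH_sqr G H : dH S G H ^+ 2 = 2^-1 * \int[lam]_x hell G H x.
Proof.
rewrite sqr_sqrtr// mulr_ge0 ?invr_ge0//; apply: Rintegral_ge0 => x _.
exact: sqr_ge0.
Qed.

Lemma dHC G H : dH S G H = dH S H G.
Proof.
have hellC : hell G H = hell H G.
  by apply/funext => x; rewrite /hell -[LHS]sqrrN opprB.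
transitivity (Num.sqrt (2^-1 * \int[lam]_x hell G H x)); first by [].
by rewrite hellC.
Qed.

(** Both mixtures have the same mass, so the squared Hellinger distance is what
    the affinity lacks to reach it. *)
Lemma affinity_dH G H : prob_weights G -> prob_weights H ->
  \int[lam]_x (Num.sqrt (mix_density S G x) * Num.sqrt (mix_density S H x)) =
  M - dH S G H ^+ 2.
Proof.
move=> pG pH; rewrite dH_sqr.
under [in RHS]eq_Rintegral do rewrite hellE//.
have iM := integrable_sqrt_mixM pG pH.
have iS : lam.-integrable setT (EFin \o (fun x => mix_density S G x + mix_density S H x)).
  exact: (integrableD measurableT (integrable_mix pG) (integrable_mix pH)).
have i2 : lam.-integrable setT (EFin \o (fun x =>
    2 * (Num.sqrt (mix_density S G x) * Num.sqrt (mix_density S H x)))).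
  exact: (integrableZl measurableT 2 iM).
rewrite (RintegralB measurableT iS i2).
rewrite (RintegralD measurableT (integrable_mix pG) (integrable_mix pH)).
rewrite (RintegralZl 2 measurableT iM) !Rintegral_mix//.
by field.
Qed.

Lemma laplace_ge0 G s : prob_weights G -> 0 <= laplace G s.
Proof.
by move=> [w0 _]; apply: sumr_ge0 => i _; rewrite mulr_ge0 ?expR_ge0.
Qed.

(** Apply the tradeoff with f = exp (s . x): the squared test function is again an
    exponential, so all integrals are Laplace transforms. *)
Lemma laplace_sub_le_dH G H s : prob_weights G -> prob_weights H ->
  expR (2^-1 * qform S s) * M * (laplace G s - laplace H s) <=
  dH S G H * (1 + expR (2^-1 * qform S (s + s)) * M *
    (laplace G (s + s) + laplace H (s + s))).
Proof.
move=> pG pH; apply: le_of_tradeoff; first exact: dH_ge0.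
  by rewrite mulr_ge0 ?addr_ge0 ?laplace_ge0// mulr_ge0 ?expR_ge0// ltW ?gauss_mass_gt0.
move=> t t0.
rewrite mulrBr mulrDr -!Rintegral_tilted_mix//.
have iG := integrable_tilted_mix s pG; have iH := integrable_tilted_mix s pH.
have iG2 := integrable_tilted_mix (s + s) pG.
have iH2 := integrable_tilted_mix (s + s) pH.
have ih := integrable_hell pG pH.
rewrite -(RintegralB measurableT iG iH) -(RintegralD measurableT iG2 iH2) dH_sqr.
rewrite (_ : 2^-1 * _ / t = (2 * t)^-1 * \int[lam]_x hell G H x); last first.
  by field; rewrite gt_eqF.
rewrite -(RintegralZl _ measurableT ih).
rewrite -(RintegralZl _ measurableT (integrableD measurableT iG2 iH2)).
have i1 := integrableZl measurableT (2 * t)^-1 ih.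
have i2 := integrableZl measurableT t (integrableD measurableT iG2 iH2).
rewrite -(RintegralD measurableT i1 i2).
apply: le_Rintegral => //.
- by have := integrableB measurableT iG iH.
- by have := integrableD measurableT i1 i2.
move=> x _; rewrite /hell.
have -> : expR (dotrv (s + s) x) = expR (dotrv s x) ^+ 2.
  rewrite expr2 -expRD; congr expR.
  by rewrite -big_split/=; apply: eq_bigr => i _; rewrite !mxE; ring.
have [[G0 _] [H0 _]] := (pG, pH).
exact: sqrt_tradeoff (mix_density_ge0 posS x G0) (mix_density_ge0 posS x H0) t0.
Qed.

Lemma laplace_dist_le_dH G H s : prob_weights G -> prob_weights H ->
  expR (2^-1 * qform S s) * M * `|laplace G s - laplace H s| <=
  dH S G H * (1 + expR (2^-1 * qform S (s + s)) * M *
    (laplace G (s + s) + laplace H (s + s))).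
Proof.
move=> pG pH; have [_|_] := ler0P (laplace G s - laplace H s); last first.
  exact: laplace_sub_le_dH.
by rewrite opprB dHC [laplace G _ + _]addrC; exact: laplace_sub_le_dH.
Qed.

End hellinger_affinity.

(** * Upper bounds on the Wasserstein distance *)

Section wasserstein_upper_bound.
Context {R : realType} {d : nat}.

Lemma measurable_enormB :
  measurable_fun setT (fun z : 'rV[R]_d * 'rV[R]_d => (enorm (z.1 - z.2))%:E).
Proof.
apply/measurable_EFinP.
rewrite /enorm; apply: (measurableT_comp (@measurable_sqrt R)).
apply: measurable_sum => i; apply: measurable_funX.
rewrite (_ : (fun _ => _) = fun z : 'rV[R]_d * 'rV[R]_d => z.1 ord0 i - z.2 ord0 i).
  by apply: measurable_funB; apply: (measurableT_comp (measurable_rV_entry i)).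
by apply/funext => z; rewrite !mxE.
Qed.

Section transport_plan.
Variables (T : finType) (t0 : T) (g : T -> R) (pt : T -> 'rV[R]_d * 'rV[R]_d).
Hypothesis g0 : forall t, 0 <= g t.
Hypothesis g1 : \sum_t g t = 1.

(* [msum] is indexed by numbers, so the pairs of atoms are enumerated *)
Let ev n := nth t0 (enum T) n.
Let w n : {nonneg R} := NngNum (g0 (ev n)).
Let m_ (n : nat) : {measure set ('rV[R]_d * 'rV[R]_d)%type -> \bar R} :=
  mscale (w n) \d_(pt (ev n)).

Let sum_ev (F : T -> \bar R) : (\sum_(n < #|T|) F (ev n) = \sum_t F t)%E.
Proof. by rewrite -[RHS]big_enum/= (big_nth t0) big_mkord -cardE. Qed.

Definition plan : set ('rV[R]_d * 'rV[R]_d)%type -> \bar R := msum m_ #|T|.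

HB.instance Definition _ := Measure.on plan.

Lemma planE A : (plan A = \sum_t (g t)%:E * \d_(pt t) A)%E.
Proof. by rewrite -(sum_ev (fun t => (g t)%:E * \d_(pt t) A)%E). Qed.

Lemma plan1 : plan setT = 1%E.
Proof.
rewrite planE -[RHS]/(1%:E) -g1 -sumEFin; apply: eq_bigr => t _.
by rewrite diracT mule1.
Qed.

HB.instance Definition _ := Measure_isProbability.Build _ _ _ plan plan1.

Lemma transport_plan_exists : exists P : probability ('rV[R]_d * 'rV[R]_d)%type R,
  (forall A, P A = \sum_t (g t)%:E * \d_(pt t) A)%E /\
  (forall f : 'rV[R]_d * 'rV[R]_d -> \bar R, measurable_fun setT f -> (forall z, 0 <= f z) ->
    \int[P]_z f z = \sum_t (g t)%:E * f (pt t))%E.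
Proof.
exists plan; split=> [A|f mf f0]; first exact: planE.
rewrite -(sum_ev (fun t => (g t)%:E * f (pt t))%E).
transitivity (\int[msum m_ #|T|]_z f z)%E; first by [].
rewrite ge0_integral_measure_sum//; apply: eq_bigr => n _.
by rewrite ge0_integral_mscale// integral_dirac// diracT mul1e.
Qed.

End transport_plan.

Variable k : nat.
Implicit Types G H : mixing R d k.

Lemma W1_le_plan G H (g : 'I_k -> 'I_k -> R) :
  (forall i j, 0 <= g i j) -> \sum_i weight G i = 1 ->
  (forall i, \sum_j g i j = weight G i) -> (forall j, \sum_i g i j = weight H j) ->
  (W1 G H <= (\sum_i \sum_j g i j * enorm (atom G i - atom H j))%:E)%E.
Proof.
move=> g0 wG gG gH.
case: k G H g g0 wG gG gH => [|k'] G H g g0 wG gG gH.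
  by move: wG; rewrite big_ord0 => /esym/eqP; rewrite oner_eq0.
pose pt (t : 'I_k'.+1 * 'I_k'.+1) := (atom G t.1, atom H t.2).
have g1 : \sum_(t : 'I_k'.+1 * 'I_k'.+1) g t.1 t.2 = 1.
  by rewrite -(pair_bigA _ (fun i j => g i j))/= -wG; apply: eq_bigr => i _; exact: gG.
have [P [PE Pint]] := transport_plan_exists (ord0, ord0) pt (fun t => g0 t.1 t.2) g1.
apply: ereal_inf_lbound; exists P; last first.
  rewrite Pint//; [|exact: measurable_enormB|by move=> z; rewrite lee_fin sqrtr_ge0].
  rewrite pair_bigA/= -sumEFin; apply: eq_bigr => t _; by rewrite EFinM.
move=> A mA; rewrite !PE; split.
  rewrite -(pair_bigA _ (fun i j => (g i j)%:E * \d_(pt (i, j)) (A `*` setT))%E)/=.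
  apply: eq_bigr => i _; rewrite -gG -sumEFin ge0_sume_distrl; last first.
    by move=> j _; rewrite lee_fin.
  apply: eq_bigr => j _; congr (_ * _)%E; rewrite !diracE; congr (_%:R%:E).
  by rewrite /pt/= in_setX in_setT andbT.
rewrite -(pair_bigA _ (fun i j => (g i j)%:E * \d_(pt (i, j)) (setT `*` A))%E)/=.
rewrite exchange_big/=.
apply: eq_bigr => i _; rewrite -gH -sumEFin ge0_sume_distrl; last first.
  by move=> j _; rewrite lee_fin.
apply: eq_bigr => j _; congr (_ * _)%E; rewrite !diracE; congr (_%:R%:E).
by rewrite /pt/= in_setX in_setT.
Qed.

End wasserstein_upper_bound.

Section wasserstein_matched.
Context {R : realType} {d k : nat}.
Implicit Types G H : mixing R d k.

(** The plan keeps the common mass min (p_i, q_i) in the i-th pair of atoms and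
    couples the excesses p - min and q - min independently; these have the
    same mass, at most the l1 distance of the weights. *)
Lemma W1_le_matched G H (D : R) : prob_weights G -> prob_weights H ->
  (forall i j, enorm (atom G i - atom H j) <= D) ->
  (W1 G H <= (\sum_i weight G i * enorm (atom G i - atom H i)
              + D * \sum_i `|weight G i - weight H i|)%:E)%E.
Proof.
move=> [G0 G1] [H0 H1] hD.
pose a := weight G; pose b := weight H; pose m i := Num.min (a i) (b i).
have ma i : 0 <= a i - m i by rewrite subr_ge0 ge_min lexx.
have mb i : 0 <= b i - m i by rewrite subr_ge0 ge_min lexx orbT.
have m0 i : 0 <= m i by rewrite le_min G0 H0.
(* for s = 0 the excesses vanish, and division by 0 giving 0 is what is wanted *)
pose s := 1 - \sum_i m i.
have sa : \sum_i (a i - m i) = s by rewrite sumrB G1.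
have sb : \sum_i (b i - m i) = s by rewrite sumrB H1.
have s0 : 0 <= s by rewrite -sa; apply: sumr_ge0 => i _.
have vanish (c : 'I_k -> R) : (forall i, 0 <= c i) -> \sum_i c i = s ->
    s = 0 -> forall i, c i = 0.
  move=> c0 cs sz i; apply/eqP; have := cs; rewrite sz => /eqP.
  by rewrite psumr_eq0// => /allP/(_ i); rewrite mem_index_enum => /(_ isT).
pose g i j := (i == j)%:R * m i + (a i - m i) * (b j - m j) / s.
have diag (f : 'I_k -> R) i : \sum_j (i == j)%:R * f j = f i.
  rewrite (bigD1 i)//= eqxx mul1r big1 ?addr0// => j ji.
  by rewrite eq_sym (negbTE ji) mul0r.
have gG i : \sum_j g i j = a i.
  rewrite big_split/= (diag (fun=> m i)) -mulr_suml -mulr_sumr sb.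
  have [sz|sN] := eqVneq s 0; last by rewrite mulfK//; lra.
  by have := vanish _ ma sa sz i; rewrite sz !mulr0 mul0r; lra.
have gH j : \sum_i g i j = b j.
  under eq_bigr do rewrite /g eq_sym.
  rewrite big_split/= (diag m) -mulr_suml -mulr_suml sa.
  have [sz|sN] := eqVneq s 0; last by rewrite mulrC mulKf//; lra.
  by have := vanish _ mb sb sz j; rewrite sz !mul0r; lra.
have g0 i j : 0 <= g i j by rewrite addr_ge0 ?mulr_ge0 ?invr_ge0.
apply: (le_trans (W1_le_plan g0 G1 gG gH)); rewrite lee_fin.
have dd j : \sum_i (i == j)%:R * (m i * enorm (atom G i - atom H j)) =
    m j * enorm (atom G j - atom H j).
  by under eq_bigr do rewrite eq_sym; rewrite (diag (fun i => _ i * _)).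
apply: (@le_trans _ _ (\sum_i \sum_j ((i == j)%:R * (m i * enorm (atom G i - atom H j))
   + (a i - m i) * (b j - m j) / s * D))).
  apply: ler_sum => i _; apply: ler_sum => j _.
  rewrite /g [leLHS]mulrDl -[X in X + _]mulrA lerD2l ler_wpM2l ?hD// mulr_ge0 ?invr_ge0//.
  by rewrite mulr_ge0.
rewrite exchange_big/=.
under eq_bigr do rewrite big_split/= dd -!mulr_suml sa.
rewrite big_split/= -!mulr_suml -mulr_sumr sb.
apply: lerD.
  apply: ler_sum => i _; rewrite ler_wpM2r ?sqrtr_ge0//.
  by have := ma i; rewrite subr_ge0.
(* the weights have sum 1, so there is an index and D is nonnegative *)
have [i _|/= nok] := pickP (fun _ : 'I_k => true); last first.
  by move: G1; rewrite big1 ?(eqP (oner_neq0 R))// => [/esym/eqP|i]; [rewrite oner_eq0|have := nok i].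
have D0 : 0 <= D by apply: le_trans (hD i i); exact: sqrtr_ge0.
rewrite mulrC ler_wpM2l//.
have [->|sN] := eqVneq s 0; first by rewrite !mul0r; apply: sumr_ge0.
rewrite mulfK// -sa; apply: ler_sum => j _.
rewrite /m /Num.min; case: ifP => _; first by rewrite subrr.
exact: ler_norm.
Qed.

End wasserstein_matched.

(** * The Euclidean norm and exponential coordinates *)

Section euclidean_norm.
Context {R : realType} {d : nat}.
Implicit Types x y u v : 'rV[R]_d.

Lemma enorm_ge0 x : 0 <= enorm x.
Proof. exact: sqrtr_ge0. Qed.

Lemma enorm_sqr x : enorm x ^+ 2 = sqnorm x.
Proof. by rewrite sqr_sqrtr ?sqnorm_ge0. Qed.

Lemma enorm_entry x i : `|x ord0 i| <= enorm x.
Proof.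
rewrite -(ler_pXn2r (n := 2))// ?nnegrE ?enorm_ge0// enorm_sqr real_normK ?num_real//.
exact: sqr_entry_le.
Qed.

Lemma sqnormD_scale x y t :
  sqnorm (x - t *: y) = sqnorm x - 2 * t * dotrv x y + t ^+ 2 * sqnorm y.
Proof.
rewrite /sqnorm /dotrv !mulr_sumr -sumrB -big_split/=.
by apply: eq_bigr => i _; rewrite !mxE; ring.
Qed.

Lemma dotrv_le x y : `|dotrv x y| <= enorm x * enorm y.
Proof.
rewrite -(ler_pXn2r (n := 2))// ?nnegrE ?mulr_ge0 ?enorm_ge0//.
rewrite real_normK ?num_real// exprMn !enorm_sqr.
have [y0|yN] := eqVneq (sqnorm y) 0.
  rewrite y0 mulr0 /dotrv big1 ?expr0n// => i _.
  have := sqr_entry_le y i; rewrite y0 => h.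
  by have /eqP := le_anti (introT andP (conj h (sqr_ge0 _))); rewrite sqrf_eq0 => /eqP ->; rewrite mulr0.
have yp : 0 < sqnorm y by rewrite lt_neqAle eq_sym yN sqnorm_ge0.
have := sqnorm_ge0 (x - (dotrv x y / sqnorm y) *: y); rewrite sqnormD_scale.
rewrite (_ : _ + _ = (sqnorm x * sqnorm y - dotrv x y ^+ 2) / sqnorm y); last by field.
by rewrite pmulr_lge0 ?invr_gt0// subr_ge0.
Qed.

Lemma enormD x y : enorm (x + y) <= enorm x + enorm y.
Proof.
rewrite -(ler_pXn2r (n := 2))// ?nnegrE ?addr_ge0 ?enorm_ge0// enorm_sqr.
have := sqnormD_scale x y (-1); rewrite scaleN1r opprK => ->.
rewrite sqrrD !enorm_sqr.
have := le_trans (ler_norm _) (dotrv_le x y); lra.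
Qed.

Lemma enormN x : enorm (- x) = enorm x.
Proof. by congr Num.sqrt; apply: eq_bigr => i _; rewrite mxE sqrrN. Qed.

Lemma enormB x y : enorm (x - y) = enorm (y - x).
Proof. by rewrite -enormN opprB. Qed.

Lemma enorm_triangle x y v : enorm (x - v) <= enorm (x - y) + enorm (y - v).
Proof. by rewrite -[x - v](subrKA y); exact: enormD. Qed.

Lemma enormZ t x : enorm (t *: x) = `|t| * enorm x.
Proof.
rewrite /enorm -sqrtr_sqr -sqrtrM ?sqr_ge0// mulr_sumr; congr Num.sqrt.
by apply: eq_bigr => i _; rewrite mxE exprMn.
Qed.

Lemma enorm_le_entries (c : R) x y : 0 <= c ->
  (forall i, `|x ord0 i| <= c * `|y ord0 i|) -> enorm x <= c * enorm y.
Proof.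
move=> c0 h; rewrite -[c]ger0_norm// -enormZ ler_wsqrtr//.
apply: ler_sum => i _; rewrite mxE.
rewrite -[leLHS]real_normK ?num_real// -[leRHS]real_normK ?num_real//.
rewrite ler_pXn2r ?nnegrE//.
by rewrite normrM [`|c|]ger0_norm.
Qed.

(** Polynomials in these coordinates are exponential sums in x, which are the
    functions whose moments the Hellinger distance controls. *)
Definition expv x : 'rV[R]_d := \row_i expR (x ord0 i).

Lemma expR_lip (r a b : R) : `|a| <= r -> `|b| <= r ->
  expR (- r) * `|a - b| <= `|expR a - expR b| <= expR r * `|a - b|.
Proof.
move=> ar br; wlog ab : a b ar br / b <= a.
  move=> H; have [ba|/ltW ba] := leP b a; first exact: H.
  by rewrite (distrC a) (distrC (expR a)); exact: H.
have /andP[a1 a2] : - r <= a <= r by rewrite -ler_norml.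
have /andP[b1 b2] : - r <= b <= r by rewrite -ler_norml.
rewrite !ger0_norm ?subr_ge0 ?ler_expR//.
have e1 : expR a - expR b = expR b * (expR (a - b) - 1).
  by rewrite mulrBr mulr1 -expRD subrKC.
have e2 : expR a - expR b = expR a * (1 - expR (b - a)).
  by rewrite mulrBr mulr1 -expRD subrKC.
apply/andP; split.
  rewrite e1 ler_pM ?expR_ge0 ?subr_ge0 ?ler_expR//.
  by have := expR_ge1Dx (a - b); lra.
rewrite e2 ler_pM ?expR_ge0 ?subr_ge0 ?ler_expR//.
  by rewrite -[1]expR0 ler_expR subr_le0.
by have := expR_ge1Dx (b - a); lra.
Qed.

Lemma expv_lip (r : R) x y : enorm x <= r -> enorm y <= r ->
  expR (- r) * enorm (x - y) <= enorm (expv x - expv y) <= expR r * enorm (x - y).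
Proof.
move=> xr yr.
have h i := expR_lip (le_trans (enorm_entry x i) xr) (le_trans (enorm_entry y i) yr).
apply/andP; split; last first.
  by apply: enorm_le_entries => [|i]; rewrite ?expR_ge0// !mxE; have /andP[] := h i.
rewrite expRN -ler_pdivlMl ?invr_gt0 ?expR_gt0// invrK.
apply: enorm_le_entries => [|i]; first exact: expR_ge0.
rewrite !mxE; have /andP[+ _] := h i.
by rewrite expRN -ler_pdivlMl ?invr_gt0 ?expR_gt0// invrK.
Qed.

End euclidean_norm.

(** * Moments of exponential sums *)

Section test_functions.
Context {R : realType} {d : nat}.
Implicit Types (x s : 'rV[R]_d) (f g : 'rV[R]_d -> R).

Definition moment k (G : mixing R d k) f : R := \sum_i weight G i * f (atom G i).

(** Finite exponential sums.  B bounds the total mass of the coefficients and D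
    the frequencies: both enter the constant by which the Hellinger distance
    controls the moments, which must not depend on the mixing measures. *)
Definition exp_sum (B D : R) f : Prop :=
  exists P : seq (R * 'rV[R]_d),
    [/\ forall x, f x = \sum_(p <- P) p.1 * expR (dotrv p.2 x),
        \sum_(p <- P) `|p.1| <= B &
        forall p, p \in P -> forall i, `|p.2 ord0 i| <= D].

Lemma exp_sum_cst c : exp_sum `|c| 0 (fun=> c).
Proof.
exists [:: (c, 0)]; split=> [x||p].
- by rewrite big_seq1/= dotrv0l expR0 mulr1.
- by rewrite big_seq1.
- by rewrite inE => /eqP -> i /=; rewrite mxE normr0.
Qed.

Lemma exp_sum_coord i : exp_sum 1 1 (fun x => expR (x ord0 i)).
Proof.
exists [:: (1, delta_mx 0 i)]; split=> [x||p].
- rewrite big_seq1/= mul1r; congr expR; rewrite /dotrv (bigD1 i)//= mxE !eqxx mul1r.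
  by rewrite big1 ?addr0// => j /negbTE ji; rewrite mxE ji andbF mul0r.
- by rewrite big_seq1/= normr1.
- by rewrite inE => /eqP -> j /=; rewrite mxE; case: (_ && _); rewrite ?normr1 ?normr0.
Qed.

Lemma exp_sum_weaken B D B' D' f : B <= B' -> D <= D' -> exp_sum B D f -> exp_sum B' D' f.
Proof.
move=> BB DD [P [fE PB PD]]; exists P; split=> //; first exact: le_trans BB.
by move=> p pP i; apply: le_trans DD; exact: PD.
Qed.

Lemma exp_sumD B D B' f g :
  exp_sum B D f -> exp_sum B' D g -> exp_sum (B + B') D (fun x => f x + g x).
Proof.
move=> [P [fE PB PD]] [Q [gE QB QD]]; exists (P ++ Q); split=> [x||p].
- by rewrite big_cat fE gE.
- by rewrite big_cat lerD.
- by rewrite mem_cat => /orP[|]; [exact: PD|exact: QD].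
Qed.

Lemma exp_sumM B D B' D' f g :
  exp_sum B D f -> exp_sum B' D' g -> exp_sum (B * B') (D + D') (fun x => f x * g x).
Proof.
move=> [P [fE PB PD]] [Q [gE QB QD]].
exists [seq (p.1 * q.1, p.2 + q.2) | p <- P, q <- Q]; split=> [x||p].
- rewrite big_allpairs_dep fE gE mulr_suml; apply: eq_bigr => p _.
  rewrite mulr_sumr; apply: eq_bigr => q _ /=.
  by rewrite dotrvDl expRD; ring.
- rewrite big_allpairs_dep/=.
  under eq_bigr do under eq_bigr do rewrite normrM.
  under eq_bigr do rewrite -mulr_sumr.
  by rewrite -mulr_suml ler_pM//; apply: sumr_ge0.
- move=> /allpairsP[[a b] [/= aP bQ ->]] i /=; rewrite mxE.
  by apply: (le_trans (ler_normD _ _)); rewrite lerD ?PD ?QD.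
Qed.

Lemma exp_sum_prod (I : Type) (r : seq I) (P : pred I) B D (F : I -> 'rV[R]_d -> R) :
  1 <= B -> 0 <= D -> (forall i, exp_sum B D (F i)) ->
  exp_sum (B ^+ size r) (D *+ size r) (fun x => \prod_(i <- r | P i) F i x).
Proof.
move=> B1 D0 hF; elim: r => [|i r IH] /=.
  rewrite expr0 mulr0n; have := exp_sum_cst 1; rewrite normr1.
  by under [in X in _ -> X]eq_fun do rewrite big_nil.
under eq_fun do rewrite big_cons.
case: (P i); last first.
  apply: exp_sum_weaken IH; first by rewrite exprS ler_peMl// exprn_ge0// (le_trans ler01).
  by rewrite mulrS lerDr.
by rewrite exprS mulrS; exact: exp_sumM.
Qed.

Lemma exp_sum_sum (I : Type) (r : seq I) B D (F : I -> 'rV[R]_d -> R) :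
  (forall i, exp_sum B D (F i)) -> 0 <= D ->
  exp_sum (B *+ size r) D (fun x => \sum_(i <- r) F i x).
Proof.
move=> hF D0; elim: r => [|i r IH] /=.
  have := exp_sum_cst 0; rewrite normr0 => /(exp_sum_weaken (lexx _) D0).
  by under [in X in _ -> X]eq_fun do rewrite big_nil.
under eq_fun do rewrite big_cons.
by rewrite mulrS; exact: exp_sumD.
Qed.

Lemma moment_exp_sum k (G : mixing R d k) f (P : seq (R * 'rV[R]_d)) :
  (forall x, f x = \sum_(p <- P) p.1 * expR (dotrv p.2 x)) ->
  moment G f = \sum_(p <- P) p.1 * laplace G p.2.
Proof.
move=> fE; rewrite /moment; under eq_bigr do rewrite fE mulr_sumr.
rewrite exchange_big/=; apply: eq_bigr => p _; rewrite /laplace mulr_sumr.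
by apply: eq_bigr => i _; rewrite mulrCA.
Qed.

Lemma dotrv_bound (D r : R) s x : (forall i, `|s ord0 i| <= D) -> enorm x <= r ->
  dotrv s x <= d%:R * (D * r).
Proof.
move=> sD xr; rewrite -[d in d%:R]card_ord -sum1_card natr_sum mulr_suml.
apply: ler_sum => i _; rewrite mul1r (le_trans (ler_norm _))// normrM ler_pM//.
exact: le_trans (enorm_entry x i) xr.
Qed.

Lemma sqnorm_bound (D : R) s : (forall i, `|s ord0 i| <= D) ->
  sqnorm s <= d%:R * D ^+ 2.
Proof.
move=> sD; rewrite -[d in d%:R]card_ord -sum1_card natr_sum mulr_suml.
apply: ler_sum => i _; rewrite mul1r -[leLHS]real_normK ?num_real//.
by rewrite ler_pXn2r ?nnegrE// (le_trans _ (sD i)).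
Qed.

(** The sum of the estimates of [laplace_dist_le_dH] over the frequencies; D bounds
    the factors in them that depend on the frequency. *)
Lemma moment_dist_le_dH (S : 'M[R]_d) (r D : R) : S^T = S ->
  (forall v : 'rV[R]_d, v != 0 -> 0 < qform S v) -> 0 <= D ->
  exists2 C, 0 < C & forall k (G H : mixing R d k) B f,
    prob_weights G -> prob_weights H ->
    (forall i, enorm (atom G i) <= r) -> (forall i, enorm (atom H i) <= r) ->
    exp_sum B D f -> `|moment G f - moment H f| <= B * (C * dH S G H).
Proof.
move=> symS posS D0.
have [b b0 hb] := qform_le S.
have M0 := gauss_mass_gt0 symS posS.
pose K := expR (2^-1 * (b * (d%:R * (D + D) ^+ 2))) * gauss_mass S *
  (expR (d%:R * ((D + D) * r)) + expR (d%:R * ((D + D) * r))).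
have K0 : 0 <= K by rewrite mulr_ge0 ?addr_ge0 ?expR_ge0// mulr_ge0 ?expR_ge0// ltW.
have C0 : 0 < (gauss_mass S)^-1 * (1 + K) by rewrite mulr_gt0 ?invr_gt0// ltr_pwDl.
exists ((gauss_mass S)^-1 * (1 + K)) => // k G H B f pG pH rG rH [P [fE PB PD]].
rewrite !(moment_exp_sum _ fE) -sumrB.
have lapl s : (forall i, `|s ord0 i| <= D) -> `|laplace G s - laplace H s| <=
    (gauss_mass S)^-1 * (1 + K) * dH S G H.
  move=> sD; have ssD i : `|(s + s) ord0 i| <= D + D.
    by rewrite mxE (le_trans (ler_normD _ _))// lerD.
  have := laplace_dist_le_dH symS posS s pG pH.
  have Lub (F : mixing R d k) : prob_weights F -> (forall i, enorm (atom F i) <= r) ->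
      laplace F (s + s) <= expR (d%:R * ((D + D) * r)).
    move=> [F0 F1] rF; rewrite -[leRHS]mul1r -[X in _ <= X * _]F1 mulr_suml; apply: ler_sum => i _.
    by rewrite ler_wpM2l// ler_expR dotrv_bound.
  have E1 : 1 <= expR (2^-1 * qform S s).
    by rewrite -[1]expR0 ler_expR mulr_ge0 ?invr_ge0// posdef_ge0.
  have hK : expR (2^-1 * qform S (s + s)) * gauss_mass S *
      (laplace G (s + s) + laplace H (s + s)) <= K.
    rewrite ler_pM ?addr_ge0 ?laplace_ge0//.
    - by rewrite mulr_ge0 ?expR_ge0// ltW.
    - rewrite ler_wpM2r ?(ltW M0)// ler_expR ler_wpM2l ?invr_ge0// (le_trans (hb _))//.
      by rewrite ler_wpM2l ?(ltW b0)// sqnorm_bound.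
    - by rewrite lerD ?Lub.
  move=> h; rewrite -mulrA ler_pdivlMl//.
  apply: (@le_trans _ _ (expR (2^-1 * qform S s) * gauss_mass S * `|laplace G s - laplace H s|)).
    by rewrite ler_wpM2r// ler_peMl// ltW.
  apply: (le_trans h); rewrite mulrC ler_wpM2r ?dH_ge0// lerD2l//.
apply: (le_trans (ler_norm_sum _ _ _)).
apply: (@le_trans _ _ (\sum_(p <- P) `|p.1| * ((gauss_mass S)^-1 * (1 + K) * dH S G H))).
  rewrite big_seq [leRHS]big_seq; apply: ler_sum => p pP.
  by rewrite -mulrBr normrM ler_wpM2l// lapl//; exact: PD.
by rewrite -mulr_suml ler_wpM2r// mulr_ge0 ?dH_ge0// ltW.
Qed.

End test_functions.

(** * Interpolation polynomials and discrete measures *)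

Lemma exponent_split k : (0 < k)%N -> (4 * k - 3 = (2 * k.-1 + 2 * k.-1).+1)%N.
Proof.
by case: k => // k _; rewrite mulnS (addnC 4) -addnBA// addn1 -mulnDl.
Qed.

Section products.
Context {R : realType}.

Lemma expr1D_sub1_le (t : R) n : 0 <= t -> (1 + t) ^+ n - 1 <= n%:R * t * (1 + t) ^+ n.
Proof.
move=> t0; have t1 : 1 <= 1 + t by lra.
elim: n => [|n IH]; first by rewrite expr0 subrr !mul0r.
have en : 0 <= (1 + t) ^+ n by rewrite exprn_ge0//; lra.
rewrite [leLHS](_ : _ = ((1 + t) ^+ n - 1) + t * (1 + t) ^+ n); last by rewrite exprS; ring.
apply: (@le_trans _ _ (n.+1%:R * t * (1 + t) ^+ n)).
  by rewrite -[n.+1]addn1 natrD; move: IH; lra.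
by rewrite ler_wpM2l ?mulr_ge0// exprS ler_peMl.
Qed.

(** Relative errors t in the factors accumulate to (1 + t)^n - 1 in the product. *)
Lemma prod_perturb (I : Type) (r : seq I) (P : pred I) (a b : I -> R) t :
  0 <= t -> (forall i, P i -> 0 <= a i) ->
  (forall i, P i -> `|b i - a i| <= t * a i) ->
  `|\prod_(i <- r | P i) b i - \prod_(i <- r | P i) a i| <=
  ((1 + t) ^+ size r - 1) * \prod_(i <- r | P i) a i.
Proof.
move=> t0 a0 hab; have t1 : 1 <= 1 + t by lra.
elim: r => [|i r IH] /=; first by rewrite !big_nil !subrr normr0 mul0r.
rewrite !big_cons; set B := \prod_(j <- r | P j) b j in IH *.
set A := \prod_(j <- r | P j) a j in IH *.
have A0 : 0 <= A by apply: prodr_ge0.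
have mono : (1 + t) ^+ size r <= (1 + t) ^+ (size r).+1.
  by rewrite exprS ler_peMl// exprn_ge0//; lra.
case: ifP => [Pi|_]; last by apply: (le_trans IH); rewrite ler_wpM2r// lerD2r.
have ai := a0 i Pi; have hi := hab i Pi.
have bi : `|b i| <= (1 + t) * a i.
  rewrite -[b i](subrK (a i)); apply: (le_trans (ler_normD _ _)).
  by rewrite (ger0_norm ai); lra.
rewrite (_ : b i * B - a i * A = (b i - a i) * A + b i * (B - A)); last by ring.
apply: (le_trans (ler_normD _ _)); rewrite !normrM (ger0_norm A0).
apply: (@le_trans _ _ (t * a i * A + (1 + t) * a i * (((1 + t) ^+ size r - 1) * A))).
  by rewrite lerD ?ler_wpM2r// ler_pM.
by rewrite exprS le_eqVlt; apply/orP; left; apply/eqP; ring.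
Qed.

Lemma prod_le_exp (I : finType) (P : pred I) (a : I -> R) (T : R) : 1 <= T ->
  (forall i, 0 <= a i <= T) -> \prod_(i | P i) a i <= T ^+ #|I|.
Proof.
move=> T1 aT; apply: (@le_trans _ _ (\prod_(i | P i) T)).
  by apply: ler_prod => i _.
by rewrite prodr_const ler_weXn2l// max_card.
Qed.

End products.

Section discrete_lower_bound.
Context {R : realType} {d k : nat}.
Variables (y z : 'I_k -> 'rV[R]_d) (p q : 'I_k -> R) (eps : R).
Implicit Types v w : 'rV[R]_d.

(** Here q and z are the weights and atoms of the reference measure, p and y those
    of a competitor, and eps bounds the differences of the moments of three
    families of polynomials.  At the reference atoms, [prod_all] vanishes with
    order two, [prod_but j] vanishes except at [z j], and [linear_but j w] vanishes
    everywhere, but to first order only at [z j]. *)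
Definition sqdist (l : 'I_k) v : R := sqnorm (v - z l).
Definition prod_all v : R := \prod_l sqdist l v.
Definition prod_but (j : 'I_k) v : R := \prod_(l | l != j) sqdist l v.
Definition linear_but (j : 'I_k) w v : R := dotrv w (v - z j) * prod_but j v.

Hypothesis p0 : forall i, 0 <= p i.
Hypothesis q0 : forall i, 0 <= q i.
Hypothesis test_all :
  `|\sum_i p i * prod_all (y i) - \sum_i q i * prod_all (z i)| <= eps.
Hypothesis test_but : forall j,
  `|\sum_i p i * prod_but j (y i) - \sum_i q i * prod_but j (z i)| <= eps.
Hypothesis test_linear : forall j w, (forall a, `|w ord0 a| <= 1) ->
  `|\sum_i p i * linear_but j w (y i) - \sum_i q i * linear_but j w (z i)| <= eps.

Let eps0 : 0 <= eps.
Proof. exact: le_trans test_all. Qed.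

Lemma sqdist_ge0 l v : 0 <= sqdist l v.
Proof. exact: sqnorm_ge0. Qed.

Lemma sqdistxx j : sqdist j (z j) = 0.
Proof. by rewrite /sqdist subrr /sqnorm big1// => i _; rewrite mxE expr0n. Qed.

Lemma prod_but_ge0 j v : 0 <= prod_but j v.
Proof. by apply: prodr_ge0 => l _; exact: sqdist_ge0. Qed.

Lemma prod_allE j v : prod_all v = sqdist j v * prod_but j v.
Proof. by rewrite /prod_all (bigD1 j). Qed.

Lemma prod_but_z j l : l != j -> prod_but j (z l) = 0.
Proof. by move=> lj; rewrite /prod_but (bigD1 l)//= sqdistxx mul0r. Qed.

Lemma sum_prod_all_le : \sum_i p i * prod_all (y i) <= eps.
Proof.
have := test_all; rewrite [X in _ - X]big1; last first.
  by move=> i _; rewrite (prod_allE i) sqdistxx mul0r mulr0.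
by rewrite subr0; apply: le_trans; exact: ler_norm.
Qed.

Lemma sum_prod_but_z j : \sum_i q i * prod_but j (z i) = q j * prod_but j (z j).
Proof.
by rewrite (bigD1 j)//= big1 ?addr0// => l lj; rewrite prod_but_z// mulr0.
Qed.

Lemma prod_but_ge j v (s : R) : 0 <= s -> (forall l, l != j -> s <= sqdist l v) ->
  s ^+ k.-1 <= prod_but j v.
Proof.
move=> s0 hs; have -> : k.-1 = #|predC1 j| by rewrite cardC1 card_ord.
by rewrite -prodr_const; apply: ler_prod => l lj; rewrite s0 hs.
Qed.

(** Far from [z j] the polynomial [prod_but j] is at most [prod_all] / a, so its
    p-moment is at most eps / a; its q-moment is the value at [z j] times q j. *)
Lemma missed_atom_bound j (a b : R) : 0 < a -> 0 <= b ->
  (forall i, a <= sqdist j (y i)) -> (forall l, l != j -> b <= sqdist l (z j)) ->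
  q j * b ^+ k.-1 <= eps * (1 + a^-1).
Proof.
move=> a0 b0 ha hb.
apply: (@le_trans _ _ (q j * prod_but j (z j))).
  by rewrite ler_wpM2l// prod_but_ge.
have := test_but j; rewrite sum_prod_but_z distrC => /(le_trans (ler_norm _)) h.
suff : \sum_i p i * prod_but j (y i) <= eps * a^-1 by move: h; lra.
rewrite ler_pdivlMr// mulr_suml (le_trans _ sum_prod_all_le)//.
apply: ler_sum => i _; rewrite -mulrA ler_wpM2l// (prod_allE j) mulrC.
by rewrite ler_wpM2r// prod_but_ge0.
Qed.

(** Now every y i is close to z i, within a multiple of the separation s, and is
    separated from the other z l. *)
Section matched.
Variables (s T K : R).
Hypothesis s0 : 0 < s.
Hypothesis T1 : 1 <= T.
Hypothesis K0 : 0 <= K.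
Hypothesis sT : s <= T.
Hypothesis sep_y : forall i l, l != i -> s <= enorm (y i - z l).
Hypothesis sep_z : forall i l, l != i -> s <= enorm (z i - z l).
Hypothesis bound_y : forall i l, enorm (y i - z l) <= T.
Hypothesis near_y : forall i, enorm (y i - z i) <= K * s.

Let u i := y i - z i.
Let P := (s ^+ 2) ^+ k.-1.
Let P0 : 0 < P. Proof. by rewrite !exprn_gt0. Qed.

Let sqdist_y i l : l != i -> s ^+ 2 <= sqdist l (y i).
Proof.
by move=> li; rewrite /sqdist -enorm_sqr ler_pXn2r ?nnegrE ?enorm_ge0 ?sep_y// ltW.
Qed.

Let sqdist_z i l : l != i -> s ^+ 2 <= sqdist l (z i).
Proof.
by move=> li; rewrite /sqdist -enorm_sqr ler_pXn2r ?nnegrE ?enorm_ge0 ?sep_z// ltW.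
Qed.

Let sqdist_le i l : 0 <= sqdist l (y i) <= T ^+ 2.
Proof.
rewrite sqdist_ge0/= /sqdist -enorm_sqr ler_pXn2r ?nnegrE ?enorm_ge0 ?bound_y//.
exact: le_trans T1.
Qed.

Let T21 : 1 <= T ^+ 2. Proof. by rewrite exprn_ege1. Qed.

(** All terms of the moment of [prod_all] are nonnegative. *)
Lemma second_order_bound i : p i * sqdist i (y i) <= eps / P.
Proof.
rewrite ler_pdivlMr// -mulrA.
have hP : sqdist i (y i) * P <= prod_all (y i).
  rewrite (prod_allE i) ler_wpM2l ?sqdist_ge0// prod_but_ge ?sqr_ge0// => l li.
  exact: sqdist_y.
apply: (le_trans (ler_wpM2l (p0 i) hP)); apply: le_trans sum_prod_all_le.
rewrite (bigD1 i)//= lerDl; apply: sumr_ge0 => l _; rewrite mulr_ge0//.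
by apply: prodr_ge0 => m _; exact: sqdist_ge0.
Qed.

Let C1 := k%:R * (T * (T ^+ 2) ^+ k).
Let C1_ge0 : 0 <= C1.
Proof. by rewrite !mulr_ge0 ?exprn_ge0// (le_trans _ T1). Qed.

Lemma prod_but_cross_le j l : l != j -> prod_but j (y l) <= (T ^+ 2) ^+ k * sqdist l (y l).
Proof.
move=> lj; rewrite /prod_but (bigD1 l)//= mulrC ler_wpM2r ?sqdist_ge0//.
by rewrite -[k in _ ^+ k]card_ord; apply: prod_le_exp.
Qed.

(** The factor of index l makes [prod_but j] of second order in the displacement
    of y l, which [second_order_bound] controls. *)
Lemma sum_cross_le j : \sum_(l | l != j) p l * (T * prod_but j (y l)) <= eps * (C1 / P).
Proof.
have TT : 0 <= T by rewrite (le_trans _ T1).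
apply: (@le_trans _ _ (\sum_(l < k) T * (T ^+ 2) ^+ k * (eps / P))).
  rewrite big_mkcond; apply: ler_sum => l _.
  case: ifP => [lj|_]; last by rewrite !mulr_ge0 ?exprn_ge0 ?invr_ge0 ?(ltW P0)//; exact: ltW.
  rewrite mulrCA -mulrA ler_wpM2l//.
  apply: (@le_trans _ _ (p l * ((T ^+ 2) ^+ k * sqdist l (y l)))).
    by rewrite ler_wpM2l// prod_but_cross_le.
  by rewrite mulrCA ler_wpM2l ?exprn_ge0// second_order_bound.
rewrite sumr_const card_ord /C1 -mulr_natl le_eqVlt; apply/orP; left; apply/eqP; ring.
Qed.

(** Test with the unit vector w along the displacement of y j: the term of index j
    is the one to bound, and the others are of second order. *)
Lemma first_order_bound j :
  p j * (enorm (u j) * prod_but j (y j)) <= eps * (1 + C1 / P).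
Proof.
pose w := (enorm (u j))^-1 *: u j.
have w1 a : `|w ord0 a| <= 1.
  rewrite mxE normrM normfV (ger0_norm (enorm_ge0 _)).
  have [->|uN] := eqVneq (enorm (u j)) 0; first by rewrite invr0 mul0r.
  have up : 0 < enorm (u j) by rewrite lt_neqAle eq_sym uN enorm_ge0.
  by rewrite mulrC ler_pdivrMr// mul1r enorm_entry.
(* w = 0 if the displacement vanishes *)
have wE : enorm w <= 1.
  rewrite enormZ normfV (ger0_norm (enorm_ge0 _)).
  have [->|uN] := eqVneq (enorm (u j)) 0; first by rewrite mulr0.
  by rewrite mulVf.
have wu : dotrv w (u j) = enorm (u j).
  have -> : dotrv w (u j) = (enorm (u j))^-1 * enorm (u j) ^+ 2.
    rewrite enorm_sqr /dotrv /sqnorm mulr_sumr; apply: eq_bigr => a _.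
    by rewrite mxE; ring.
  have [->|uN] := eqVneq (enorm (u j)) 0; first by rewrite invr0 mul0r.
  by rewrite expr2 mulKf.
have := test_linear j w1.
rewrite [X in _ - X]big1 ?subr0; last first.
  move=> l _; have [->|lj] := eqVneq l j.
    by rewrite /linear_but subrr /dotrv big1 ?mul0r ?mulr0// => a _; rewrite !mxE mulr0.
  by rewrite /linear_but prod_but_z// !mulr0.
move=> /(le_trans (ler_norm _)); rewrite (bigD1 j)//= {1}/linear_but wu => h.
have cross : - (\sum_(l | l != j) p l * linear_but j w (y l)) <= eps * (C1 / P).
  apply: le_trans (sum_cross_le j); rewrite -sumrN; apply: ler_sum => l lj.
  rewrite -mulrN ler_wpM2l// (le_trans (ler_norm _))// normrN /linear_but normrM.
  rewrite (ger0_norm (prod_but_ge0 _ _)) ler_wpM2r ?prod_but_ge0//.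
  apply: (le_trans (dotrv_le _ _)).
  by rewrite -[T]mul1r ler_pM ?enorm_ge0.
by move: h cross; lra.
Qed.

Let C2 := k%:R * (2 + K) * (1 + (2 + K) * K) ^+ k.
Let C2_ge0 : 0 <= C2.
Proof. by rewrite !mulr_ge0 ?exprn_ge0 ?addr_ge0 ?mulr_ge0 ?addr_ge0. Qed.

(** Each factor of [prod_but j] is at least s^2 at y j, so moving from y j to z j
    changes it by a relative error of order |u j| / s. *)
Lemma prod_but_relative j :
  `|prod_but j (z j) - prod_but j (y j)| <= C2 / s * (enorm (u j) * prod_but j (y j)).
Proof.
pose t := (2 + K) * (enorm (u j) / s).
have t0 : 0 <= t by rewrite mulr_ge0 ?addr_ge0// divr_ge0 ?enorm_ge0 ?ltW.
have tK : t <= (2 + K) * K.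
  by rewrite ler_wpM2l ?addr_ge0// ler_pdivrMr// near_y.
have rel l : l != j -> `|sqdist l (z j) - sqdist l (y j)| <= t * sqdist l (y j).
  move=> lj; pose v := y j - z l.
  have -> : sqdist l (z j) - sqdist l (y j) = enorm (u j) ^+ 2 - 2 * dotrv v (u j).
    rewrite enorm_sqr /sqdist (_ : z j - z l = v - 1 *: u j); last first.
      by rewrite scale1r /v /u; apply/rowP => a; rewrite !mxE; ring.
    by rewrite sqnormD_scale -/v expr1n; ring.
  have sv := sep_y lj; rewrite -/v in sv.
  have -> : sqdist l (y j) = enorm v ^+ 2 by rewrite enorm_sqr.
  apply: (le_trans (ler_normB _ _)).
  rewrite [`|2 * _|]normrM (ger0_norm (sqr_ge0 _)) (ger0_norm (ler0n _ 2)).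
  have dv := dotrv_le v (u j); have nu := near_y j; rewrite -/(u j) in nu.
  have un := enorm_ge0 (u j).
  apply: (@le_trans _ _ (K * s * enorm (u j) + 2 * (enorm v * enorm (u j)))).
    by rewrite lerD ?expr2 ?ler_wpM2r// ler_wpM2l.
  apply: (@le_trans _ _ (K * enorm v * enorm (u j) + 2 * (enorm v * enorm (u j)))).
    by rewrite lerD2r ler_wpM2r// ler_wpM2l.
  rewrite (_ : _ + _ = (2 + K) * (enorm (u j) * enorm v)); last by ring.
  rewrite /t -mulrA ler_wpM2l ?addr_ge0// mulrAC -mulrA ler_wpM2l//.
  by rewrite ler_pdivlMr// expr2 ler_wpM2l// enorm_ge0.
have := prod_perturb (index_enum 'I_k) t0 (fun l (_ : l != j) => sqdist_ge0 l (y j)) rel.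
rewrite -[size _]/(size (index_enum 'I_k)) -/(prod_but j (z j)) -/(prod_but j (y j)).
have -> : size (index_enum 'I_k) = k by rewrite -[RHS]card_ord cardE enumT.
move=> /le_trans; apply.
rewrite mulrA ler_wpM2r ?prod_but_ge0//.
apply: (le_trans (expr1D_sub1_le k t0)).
apply: (@le_trans _ _ (k%:R * t * (1 + (2 + K) * K) ^+ k)).
  apply: ler_wpM2l; first by rewrite mulr_ge0.
  apply: lerXn2r; rewrite ?nnegrE ?lerD2l//; first by rewrite addr_ge0.
  by rewrite addr_ge0// mulr_ge0 ?addr_ge0.
by rewrite /t /C2 le_eqVlt; apply/orP; left; apply/eqP; field; rewrite gt_eqF.
Qed.

(** Compare p j with q j through [prod_but j] at z j.  Moving the point y j to z j costs
    C2 / s times the quantity of [first_order_bound], and this is the last factor s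
    lost in the exponent 4 k - 3. *)
Lemma weight_bound j : P * `|p j - q j| <= eps * (1 + C1 / P) * (1 + C2 / s).
Proof.
have hz : P <= prod_but j (z j).
  by apply: prod_but_ge; rewrite ?sqr_ge0// => l; exact: sqdist_z.
apply: (@le_trans _ _ `|p j * prod_but j (z j) - q j * prod_but j (z j)|).
  by rewrite -mulrBl normrM mulrC ler_wpM2l// ger0_norm ?prod_but_ge0.
have cross : \sum_(l | l != j) p l * prod_but j (y l) <= eps * (C1 / P).
  apply: le_trans (sum_cross_le j); apply: ler_sum => l _.
  by rewrite ler_wpM2l// ler_peMl// prod_but_ge0.
have cross0 : 0 <= \sum_(l | l != j) p l * prod_but j (y l).
  by apply: sumr_ge0 => l _; rewrite mulr_ge0// prod_but_ge0.
have := test_but j; rewrite sum_prod_but_z (bigD1 j)//=.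
have rel := ler_wpM2l (p0 j) (prod_but_relative j).
have fo := first_order_bound j.
have C2s : 0 <= C2 / s by rewrite divr_ge0// ltW.
have e1 : p j * (C2 / s * (enorm (u j) * prod_but j (y j))) <= C2 / s * (eps * (1 + C1 / P)).
  by rewrite mulrCA ler_wpM2l.
move: rel cross cross0 e1.
set X := \sum_(l | _) _; set a := prod_but j (z j); set b := prod_but j (y j).
move=> rel cross cross0 e1 h.
rewrite (_ : p j * a - q j * a = (p j * b + X - q j * a) + p j * (a - b) - X); last by ring.
apply: (le_trans (ler_normB _ _)); rewrite (ger0_norm cross0).
have := ler_normD (p j * b + X - q j * a) (p j * (a - b)).
rewrite [`|p j * (a - b)|]normrM (ger0_norm (p0 j)).
by move: rel e1 h cross; lra.
Qed.

(** Multiplying by the powers of s in the denominators: 2 (k - 1) from the values of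
    [prod_but], 2 (k - 1) from the cross terms, and one from [prod_but_relative]. *)
Lemma matched_bound j :
  s ^+ (4 * k - 3) * (p j * enorm (u j)) <= eps * ((T ^+ 2) ^+ k + C1) * T /\
  s ^+ (4 * k - 3) * `|p j - q j| <= eps * ((T ^+ 2) ^+ k + C1) * (T + C2).
Proof.
have TT : 0 <= T by rewrite (le_trans _ T1).
have k0 : (0 < k)%N by case: k j => [[]|].
have sE : s ^+ (4 * k - 3) = P * P * s.
  rewrite /P -!exprM -exprD -exprSr; congr (_ ^+ _).
  exact: exponent_split.
have PT : P <= (T ^+ 2) ^+ k.
  apply: (@le_trans _ _ ((T ^+ 2) ^+ k.-1)).
    apply: lerXn2r; rewrite ?nnegrE ?sqr_ge0//.
    by apply: lerXn2r; rewrite ?nnegrE ?(ltW s0).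
  by rewrite ler_weXn2l// leq_pred.
have hP : P * (1 + C1 / P) <= (T ^+ 2) ^+ k + C1.
  by rewrite mulrDr mulr1 mulrCA divff ?gt_eqF// mulr1 lerD2r.
have fo : P * (p j * enorm (u j)) <= eps * (1 + C1 / P).
  apply: le_trans (first_order_bound j); rewrite mulrC -mulrA ler_wpM2l// ler_wpM2l ?enorm_ge0//.
  by apply: prod_but_ge; rewrite ?sqr_ge0// => l; exact: sqdist_y.
have wb := weight_bound j.
have PC0 : 0 <= P * (1 + C1 / P) by rewrite mulr_ge0 ?(ltW P0)// addr_ge0// divr_ge0// ltW.
split; rewrite sE.
  apply: (@le_trans _ _ (P * (eps * (1 + C1 / P)) * s)).
    by rewrite mulrAC ler_wpM2r ?(ltW s0)// -mulrA ler_wpM2l// ltW.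
  by rewrite (mulrCA P eps) ler_pM ?(ltW s0)// ?ler_wpM2l// mulr_ge0.
apply: (@le_trans _ _ (P * (eps * (1 + C1 / P) * (1 + C2 / s)) * s)).
  rewrite [leLHS]mulrAC ler_wpM2r ?(ltW s0)// -[leLHS]mulrA ler_wpM2l//.
  exact: ltW.
rewrite (_ : _ * s = eps * (P * (1 + C1 / P)) * (s + C2)); last by field; rewrite !gt_eqF.
apply: ler_pM.
- exact: mulr_ge0.
- by rewrite addr_ge0// ltW.
- exact: ler_wpM2l.
- by rewrite lerD2r.
Qed.

End matched.

End discrete_lower_bound.

(** * Separation, weights and relabelling *)

Section true_mixings.
Context {R : realType} {d k : nat}.
Implicit Types G H : mixing R d k.

Lemma sep_le H j l : j != l -> sep H <= enorm (atom H j - atom H l).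
Proof.
move=> jl; apply: ge_inf.
  by exists 0 => _ [p _ <-]; exact: enorm_ge0.
by exists (j, l).
Qed.

Lemma min_weight_le H j : (forall i, 0 < weight H i) -> min_weight H <= weight H j.
Proof.
move=> w0; apply: ge_inf; last by exists j.
by exists 0 => _ [i _ <-]; exact: ltW.
Qed.

Lemma min_weight_gt0 H : (0 < k)%N -> (forall i, 0 < weight H i) -> 0 < min_weight H.
Proof.
move=> k0 w0; pose i0 := Ordinal k0.
pose i1 := [arg min_(i < i0) weight H i]%O.
have i1P j : weight H i1 <= weight H j.
  by rewrite /i1; case: arg_minP => // i _; exact.
apply: (lt_le_trans (w0 i1)); apply: lb_le_inf; first by exists (weight H i0), i0.
by move=> _ [j _ <-].
Qed.

Lemma weights_le1 H i : (forall i, 0 <= weight H i) -> \sum_i weight H i = 1 -> weight H i <= 1.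
Proof.
by move=> w0 w1; rewrite -w1 (bigD1 i)//= lerDl; apply: sumr_ge0.
Qed.

Definition permute (f : 'I_k -> 'I_k) G : mixing R d k :=
  Mixing (weight G \o f) (atom G \o f).

Section permute.
Variable f : 'I_k -> 'I_k.
Hypothesis finj : injective f.

Lemma prob_weights_permute G : prob_weights G -> prob_weights (permute f G).
Proof.
move=> [w0 w1]; split=> [i|/=]; first exact: w0.
by rewrite -w1 [RHS](reindex_inj finj).
Qed.

Lemma dH_permute S G H : dH S (permute f G) H = dH S G H.
Proof.
suff eqp : mix_density S (permute f G) = mix_density S G by rewrite /dH eqp.
by apply/funext => x; rewrite /mix_density [RHS](reindex_inj finj).
Qed.

Lemma W1_permute G H : W1 (permute f G) H = W1 G H.
Proof.
suff eqm : mixing_measure (permute f G) = mixing_measure G by rewrite /W1 eqm.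
by apply/funext => A; rewrite /mixing_measure [RHS](reindex_inj finj).
Qed.

End permute.

End true_mixings.

(** * Lower bounds on the Hellinger distance *)

Section hellinger_lower_bound.
Context {R : realType} {d : nat}.
Variables (S : 'M[R]_d) (r : R) (k : nat).
Hypothesis symS : S^T = S.
Hypothesis posS : forall v : 'rV[R]_d, v != 0 -> 0 < qform S v.
Hypothesis r0 : 0 < r.
Hypothesis k2 : (2 <= k)%N.
Implicit Types (G H : mixing R d k) (x w : 'rV[R]_d).

Let z H (j : 'I_k) : 'rV[R]_d := expv (atom H j).
Let inball G := forall i, enorm (atom G i) <= r.

(** The coordinates of [expv x - z H j] are exponential sums with a constant term
    bounded by exp r, and exponential sums form an algebra; degrees and
    coefficients are bounded in terms of d, k and r only. *)
Lemma polynomials_are_exp_sums : exists B D : R, [/\ 0 < B, 0 <= D &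
  forall H, inball H ->
  [/\ exp_sum B D (prod_all (z H) \o expv),
      forall j, exp_sum B D (prod_but (z H) j \o expv) &
      forall j w, (forall a, `|w ord0 a| <= 1) ->
        exp_sum B D (linear_but (z H) j w \o expv)]].
Proof.
pose E := 1 + expR r; pose nd := size (index_enum 'I_d); pose nk := size (index_enum 'I_k).
pose B2 := 1 + (E * E) *+ nd; pose BQ := B2 ^+ nk; pose DQ : R := (1 + 1) *+ nk.
have E1 : 1 <= E by rewrite lerDl expR_ge0.
have E0 : 0 <= E by rewrite (le_trans ler01).
have B21 : 1 <= B2 by rewrite lerDl mulrn_wge0// mulr_ge0.
have BQ1 : 1 <= BQ by rewrite exprn_ege1.
have DQ0 : 0 <= DQ by rewrite mulrn_wge0// addr_ge0.
have B0 : 0 <= E *+ nd by rewrite mulrn_wge0.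
exists ((1 + E *+ nd) * BQ), (1 + DQ); split.
- by rewrite mulr_gt0 ?(lt_le_trans ltr01)// lerDl.
- by rewrite addr_ge0.
move=> H bH.
have coord j a : exp_sum E 1 (fun x => (expv x - z H j) ord0 a).
  have := exp_sum_weaken (lexx _) ler01 (@exp_sum_cst R d (- (z H j) ord0 a)).
  move=> /(exp_sumD (exp_sum_coord a)).
  rewrite (_ : (fun _ => _) = (fun x => (expv x - z H j) ord0 a)); last first.
    by apply/funext => x; rewrite !mxE.
  apply: exp_sum_weaken => //; rewrite lerD2l normrN mxE ger0_norm ?expR_ge0// ler_expR.
  exact: le_trans (ler_norm _) (le_trans (enorm_entry _ _) (bH j)).
have dist l : exp_sum B2 (1 + 1) (sqdist (z H) l \o expv).
  have := exp_sum_sum (index_enum 'I_d) (fun a => exp_sumM (coord l a) (coord l a)).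
  move=> /(_ (addr_ge0 ler01 ler01)).
  rewrite (_ : (fun _ => _) = sqdist (z H) l \o expv); last first.
    by apply/funext => x; apply: eq_bigr => a _; rewrite expr2.
  by apply: exp_sum_weaken => //; rewrite lerDr.
have prodP (P : pred 'I_k) :
    exp_sum BQ DQ (fun x => \prod_(l | P l) sqdist (z H) l (expv x)).
  exact: (exp_sum_prod (index_enum 'I_k) P B21 (addr_ge0 ler01 ler01) dist).
have wB : BQ <= (1 + E *+ nd) * BQ by rewrite ler_peMl ?lerDl// (le_trans ler01).
have wD : DQ <= 1 + DQ by rewrite lerDr.
split.
- exact: exp_sum_weaken wB wD (prodP xpredT).
- by move=> j; exact: exp_sum_weaken wB wD (prodP _).
move=> j w w1.
have lin : exp_sum (E *+ nd) 1 (fun x => dotrv w (expv x - z H j)).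
  apply: (exp_sum_sum (index_enum 'I_d) _ ler01) => a.
  have := exp_sumM (@exp_sum_cst R d (w ord0 a)) (coord j a); rewrite add0r.
  by apply: exp_sum_weaken => //; rewrite ler_piMl.
have := exp_sumM lin (prodP (fun l => l != j)).
by apply: exp_sum_weaken => //; rewrite ler_wpM2r ?(le_trans ler01 BQ1)// lerDr.
Qed.

Let tests H G (eps : R) :=
  [/\ `|\sum_i weight G i * prod_all (z H) (z G i)
        - \sum_i weight H i * prod_all (z H) (z H i)| <= eps,
      forall j, `|\sum_i weight G i * prod_but (z H) j (z G i)
        - \sum_i weight H i * prod_but (z H) j (z H i)| <= eps &
      forall j w, (forall a, `|w ord0 a| <= 1) ->
        `|\sum_i weight G i * linear_but (z H) j w (z G i)
        - \sum_i weight H i * linear_but (z H) j w (z H i)| <= eps].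

Lemma tests_le_dH : exists2 C, 0 < C & forall G H,
  prob_weights G -> prob_weights H -> inball G -> inball H -> tests H G (C * dH S G H).
Proof.
have [B [D [B0 D0 hT]]] := polynomials_are_exp_sums.
have [C C0 hC] := moment_dist_le_dH r symS posS D0.
exists (B * C); first exact: mulr_gt0.
move=> G H pG pH bG bH; have [h1 h2 h3] := hT H bH; rewrite -mulrA; split.
- exact: hC h1.
- by move=> j; exact: hC (h2 j).
- by move=> j w w1; exact: hC (h3 j w w1).
Qed.

Let em := expR (- r).
Let ep := expR r.
Let em0 : 0 < em. Proof. exact: expR_gt0. Qed.
Let ep0 : 0 < ep. Proof. exact: expR_gt0. Qed.
Let em1 : em <= 1. Proof. by rewrite -expR0 ler_expR oppr_le0 ltW. Qed.
Let ep1 : 1 <= ep. Proof. by rewrite -expR0 ler_expR ltW. Qed.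
Let emp : em * ep = 1. Proof. by rewrite -expRD addNr expR0. Qed.

Let z_ge G H i j : inball G -> inball H ->
  em * enorm (atom G i - atom H j) <= enorm (z G i - z H j).
Proof. by move=> bG bH; have /andP[] := expv_lip (bG i) (bH j). Qed.

Let z_le G H i j : inball G -> inball H ->
  enorm (z G i - z H j) <= ep * enorm (atom G i - atom H j).
Proof. by move=> bG bH; have /andP[] := expv_lip (bG i) (bH j). Qed.

Let ball_diam G H i j : inball G -> inball H -> enorm (atom G i - atom H j) <= 2 * r.
Proof.
move=> bG bH; apply: (le_trans (enormD _ _)); rewrite enormN mulrDl !mul1r.
by rewrite lerD.
Qed.

Let separated H (D : R) := forall j l, j != l -> D <= enorm (atom H j - atom H l).

Let sep_le_diam H D : inball H -> separated H D -> D <= 2 * r.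
Proof.
move=> bH hD; have k0 : (0 < k)%N by exact: ltnW.
have := hD (Ordinal k0) (Ordinal k2) isT; move=> /le_trans; apply; exact: ball_diam.
Qed.

(** [missed_atom_bound] gives the exponent 2 k, which is at most 4 k - 3 because
    k >= 2; the surplus powers of D are bounded by the diameter of the ball. *)
Lemma dH_ge_missed : exists2 c, 0 < c & forall G H D j,
  prob_weights G -> prob_weights H -> inball G -> inball H -> 0 < D -> separated H D ->
  (forall i, D / 4 <= enorm (atom G i - atom H j)) ->
  c * weight H j * D ^+ (4 * k - 3) <= dH S G H.
Proof.
have [C C0 hC] := tests_le_dH.
pose c1 := (em / 4) ^+ (2 * k); pose c2 := (2 * r) ^+ (2 * k - 3).
have c10 : 0 < c1 by rewrite exprn_gt0// divr_gt0.
have r20 : 0 < 2 * r by rewrite mulr_gt0.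
have c20 : 0 < c2 by rewrite exprn_gt0.
pose c3 := C * (1 + (2 * r) ^+ 2) * c2.
have c30 : 0 < c3 by rewrite !mulr_gt0// ltr_pwDl// exprn_ge0// ltW.
exists (c1 / c3); first exact: divr_gt0.
move=> G H D j pG pH bG bH D0 hD far.
have D2r := sep_le_diam bH hD.
pose a := (em * (D / 4)) ^+ 2; pose b := (em * D) ^+ 2.
have a0 : 0 < a by rewrite exprn_gt0// mulr_gt0// divr_gt0.
have ab : a <= b.
  apply: lerXn2r; rewrite ?nnegrE ?mulr_ge0 ?divr_ge0 ?(ltW em0) ?(ltW D0)//.
  by rewrite ler_wpM2l ?(ltW em0)// ler_pdivrMr// ler_peMr ?(ltW D0)// ler1n.
have b0 : 0 <= b by exact: sqr_ge0.
have [h1 h2 _] := hC G H pG pH bG bH.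
have far' i : a <= sqdist (z H) j (z G i).
  rewrite /sqdist -enorm_sqr; apply: lerXn2r; rewrite ?nnegrE ?enorm_ge0//.
    by rewrite mulr_ge0 ?divr_ge0 ?(ltW em0) ?(ltW D0).
  by apply: le_trans (z_ge _ _ bG bH); rewrite ler_wpM2l ?(ltW em0).
have sep' l : l != j -> b <= sqdist (z H) l (z H j).
  move=> lj; rewrite /sqdist -enorm_sqr; apply: lerXn2r; rewrite ?nnegrE ?enorm_ge0//.
    by rewrite mulr_ge0 ?(ltW em0) ?(ltW D0).
  by apply: le_trans (z_ge _ _ bH bH); rewrite ler_wpM2l ?(ltW em0)// hD// eq_sym.
have := missed_atom_bound pG.1 pH.1 h1 h2 a0 b0 far' sep'.
set h := dH S G H; have h0 : 0 <= h by exact: dH_ge0.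
move=> key.
have k0 : (0 < k)%N by exact: ltnW.
have aD : a <= (2 * r) ^+ 2.
  apply: lerXn2r; rewrite ?nnegrE ?mulr_ge0 ?divr_ge0 ?(ltW em0) ?(ltW D0) ?(ltW r0)//.
  rewrite -[leRHS]mul1r ler_pM ?divr_ge0 ?(ltW em0) ?(ltW D0)//.
  by rewrite ler_pdivrMr// (le_trans D2r)// ler_peMr ?(ltW r20)// ler1n.
have key2 : weight H j * a ^+ k <= C * h * (1 + (2 * r) ^+ 2).
  apply: (@le_trans _ _ (weight H j * b ^+ k.-1 * a)).
    rewrite -[k in a ^+ k](prednK k0) exprSr mulrA ler_wpM2r ?(ltW a0)//.
    by rewrite ler_wpM2l ?pH.1// lerXn2r ?nnegrE// ltW.
  apply: (@le_trans _ _ (C * h * (1 + a^-1) * a)); first by rewrite ler_wpM2r ?(ltW a0).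
  rewrite -mulrA ler_wpM2l ?(mulr_ge0 (ltW C0))//.
  by rewrite mulrDl mul1r mulVf ?gt_eqF// addrC lerD2l.
have Dexp : D ^+ (4 * k - 3) <= D ^+ (2 * k) * c2.
  rewrite (_ : 4 * k - 3 = 2 * k + (2 * k - 3))%N; last first.
    by rewrite addnBA -?mulnDl//; rewrite (leq_trans _ (leq_mul (leqnn 2) k2)).
  rewrite exprD ler_wpM2l ?exprn_ge0 ?(ltW D0)// lerXn2r ?nnegrE ?(ltW D0) ?(ltW r20)//.
have aE : a ^+ k = c1 * D ^+ (2 * k).
  by rewrite /a /c1 -exprM -exprMn; congr (_ ^+ _); ring.
rewrite aE in key2.
apply: (@le_trans _ _ (c1 / c3 * weight H j * (D ^+ (2 * k) * c2))).
  by rewrite ler_wpM2l// mulr_ge0 ?pH.1// divr_ge0// ltW.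
rewrite (_ : _ * (D ^+ _ * c2) = (weight H j * (c1 * D ^+ (2 * k))) * c2 / c3); last by ring.
rewrite ler_pdivrMr// (_ : h * c3 = C * h * (1 + (2 * r) ^+ 2) * c2); last by rewrite /c3; ring.
by rewrite ler_wpM2r// ltW.
Qed.

(** In the coordinates [expv] distances change by factors between exp (- r) and
    exp r, so the reference points are separated by s = exp (- r) D / 2, also
    from the competitors, since these are within D / 4 of their partners. *)
Lemma dH_ge_matched : exists2 c, 0 < c & forall G H D,
  prob_weights G -> prob_weights H -> inball G -> inball H -> 0 < D -> separated H D ->
  (forall j, enorm (atom G j - atom H j) <= D / 4) ->
  ((c * D ^+ (4 * k - 3))%:E * W1 G H <= (dH S G H)%:E)%E.
Proof.
have [C C0 hC] := tests_le_dH.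
pose T := 1 + ep * (2 * r); pose K := ep * ep.
pose C1 := (T ^+ 2) ^+ k + k%:R * (T * (T ^+ 2) ^+ k).
pose C2 := k%:R * (2 + K) * (1 + (2 + K) * K) ^+ k.
pose A := k%:R * (ep * (C1 * T) + 2 * r * (C1 * (T + C2))).
have r20 : 0 < 2 * r by rewrite mulr_gt0.
have T1 : 1 <= T by rewrite lerDl mulr_ge0// ltW.
have T0 : 0 < T by exact: lt_le_trans T1.
have K0 : 0 <= K by rewrite mulr_ge0// ltW.
have K20 : 0 <= 2 + K by rewrite addr_ge0.
have C20 : 0 <= C2.
  by rewrite /C2; move: (2 + K) K20 => u u0; rewrite mulr_ge0 ?mulr_ge0// exprn_ge0// addr_ge0// mulr_ge0.
have C10 : 0 < C1 by rewrite ltr_pwDl ?exprn_gt0// !mulr_ge0 ?exprn_ge0// ltW.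
have k0 : (0 < k)%N by exact: ltnW.
have A0 : 0 < A.
  rewrite mulr_gt0 ?ltr0n// addr_gt0// !mulr_gt0//.
  by rewrite ltr_pwDl.
pose e := (4 * k - 3)%N.
have ee0 : 0 < (em / 2) ^+ e by rewrite exprn_gt0// divr_gt0.
exists ((em / 2) ^+ e / (A * C)); first by rewrite divr_gt0// mulr_gt0.
move=> G H D pG pH bG bH D0 hD near.
have D2r := sep_le_diam bH hD.
set h := dH S G H; have h0 : 0 <= h by exact: dH_ge0.
pose s := em * (D / 2).
have s0 : 0 < s by rewrite mulr_gt0// divr_gt0.
have sT : s <= T.
  apply: (@le_trans _ _ (1 * (2 * r))).
    rewrite ler_pM ?(ltW em0) ?divr_ge0 ?(ltW D0)//.
    by rewrite ler_pdivrMr// (le_trans D2r)// ler_peMr ?(ltW r20)// ler1n.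
  by rewrite (@le_trans _ _ (ep * (2 * r)))// ?lerDr// ler_wpM2r ?(ltW r20).
have sep_z i l : l != i -> s <= enorm (z H i - z H l).
  move=> li; apply: le_trans (z_ge _ _ bH bH); rewrite ler_wpM2l ?(ltW em0)//.
  have := hD i l; rewrite eq_sym => /(_ li) /(le_trans _); apply.
  by rewrite ler_pdivrMr// ler_peMr ?(ltW D0)// ler1n.
have sep_y i l : l != i -> s <= enorm (z G i - z H l).
  move=> li; apply: le_trans (z_ge _ _ bG bH); rewrite ler_wpM2l ?(ltW em0)//.
  have := hD i l; rewrite eq_sym => /(_ li) hs.
  have := enorm_triangle (atom H i) (atom G i) (atom H l).
  by rewrite (enormB (atom H i) (atom G i)); have := near i; lra.
have bound_y i l : enorm (z G i - z H l) <= T.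
  apply: (le_trans (z_le _ _ bG bH)); rewrite ler_wpDl// ler_wpM2l ?(ltW ep0)//.
  exact: ball_diam.
have near_y i : enorm (z G i - z H i) <= K * s.
  apply: (le_trans (z_le _ _ bG bH)).
  rewrite /K /s mulrA -(mulrA ep ep em) (mulrC ep em) emp mulr1 ler_wpM2l ?(ltW ep0)//.
  by have := near i; lra.
have [h1 h2 h3] := hC G H pG pH bG bH.
have key := matched_bound pG.1 h1 h2 h3 s0 T1 K0 sT sep_y sep_z bound_y near_y.
have W := W1_le_matched pG pH (fun i j => ball_diam i j bG bH).
have cD0 : 0 <= (em / 2) ^+ e / (A * C) * D ^+ e.
  by rewrite mulr_ge0 ?exprn_ge0 ?(ltW D0)// divr_ge0 ?(ltW ee0)// ltW// mulr_gt0.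
apply: (@le_trans _ _ (((em / 2) ^+ e / (A * C) * D ^+ e)%:E *
  (\sum_i weight G i * enorm (atom G i - atom H i) +
    2 * r * \sum_i `|weight G i - weight H i|)%:E)%E).
  by apply: lee_wpmul2l => //; rewrite lee_fin.
rewrite -EFinM lee_fin -/e in key *.
rewrite (_ : (em / 2) ^+ e / (A * C) * D ^+ e = s ^+ e / (A * C)); last first.
  by rewrite mulrAC -exprMn /s; congr (_ ^+ _ / _); ring.
rewrite mulrAC ler_pdivrMr ?(mulr_gt0 A0 C0)//.
rewrite mulrDr mulr_sumr (mulrCA (s ^+ e)) mulr_sumr.
apply: (@le_trans _ _ (\sum_(i < k) ep * (C * h * C1 * T) +
   2 * r * \sum_(i < k) C * h * C1 * (T + C2))).
  apply: lerD.
    apply: ler_sum => i _; have [+ _] := key i; rewrite -/C1 => ki.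
    apply: (@le_trans _ _ (ep * (s ^+ e * (weight G i * enorm (z G i - z H i))))); last first.
      by rewrite ler_wpM2l ?(ltW ep0).
    rewrite [leRHS]mulrCA ler_wpM2l ?exprn_ge0 ?(ltW s0)//.
    rewrite [leRHS]mulrCA ler_wpM2l ?pG.1//.
    rewrite -ler_pdivrMl// -expRN -/em.
    exact: z_ge.
  by rewrite ler_wpM2l ?(ltW r20)//; apply: ler_sum => i _; have [_] := key i.
rewrite !sumr_const card_ord -(mulr_natl (ep * _)) -(mulr_natl (C * h * C1 * _)) /A.
by rewrite le_eqVlt; apply/orP; left; apply/eqP; ring.
Qed.

End hellinger_lower_bound.

(** * Hellinger distance against Wasserstein distance *)

Section hellinger_wasserstein.
Context {R : realType} {d : nat}.
Variables (S : 'M[R]_d) (r : R) (k : nat).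
Hypothesis symS : S^T = S.
Hypothesis posS : forall v : 'rV[R]_d, v != 0 -> 0 < qform S v.
Hypothesis r0 : 0 < r.
Hypothesis k2 : (2 <= k)%N.
Implicit Types (G H : mixing R d k).

Definition eball : set 'rV[R]_d := [set x | enorm x <= r].

(** The alternative on which the lower bounds are based: either the atoms of G can
    be paired with those of H, or some atom of H is missed. *)
Definition covering H G := forall j, exists i, enorm (atom G i - atom H j) <= sep H / 4.

Lemma true_mixing_prob H (Theta : set 'rV[R]_d) : true_mixing Theta H -> prob_weights H.
Proof. by move=> [_ w0 w1 _]; split => // i; rewrite ltW. Qed.

Lemma mix_class_prob G (Theta : set 'rV[R]_d) : mix_class Theta G -> prob_weights G.
Proof. by move=> [_ w0 w1]; split => // i; have /andP[] := w0 i. Qed.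

(** Balls of radius [sep H / 4] around the atoms of H are disjoint, so the atoms of G
    chosen in them are distinct and, both measures having k atoms, exhaust G.
    Relabelling G changes neither its density nor its measure. *)
Lemma dH_ge_covering : exists2 c, 0 < c & forall H G,
  true_mixing eball H -> mix_class eball G -> covering H G ->
  ((c * sep H ^+ (4 * k - 3))%:E * W1 G H <= (dH S G H)%:E)%E.
Proof.
have [c c0 hc] := dH_ge_matched symS posS r0 k2; exists c => // H G tH mG cov.
have pH := true_mixing_prob tH; have pG := mix_class_prob mG.
have [bH _ _ sep0] := tH; have [bG _ _] := mG.
pose f j := sval (cid (cov j)).
have fP j : enorm (atom G (f j) - atom H j) <= sep H / 4 by exact: svalP (cid (cov j)).
have finj : injective f.
  move=> j l fjl; apply/eqP; apply: contraT => jl.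
  have := sep_le H jl; have := fP j; have := fP l; rewrite fjl.
  have := enorm_triangle (atom H j) (atom G (f l)) (atom H l).
  by rewrite (enormB (atom H j) (atom G _)); move: sep0; lra.
rewrite -(W1_permute finj) -(dH_permute finj).
apply: hc => //.
- exact: prob_weights_permute.
- by move=> i; exact: bG.
- by move=> j l; exact: sep_le.
Qed.

Lemma dH_ge_not_covering : exists2 c, 0 < c & forall H G,
  true_mixing eball H -> mix_class eball G -> ~ covering H G ->
  c * min_weight H * sep H ^+ (4 * k - 3) <= dH S G H.
Proof.
have [c c0 hc] := dH_ge_missed symS posS r0 k2; exists c => // H G tH mG.
have pH := true_mixing_prob tH; have pG := mix_class_prob mG.
have [bH wH _ sep0] := tH; have [bG _ _] := mG.
move=> /existsNP[j /forallNP far].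
apply: (@le_trans _ _ (c * weight H j * sep H ^+ (4 * k - 3))).
  rewrite ler_wpM2r ?exprn_ge0 ?(ltW sep0)// ler_wpM2l ?(ltW c0)//.
  exact: min_weight_le.
apply: hc => //; first by move=> i l; exact: sep_le.
by move=> i; have /negP := far i; rewrite -ltNge => /ltW.
Qed.

Lemma W1_le_diam H G : true_mixing eball H -> mix_class eball G ->
  (W1 G H <= (6 * r)%:E)%E.
Proof.
move=> tH mG; have pH := true_mixing_prob tH; have pG := mix_class_prob mG.
have [bH _ _ _] := tH; have [bG _ _] := mG.
have diam i j : enorm (atom G i - atom H j) <= 2 * r.
  apply: (le_trans (enormD _ _)); rewrite enormN mulrDl !mul1r.
  by rewrite lerD; [by []|exact: bG|exact: bH].
apply: (le_trans (W1_le_matched pG pH diam)); rewrite lee_fin.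
have h1 : \sum_i weight G i * enorm (atom G i - atom H i) <= 2 * r.
  rewrite -[leRHS]mul1r -[X in _ <= X * _]pG.2 mulr_suml; apply: ler_sum => i _.
  by rewrite ler_wpM2l ?pG.1.
have h2 : \sum_i `|weight G i - weight H i| <= 2.
  apply: (@le_trans _ _ (\sum_i (weight G i + weight H i))).
    apply: ler_sum => i _; apply: (le_trans (ler_normB _ _)).
    by rewrite !ger0_norm ?pG.1 ?pH.1.
  by rewrite big_split/= pG.2 pH.2.
have : 2 * r * \sum_i `|weight G i - weight H i| <= 2 * r * 2.
  by rewrite ler_wpM2l// mulr_ge0// ltW.
by move: h1; lra.
Qed.

(** If an atom is missed, the lower bound on the Hellinger distance does not see
    W1, but W1 is at most a multiple of the radius. *)
Lemma dH_ge_W1 : exists2 c, 0 < c & forall H G,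
  true_mixing eball H -> mix_class eball G ->
  ((c * min_weight H * sep H ^+ (4 * k - 3))%:E * W1 G H <= (dH S G H)%:E)%E.
Proof.
have [c1 c10 h1] := dH_ge_covering; have [c2 c20 h2] := dH_ge_not_covering.
pose c := Num.min c1 (c2 / (6 * r)).
have r60 : 0 < 6 * r by rewrite mulr_gt0.
have c0 : 0 < c by rewrite lt_min c10 divr_gt0.
exists c => // H G tH mG; have [_ wH w1 sep0] := tH.
have k0 : (0 < k)%N by exact: ltnW.
have mw0 := min_weight_gt0 k0 wH.
have mw1 : min_weight H <= 1.
  apply: (le_trans (min_weight_le (Ordinal k0) wH)); apply: weights_le1 => // i.
  exact: ltW.
have W0 : (0 <= W1 G H)%E.
  apply: le_ereal_inf_tmp => _ [g _ <-]; apply: integral_ge0 => z _.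
  by rewrite lee_fin enorm_ge0.
have s0 : 0 <= sep H ^+ (4 * k - 3) by rewrite exprn_ge0// ltW.
have [cov|ncov] := pselect (covering H G).
  apply: le_trans (h1 H G tH mG cov); rewrite lee_wpmul2r// lee_fin ler_wpM2r//.
  by rewrite -[leRHS]mulr1 ler_pM ?(ltW c0) ?(ltW mw0)// ge_min lexx.
have := h2 H G tH mG ncov; rewrite -lee_fin; apply: le_trans.
apply: (@le_trans _ _ ((c * min_weight H * sep H ^+ (4 * k - 3))%:E * (6 * r)%:E)%E).
  by apply: lee_wpmul2l; [rewrite lee_fin !mulr_ge0// ltW | exact: W1_le_diam].
rewrite -EFinM lee_fin mulrAC ler_wpM2r// mulrAC ler_wpM2r ?(ltW mw0)//.
by rewrite -ler_pdivlMr// ge_min lexx orbT.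
Qed.

End hellinger_wasserstein.

(** * Expectations of products of independent variables *)

Section transfer.
Local Open Scope ereal_scope.
Context d1 d2 (T1 : measurableType d1) (T2 : measurableType d2) (R : realType).
Variables (mu : {measure set T1 -> \bar R}) (nu : {measure set T2 -> \bar R}).
Variables (X : T1 -> T2) (h : T1 -> R).
Hypothesis mX : measurable_fun setT X.
Hypothesis mh : measurable_fun setT h.
Hypothesis h0 : forall x, (0 <= h x)%R.
Hypothesis hX : forall A, measurable A -> \int[mu]_x (h x * \1_A (X x))%:E = nu A.

Import HBNNSimple.

Let transfer_nnsfun (s : {nnsfun T2 >-> R}) :
  \int[mu]_x (h x * s (X x))%:E = \int[nu]_y (s y)%:E.
Proof.
have ms (r : R) : measurable (s @^-1` [set r]) by [].
rewrite integralT_nnsfun sintegralE.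
transitivity (\int[mu]_x (\sum_(r \in range s) r%:E * (h x * \1_(s @^-1` [set r]) (X x))%:E)).
  apply: eq_integral => x _; rewrite fimfunE EFinM -fsumEFin//.
  rewrite ge0_mule_fsumr; last first.
    by move=> r; rewrite nnfun_muleindic_ge0.
  by apply: eq_fsbigr => r _; rewrite -!EFinM mulrCA.
have mhX A : measurable A -> measurable_fun setT (fun x => (h x * \1_A (X x))%:E).
  move=> mA; apply/measurable_EFinP; apply: measurable_funM => //.
  by apply: measurableT_comp => //; exact: measurable_indic.
rewrite ge0_integral_fsum//.
- apply: eq_fsbigr => r /set_mem[y _ <-].
  by rewrite ge0_integralZl ?hX ?lee_fin//; [exact: mhX|move=> x _; rewrite lee_fin mulr_ge0].
- by move=> r; apply: measurable_funeM; exact: mhX.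
- move=> r x _; rewrite -EFinM mulrCA EFinM mule_ge0 ?lee_fin//.
  by have := nnfun_muleindic_ge0 s r (X x); rewrite -EFinM lee_fin.
Qed.

(** A change of variables with a density h: from indicators to simple functions by
    linearity, and to nonnegative functions by monotone convergence. *)
Lemma integral_transfer (g : T2 -> R) : measurable_fun setT g ->
  (forall y, (0 <= g y)%R) ->
  \int[mu]_x (h x * g (X x))%:E = \int[nu]_y (g y)%:E.
Proof.
move=> mg g0.
have mg' : measurable_fun setT (EFin \o g) by exact/measurable_EFinP.
pose g_ := nnsfun_approx measurableT mg'.
have cg y : (g_ n y)%:E @[n --> \oo] --> (g y)%:E.
  by apply: (cvg_nnsfun_approx measurableT mg') => // z _; rewrite lee_fin.
have ndg y : {homo (fun n => g_ n y) : m n / (m <= n)%N >-> (m <= n)%R}.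
  by move=> m n mn; exact/lefP/(nd_nnsfun_approx measurableT mg').
transitivity (limn (fun n => \int[mu]_x (h x * g_ n (X x))%:E)).
  rewrite -monotone_convergence//.
  - apply: eq_integral => x _; apply/esym/cvg_lim => //.
    under eq_fun do rewrite EFinM.
    by rewrite EFinM; apply: cvgeZl.
  - move=> n; apply/measurable_EFinP; apply: measurable_funM => //.
    exact: measurableT_comp.
  - by move=> n x _; rewrite lee_fin mulr_ge0.
  - by move=> x _ m n mn; rewrite lee_fin ler_wpM2l// ndg.
under eq_fun do rewrite transfer_nnsfun.
rewrite -monotone_convergence//.
- by apply: eq_integral => y _; apply/cvg_lim.
- by move=> n; apply/measurable_EFinP.
- by move=> n y _; rewrite lee_fin.
- by move=> y _ m n mn; rewrite lee_fin ndg.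
Qed.

End transfer.

Section independent_products.
Context {R : realType} {d : nat} dO (O : measurableType dO) (P : probability O R).
Variables (n : nat) (X : 'I_n -> {RV P >-> 'rV[R]_d}).
Hypothesis indX : independent X.
Variables (g : 'rV[R]_d -> R) (e : R).
Hypothesis mg : measurable_fun setT g.
Hypothesis g0 : forall x, 0 <= g x.
Hypothesis Eg : forall i, (\int[P]_w (g (X i w))%:E = e%:E)%E.

Let mX i : measurable_fun setT (X i). Proof. exact: measurable_funPT. Qed.

Let e0 : 'I_n -> 0 <= e.
Proof. by move=> i; rewrite -lee_fin -(Eg i); apply: integral_ge0 => w _; rewrite lee_fin. Qed.

(* the first m factors are g (X i), the others indicators of events *)
Let F m (A : 'I_n -> set 'rV[R]_d) (i : 'I_n) w : R :=
  if (i < m)%N then g (X i w) else \1_(A i) (X i w).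

Let q m (A : 'I_n -> set 'rV[R]_d) (i : 'I_n) : R :=
  if (i < m)%N then e else fine (P (X i @^-1` A i)).

Let mF m A i : measurable (A i) -> measurable_fun setT (F m A i).
Proof.
move=> mA; rewrite /F; case: (i < m)%N; first exact: measurableT_comp.
by apply: measurableT_comp => //; exact: measurable_indic.
Qed.

Let F0 m A i w : 0 <= F m A i w.
Proof. by rewrite /F; case: ifP. Qed.

Let q0 m A i : 0 <= q m A i.
Proof. by rewrite /q; case: ifP => _; [exact: e0|exact: fine_ge0]. Qed.

Let mpre i (A : set 'rV[R]_d) : measurable A -> measurable (X i @^-1` A).
Proof. by move=> mA; rewrite -[X in measurable X]setTI; exact: mX. Qed.

(* Independence is the case m = 0.  The case m for every event of index m says that
   the product of the other factors, integrated over that event, is a multiple of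
   the law of the m-th variable; integrating g against this measure replaces the
   event by g. *)
Let mixed_product m A : (forall i, measurable (A i)) ->
  (\int[P]_w (\prod_i F m A i w)%:E = (\prod_i q m A i)%:E)%E.
Proof.
elim: m A => [|m IH] A mA.
  rewrite /q /=.
  transitivity (P (\bigcap_(i in [set` [set: 'I_n]%SET]) (X i @^-1` A i))).
    have mI : measurable (\bigcap_(i in [set` [set: 'I_n]%SET]) (X i @^-1` A i)).
      by apply: fin_bigcap_measurable => [|i _]; [exact: finite_finset|exact: mpre].
    rewrite -[X in P X]setIT -integral_indic//; apply: eq_integral => w _; congr EFin.
    rewrite indicE; have [win|wnin] := pselect (forall i, A i (X i w)).
      rewrite mem_set => [|i _]; last exact: win.
      by apply: big1 => i _; rewrite /F/= indicE mem_set.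
    rewrite memNset; last by move=> h; apply: wnin => i; apply: h; rewrite /= finset.in_setT.
    have /existsNP[i Ai] := wnin.
    by rewrite (bigD1 i)//= /F/= indicE memNset// mul0r.
  rewrite indX// -prodEFin; apply: eq_big => [i|i _]; first by rewrite finset.in_setT.
  by rewrite fineK// fin_num_measure//; exact: mpre.
have [nm|mn] := leqP n m.
  have eqF (i : 'I_n) : (i < m.+1)%N = (i < m)%N.
    by have im := leq_trans (ltn_ord i) nm; rewrite ltnS (ltnW im) im.
  rewrite /q; under eq_integral do under eq_bigr do rewrite /F eqF.
  by under [in RHS]eq_bigr do rewrite eqF; exact: IH.
pose i0 := Ordinal mn.
have F1 i w B : i != i0 -> F m.+1 A i w = F m (fun j => if j == i0 then B else A j) i w.
  move=> ii0; rewrite /F ltnS (negbTE ii0) leq_eqVlt.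
  by rewrite (_ : (_ == _ :> nat) = false)//; apply: contra_neqF ii0 => /eqP im; exact: val_inj.
have q1 i B : i != i0 -> q m.+1 A i = q m (fun j => if j == i0 then B else A j) i.
  move=> ii0; rewrite /q ltnS (negbTE ii0) leq_eqVlt.
  by rewrite (_ : (_ == _ :> nat) = false)//; apply: contra_neqF ii0 => /eqP im; exact: val_inj.
pose h w := \prod_(i | i != i0) F m.+1 A i w.
pose c := \prod_(i | i != i0) q m.+1 A i.
have c0 : 0 <= c by apply: prodr_ge0.
have h0 w : 0 <= h w by apply: prodr_ge0.
have mh : measurable_fun setT h.
  rewrite /h; under eq_fun do rewrite big_mkcond.
  by apply: measurable_prod => i _; case: (i != i0) => //; exact: mF.
have hX B : measurable B ->
    (\int[P]_w (h w * \1_B (X i0 w))%:E = mscale (NngNum c0) (distribution P (X i0)) B)%E.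
  move=> mB; pose AB j := if j == i0 then B else A j.
  have := IH AB; rewrite (bigD1 i0)//= => IHB.
  transitivity (\int[P]_w (\prod_i F m AB i w)%:E)%E.
    apply: eq_integral => w _; congr EFin; rewrite (bigD1 i0)//= mulrC; congr (_ * _).
      by rewrite /F ltnn /AB eqxx.
    by apply: eq_bigr => i ii0; exact: F1.
  rewrite IHB; last by move=> j; rewrite /AB; case: ifP.
  rewrite EFinM muleC; congr (_ * _)%E.
    by congr EFin; apply: eq_bigr => i ii0; rewrite -q1.
  by rewrite /q ltnn /AB eqxx fineK// fin_num_measure//; exact: mpre.
transitivity (\int[P]_w (h w * g (X i0 w))%:E)%E.
  apply: eq_integral => w _; congr EFin; rewrite (bigD1 i0)//= mulrC; congr (_ * _).
  by rewrite /F ltnSn.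
rewrite (integral_transfer (mX i0) mh h0 hX mg g0).
have mg' : measurable_fun setT (EFin \o g) by apply/measurable_EFinP.
transitivity (c%:E * \int[distribution P (X i0)]_y (g y)%:E)%E.
  apply: (@ge0_integral_mscale _ _ R (distribution P (X i0)) _ measurableT
    (NngNum c0) _ mg') => x _ /=.
  by rewrite lee_fin.
have -> : (\int[distribution P (X i0)]_y (g y)%:E = e%:E)%E.
  by rewrite -(Eg i0) -(ge0_integral_distribution (X i0) mg').
rewrite (bigD1 i0)//= mulrC EFinM; congr (_ * _)%E.
by rewrite /q ltnSn.
Qed.

Lemma integral_prod_independent :
  (\int[P]_w (\prod_i g (X i w))%:E = (e ^+ n)%:E)%E.
Proof.
have := @mixed_product n (fun=> setT) (fun=> measurableT).
rewrite (eq_bigr (fun=> e)) => [|i _]; last by rewrite /q ltn_ord.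
rewrite prodr_const card_ord => <-; apply: eq_integral => w _; congr EFin.
by apply: eq_bigr => i _; rewrite /F ltn_ord.
Qed.

End independent_products.

(** * Exponential bounds for samples *)

Lemma markov_superlevel dT (T : measurableType dT) (R : realType)
    (mu : {measure set T -> \bar R}) (f : T -> R) (e t : R) :
  measurable_fun setT f -> (forall w, 0 <= f w) ->
  (\int[mu]_w (f w)%:E <= e%:E)%E -> 0 < t ->
  measurable [set w | t <= f w] /\ (mu [set w | t <= f w]%R <= (e / t)%:E)%E.
Proof.
move=> mf f0 fe t0; set B := [set w | t <= f w].
have mB : measurable B.
  rewrite (_ : B = setT `&` f @^-1` `[t, +oo[%classic); first exact: mf.
  by apply/seteqP; split => w; rewrite /= in_itv/= andbT; [split|case].
split=> //; rewrite EFinM lee_pdivlMr// muleC; apply: le_trans fe.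
apply: (@le_trans _ _ (\int[mu]_w (t%:E * (\1_B w)%:E))%E).
  rewrite ge0_integralZl_EFin//; last 2 first.
  - by apply/measurable_EFinP; exact: measurable_indic.
  - exact: ltW.
  by rewrite integral_indic// setIT.
apply: ge0_le_integral => //.
- by move=> w _; rewrite -EFinM lee_fin mulr_ge0// ltW.
- apply: measurable_funeM; apply/measurable_EFinP; exact: measurable_indic.
- by apply/measurable_EFinP.
- move=> w _; rewrite -EFinM lee_fin indicE.
  have [wB|wB] := boolP (w \in B); first by rewrite mulr1; move: wB; rewrite inE.
  by rewrite mulr0.
Qed.

Section chernoff.
Context {R : realType} {d : nat}.
Variable S : 'M[R]_d.
Hypothesis symS : S^T = S.
Hypothesis posS : forall v : 'rV[R]_d, v != 0 -> 0 < qform S v.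
Variable k : nat.
Implicit Types G H : mixing R d k.
Local Notation lam := (@lebesgue_rV R d).

Section sample.
Context dO (O : measurableType dO) (P : probability O R).
Variables (n : nat) (X : 'I_n -> {RV P >-> 'rV[R]_d}) (H : mixing R d k).
Hypothesis iidX : iid_sample X (mix_density S H).
Hypothesis pH : prob_weights H.

Let mX i : measurable_fun setT (X i). Proof. exact: measurable_funPT. Qed.

Lemma expectation_sample i (g : 'rV[R]_d -> R) : measurable_fun setT g ->
  (forall x, 0 <= g x) ->
  (\int[P]_w (g (X i w))%:E = \int[lam]_x (mix_density S H x * g x)%:E)%E.
Proof.
move=> mg g0; have mg' : measurable_fun setT (EFin \o g) by apply/measurable_EFinP.
rewrite (@integral_transfer _ _ _ _ R lam (distribution P (X i)) id)//.
- exact/esym/(ge0_integral_distribution (X i) mg').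
- exact: measurable_mix_density.
- by move=> x; apply: mix_density_ge0 => //; exact: pH.1.
- move=> A mA; transitivity (\int[lam]_(x in A) (mix_density S H x)%:E)%E.
    rewrite [RHS]integral_mkcond; apply: eq_integral => x _.
    by rewrite patchE indicE; case: (x \in A); rewrite ?mulr1 ?mulr0.
  exact/esym/iidX.2.
Qed.

(** The density of an observation has mass 1. *)
Lemma gauss_mass_sample : 'I_n -> gauss_mass S = 1.
Proof.
move=> i; have := expectation_sample i (measurable_cst (1 : R)) (fun=> ler01).
under [in X in _ = X -> _]eq_integral do rewrite mulr1.
rewrite mix_mass//; [|exact: pH.1|exact: pH.2].
have E1 : (\int[P]_w (cst 1%:E w) = 1%:E)%E.
  by rewrite (integral_cst P measurableT) mul1e; exact: probability_setT.
by rewrite -[X in X = _ -> _]/(\int[P]_w (cst 1%:E w))%E E1 => -[].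
Qed.

(** Chernoff's bound at exponent 1/2: the expectation of the square root of the
    likelihood ratio of one observation is the affinity of u and the true
    density. *)
Lemma likelihood_ratio_tail (u : 'rV[R]_d -> R) (e t : R) :
  measurable_fun setT u -> (forall x, 0 <= u x) ->
  (\int[lam]_x (Num.sqrt (u x) * Num.sqrt (mix_density S H x))%:E = e%:E)%E ->
  0 < t ->
  let B := [set w | t <= \prod_i Num.sqrt (u (X i w) / mix_density S H (X i w))] in
  measurable B /\ (P B <= (e ^+ n / t)%:E)%E.
Proof.
move=> mu u0 ue t0; pose g x := Num.sqrt (u x / mix_density S H x).
have H0 x : 0 < mix_density S H x by apply: mix_density_gt0 => //; [exact: pH.1|exact: pH.2].
have mg : measurable_fun setT g.
  rewrite (_ : g = fun x => Num.sqrt (u x * expR (- ln (mix_density S H x)))); last first.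
    by apply/funext => x; rewrite expRN lnK// posrE.
  apply: (measurableT_comp (@measurable_sqrt R)); apply: measurable_funM => //.
  apply: measurableT_comp => //; apply: measurableT_comp => //.
  apply: (measurableT_comp (@measurable_ln R)); exact: measurable_mix_density.
have g0 x : 0 <= g x by exact: sqrtr_ge0.
have Eg i : (\int[P]_w (g (X i w))%:E = e%:E)%E.
  rewrite expectation_sample// -ue; apply: eq_integral => x _; congr EFin.
  rewrite /g sqrtrM// sqrtrV ?(ltW (H0 x))// mulrCA; congr (_ * _).
  by rewrite -{1}[mix_density S H x]sqr_sqrtr ?(ltW (H0 x))// expr2 mulfK// gt_eqF// sqrtr_gt0.
have prodE := integral_prod_independent iidX.1 mg g0 Eg.
have mprod : measurable_fun setT (fun w => \prod_i g (X i w)).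
  by apply: measurable_prod => i _; exact: measurableT_comp.
apply: markov_superlevel => //; first by move=> w; apply: prodr_ge0.
by rewrite prodE.
Qed.

End sample.

(** A vector outside the cube has a coordinate a with exp (x_a) or exp (- x_a) at
    least exp m, and the expectation of these 2 d exponentials is a Laplace
    transform; then Markov's inequality applies. *)
Lemma cube_tail (r : R) : exists2 K, 0 <= K &
  forall (H : mixing R d k), prob_weights H -> (forall j, enorm (atom H j) <= r) ->
  forall dO (O : measurableType dO) (P : probability O R) n
    (X : 'I_n -> {RV P >-> 'rV[R]_d}), iid_sample X (mix_density S H) ->
  forall i (m : R), exists2 B, measurable B &
    [set w | exists a, m < `|X i w ord0 a|] `<=` B /\ (P B <= (K * expR (- m))%:E)%E.
Proof.
pose freq (j : 'I_d * bool) : 'rV[R]_d := (-1) ^+ j.2 *: delta_mx 0 j.1.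
pose phi (x : 'rV[R]_d) := \sum_j expR (dotrv (freq j) x).
have freq1 j a : `|freq j ord0 a| <= 1.
  rewrite !mxE normrM normrX normrN normr1 expr1n mul1r.
  by case: (_ && _); rewrite ?normr1 ?normr0.
have dot_freq j x : dotrv (freq j) x = (-1) ^+ j.2 * x ord0 j.1.
  rewrite /dotrv (bigD1 j.1)//= !mxE !eqxx mulr1 big1 ?addr0// => a /negbTE aj.
  by rewrite !mxE aj andbF mulr0 mul0r.
have [b b0 hb] := qform_le S.
pose K := (expR (2^-1 * (b * (d%:R * 1 ^+ 2))) * gauss_mass S * expR (d%:R * (1 * r)))
  *+ #|{: 'I_d * bool}|.
have K0 : 0 <= K.
  by rewrite mulrn_wge0// !mulr_ge0 ?expR_ge0// ltW// gauss_mass_gt0.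
exists K => // H pH bH dO O P n X iidX i m.
have mphi : measurable_fun setT phi.
  by apply: measurable_sum => j; apply: measurableT_comp => //; exact: measurable_dotrv.
have phi0 x : 0 <= phi x by apply: sumr_ge0 => j _; exact: expR_ge0.
have Ephi : (\int[P]_w (phi (X i w))%:E <= K%:E)%E.
  rewrite (expectation_sample iidX pH)//.
  under eq_integral do rewrite mulr_sumr -sumEFin.
  rewrite ge0_integral_sum//; last 2 first.
  - move=> j; apply/measurable_EFinP; apply: measurable_funM; first exact: measurable_mix_density.
    by apply: measurableT_comp => //; exact: measurable_dotrv.
  - by move=> j x _; rewrite lee_fin mulr_ge0 ?expR_ge0// mix_density_ge0//; exact: pH.1.
  rewrite /K -sumr_const -sumEFin; apply: lee_sum => j _.
  under eq_integral do rewrite mulrC.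
  rewrite mix_laplace//; last exact: pH.1.
  rewrite lee_fin ler_pM//.
  - by rewrite mulr_ge0 ?expR_ge0// ltW// gauss_mass_gt0.
  - by apply: sumr_ge0 => l _; rewrite mulr_ge0 ?expR_ge0// pH.1.
  - rewrite ler_wpM2r ?(ltW (gauss_mass_gt0 symS posS))// ler_expR ler_wpM2l ?invr_ge0//.
    by rewrite (le_trans (hb _))// ler_wpM2l ?(ltW b0)// sqnorm_bound.
  - rewrite -[leRHS]mul1r -[X in _ <= X * _]pH.2 mulr_suml; apply: ler_sum => l _.
    by rewrite ler_wpM2l ?pH.1// ler_expR dotrv_bound.
have mX : measurable_fun setT (X i) by exact: measurable_funPT.
have [mB PB] := markov_superlevel (measurableT_comp mphi mX) (fun w => phi0 (X i w)) Ephi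
  (expR_gt0 m).
exists [set w | expR m <= phi (X i w)]; first exact: mB.
split=> [w [a am]/=|]; last by rewrite expRN.
pose j := (a, X i w ord0 a < 0).
rewrite /phi (bigD1 j)//= ler_wpDr//; first by apply: sumr_ge0 => l _; exact: expR_ge0.
rewrite ler_expR dot_freq /j/=; case: ltrP => h; last first.
  by move: am; rewrite expr0 mul1r ger0_norm// => /ltW.
by move: am; rewrite expr1 mulN1r ltr0_norm// => /ltW.
Qed.

End chernoff.

(** * Envelopes of neighbouring mixtures *)

Section envelope.
Context {R : realType} {d : nat}.
Variable S : 'M[R]_d.
Hypothesis symS : S^T = S.
Hypothesis posS : forall v : 'rV[R]_d, v != 0 -> 0 < qform S v.
Variable r : R.
Hypothesis r0 : 0 < r.
Local Notation lam := (@lebesgue_rV R d).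
Local Notation M := (gauss_mass S).

(** The exponents differ by the inverse form between x - theta, of size n, and
    theta - theta', of size n^-2, hence by O(1 / n).  The product of n such ratios
    is therefore bounded. *)
Lemma gauss_ratio : exists2 A, 0 <= A & forall (n : R) (theta theta' x : 'rV[R]_d),
  1 <= n -> enorm theta <= r ->
  (forall a, `|theta ord0 a - theta' ord0 a| <= n^-1 ^+ 2) ->
  (forall a, `|x ord0 a| <= n) ->
  gauss_density S theta x <= expR (A / n) * gauss_density S theta' x.
Proof.
pose s1 := \sum_a \sum_b `|invmx S a b|.
have s10 : 0 <= s1 by do 2 (apply: sumr_ge0 => ? _).
exists (2^-1 * (s1 * (3 + 2 * r))).
  by rewrite !mulr_ge0 ?invr_ge0// addr_ge0// mulr_ge0// ltW.
move=> n theta theta' x n1 tr tt xn.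
have n0 : 0 < n by exact: lt_le_trans n1.
set t := n^-1 in tt *; have t0 : 0 < t by rewrite invr_gt0.
have t1 : t <= 1 by rewrite invf_le1.
have nt : n * t = 1 by rewrite mulfV// gt_eqF.
pose v := x - theta; pose eta := theta - theta'.
have eE : x - theta' = v + eta by rewrite /v /eta addrA subrK.
have vn a : `|v ord0 a| <= n + r.
  rewrite /v !mxE (le_trans (ler_normB _ _))// lerD//.
  exact: le_trans (enorm_entry _ _) tr.
have et a : `|eta ord0 a| <= t ^+ 2 by rewrite /eta !mxE.
have key : qform (invmx S) (v + eta) - qform (invmx S) v <= s1 * (3 + 2 * r) * t.
  rewrite !qformE -sumrB /s1 !mulr_suml; apply: ler_sum => a _.
  rewrite -sumrB !mulr_suml; apply: ler_sum => b _.
  rewrite [(v + eta) ord0 a]mxE [(v + eta) ord0 b]mxE.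
  have hva := vn a; have hvb := vn b; have hea := et a; have heb := et b.
  rewrite (_ : _ - _ = invmx S a b * (v ord0 a * eta ord0 b + eta ord0 a * v ord0 b
    + eta ord0 a * eta ord0 b)); last by ring.
  rewrite (le_trans (ler_norm _))// normrM -mulrA ler_wpM2l//.
  apply: (@le_trans _ _ ((n + r) * t ^+ 2 + t ^+ 2 * (n + r) + t ^+ 2 * t ^+ 2)).
    apply: (le_trans (ler_normD _ _)); apply: lerD; last first.
      by rewrite normrM ler_pM.
    by apply: (le_trans (ler_normD _ _)); rewrite !normrM lerD// ler_pM.
  rewrite (_ : _ + _ = (n * t) * t + (n * t) * t + 2 * r * t * t + t * t * t * t); last by ring.
  rewrite nt !mul1r.
  have tt1 : t * t <= t by rewrite ler_piMr// ltW.
  have tt2 : t * t * t * t <= t.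
    rewrite -mulrA (le_trans _ tt1)// -[leRHS]mulr1 ler_wpM2l ?mulr_ge0 ?(ltW t0)//.
    exact: le_trans tt1 t1.
  have tt3 : 2 * r * t * t <= 2 * r * t by rewrite -mulrA ler_wpM2l// mulr_ge0// ltW.
  by lra.
rewrite !gaussE mulrCA ler_wpM2l ?invr_ge0 ?sqrtr_ge0// -expRD ler_expR.
by move: key; rewrite -eE; lra.
Qed.

Variable k : nat.
Implicit Types G H : mixing R d k.

Definition components G : mixing R d k := Mixing (fun=> 1) (atom G).

(** With t = 1 / n the second term absorbs perturbations of the weights by n^-2, and
    it adds only O(1 / n) to the affinity, in spite of the square root. *)
Definition envelope (t : R) G x : R :=
  mix_density S G x + t ^+ 2 * mix_density S (components G) x.

Lemma integrable_components G :
  lam.-integrable setT (EFin \o mix_density S (components G)).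
Proof.
apply: ge0_integrable_lty.
- exact: measurable_mix_density.
- by move=> x; apply: mix_density_ge0.
- by rewrite mix_mass_weights// ltry.
Qed.

Lemma envelope_ge0 t G x : prob_weights G -> 0 <= envelope t G x.
Proof.
move=> [w0 _]; apply: addr_ge0; first exact: mix_density_ge0.
by apply: mulr_ge0; [exact: sqr_ge0 | exact: mix_density_ge0].
Qed.

Lemma measurable_envelope t G : measurable_fun setT (envelope t G).
Proof.
apply: measurable_funD; first exact: measurable_mix_density.
by apply: measurable_funM => //; exact: measurable_mix_density.
Qed.

Lemma sqrtrD_le (a b : R) : 0 <= a -> 0 <= b ->
  Num.sqrt (a + b) <= Num.sqrt a + Num.sqrt b.
Proof.
move=> a0 b0; rewrite -(ler_pXn2r (n := 2))// ?nnegrE ?addr_ge0 ?sqrtr_ge0//.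
by rewrite sqrrD !sqr_sqrtr ?addr_ge0// addrAC lerDl mulrn_wge0// mulr_ge0 ?sqrtr_ge0.
Qed.

Lemma envelope_affinity t G H : 0 <= t -> prob_weights G -> prob_weights H ->
  exists2 e, 0 <= e <= M - dH S G H ^+ 2 + t * (M * (k%:R + 1)) &
  (\int[lam]_x (Num.sqrt (envelope t G x) * Num.sqrt (mix_density S H x))%:E = e%:E)%E.
Proof.
move=> t0 pG pH.
pose f x := Num.sqrt (envelope t G x) * Num.sqrt (mix_density S H x).
pose a x := Num.sqrt (mix_density S G x) * Num.sqrt (mix_density S H x).
pose b x := mix_density S (components G) x + mix_density S H x.
have H0 x : 0 <= mix_density S H x by apply: mix_density_ge0 => //; exact: pH.1.
have G0 x : 0 <= mix_density S G x by apply: mix_density_ge0 => //; exact: pG.1.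
have W0 x : 0 <= mix_density S (components G) x by apply: mix_density_ge0.
have iA : lam.-integrable setT (EFin \o a) by exact: integrable_sqrt_mixM.
have iB : lam.-integrable setT (EFin \o b).
  exact: (integrableD measurableT (integrable_components G) (integrable_mix symS posS pH)).
have iTB : lam.-integrable setT (EFin \o (fun x => t * b x)).
  exact: (integrableZl measurableT t iB).
have iAB : lam.-integrable setT (EFin \o (fun x => a x + t * b x)).
  exact: (integrableD measurableT iA iTB).
have f0 x : 0 <= f x by rewrite mulr_ge0 ?sqrtr_ge0.
have mf : measurable_fun setT f.
  apply: measurable_funM; last exact: measurable_sqrt_mix.
  by apply: (measurableT_comp (@measurable_sqrt R)); exact: measurable_envelope.
have fab x : f x <= a x + t * b x.
  rewrite /f /a; apply: (@le_trans _ _ ((Num.sqrt (mix_density S G x) +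
      t * Num.sqrt (mix_density S (components G) x)) * Num.sqrt (mix_density S H x))).
    rewrite ler_wpM2r ?sqrtr_ge0// (le_trans (sqrtrD_le _ _)) ?mulr_ge0 ?sqr_ge0//.
    by rewrite lerD2l sqrtrM ?sqr_ge0// sqrtr_sqr ger0_norm.
  by rewrite mulrDl lerD2l -mulrA ler_wpM2l// sqrt_mul_le.
have iF : lam.-integrable setT (EFin \o f).
  apply: (le_integrable measurableT _ _ iAB); first exact/measurable_EFinP.
  move=> x _ /=; rewrite lee_fin !ger0_norm//.
  exact: le_trans (f0 x) (fab x).
exists (\int[lam]_x f x); last by rewrite /Rintegral fineK//; exact: integrable_fin_num.
apply/andP; split; first by apply: Rintegral_ge0.
have -> : M - dH S G H ^+ 2 + t * (M * (k%:R + 1)) = \int[lam]_x (a x + t * b x).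
  rewrite (RintegralD measurableT iA iTB) (RintegralZl _ measurableT iB).
  rewrite (affinity_dH symS posS pG pH); congr (_ + t * _).
  rewrite (RintegralD measurableT (integrable_components G) (integrable_mix symS posS pH)).
  rewrite (Rintegral_mix symS posS pH) /Rintegral mix_mass_weights//=.
  by rewrite sumr_const card_ord; ring.
exact: le_Rintegral.
Qed.

Lemma mix_le_envelope (A n : R) G G' x : 0 <= n ->
  prob_weights G -> prob_weights G' ->
  (forall i, gauss_density S (atom G i) x <= expR (A / n) * gauss_density S (atom G' i) x) ->
  (forall i, `|weight G i - weight G' i| <= n^-1 ^+ 2) ->
  mix_density S G x <= expR (A / n) * envelope n^-1 G' x.
Proof.
move=> n0 [w0 _] [w0' _] hg hw.
rewrite /envelope /mix_density mulr_sumr -big_split/= mulr_sumr; apply: ler_sum => i _.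
rewrite mul1r -mulrDl (mulrCA (expR (A / n))); apply: ler_pM => //.
  by rewrite ltW// gauss_gt0.
by have := le_trans (ler_norm _) (hw i); lra.
Qed.

End envelope.

(** * The maximum likelihood estimator *)

Section cells.
Context {R : realType} {d k : nat}.
Variable r : R.
Implicit Types G : mixing R d k.

(** Adding r makes the coordinates of atoms in the ball nonnegative, so that one
    rounding serves for weights and coordinates. *)
Definition parameter G (t : 'I_k * option 'I_d) : R :=
  if t.2 is Some a then atom G t.1 ord0 a + r else weight G t.1.

(** Cells of mesh n^-2.  [same_cell] takes N large enough for all rounded
    parameters to be at most N, where [inord] is injective. *)
Definition cell (N n : nat) G : {ffun 'I_k * option 'I_d -> 'I_N.+1} :=
  [ffun t => inord (Num.truncn (parameter G t * n%:R ^+ 2))].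

Lemma same_cell (m n : nat) G G' t : (0 < n)%N ->
  0 <= parameter G t <= m%:R -> 0 <= parameter G' t <= m%:R ->
  cell (m * n ^ 2) n G = cell (m * n ^ 2) n G' ->
  `|parameter G t - parameter G' t| <= n%:R^-1 ^+ 2.
Proof.
move=> n0 /andP[a0 am] /andP[b0 bm] /ffunP/(_ t); rewrite !ffunE => /(congr1 val) /=.
have n2 : 0 < n%:R ^+ 2 :> R by rewrite exprn_gt0// ltr0n.
have bound (x : R) : 0 <= x -> x <= m%:R ->
    (Num.truncn (x * n%:R ^+ 2) < (m * n ^ 2).+1)%N.
  move=> x0 xm; rewrite ltnS -(ler_nat R) natrM natrX.
  have xn0 : 0 <= x * n%:R ^+ 2 by rewrite mulr_ge0// ltW.
  have /andP[h _] := truncn_itv xn0; apply: (le_trans h).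
  by rewrite ler_wpM2r// ltW.
rewrite !inordK ?bound// => e.
have an : 0 <= parameter G t * n%:R ^+ 2 by rewrite mulr_ge0// ltW.
have bn : 0 <= parameter G' t * n%:R ^+ 2 by rewrite mulr_ge0// ltW.
have /andP[a1 a2] := truncn_itv an; have /andP[b1 b2] := truncn_itv bn.
move: a1 a2 b1 b2; rewrite e -(natr1 (Num.truncn _)).
move: (Num.truncn _)%:R => u a1 a2 b1 b2.
rewrite exprVn -[leRHS]mul1r ler_pdivlMr// -[n%:R ^+ 2]ger0_norm ?(ltW n2)//.
by rewrite -normrM mulrBl ler_norml; apply/andP; split; lra.
Qed.

End cells.

Section union_bound.
Context {R : realType} dO (O : measurableType dO) (P : probability O R).

Lemma union_bound (I : finType) (E : I -> set O) (b : R) :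
  (forall i, exists2 B, measurable B & E i `<=` B /\ (P B <= b%:E)%E) ->
  exists2 B, measurable B & (forall i, E i `<=` B) /\ (P B <= (#|I|%:R * b)%:E)%E.
Proof.
move=> /(_ _)/cid2-/all_sig2[B mB hB].
have key (s : seq I) : measurable (\big[setU/set0]_(i <- s) B i) /\
    (P (\big[setU/set0]_(i <- s) B i) <= ((size s)%:R * b)%:E)%E.
  elim: s => [|i s [mU PU]]; first by rewrite big_nil measure0 mul0r.
  rewrite big_cons; split; first exact: measurableU.
  apply: (le_trans (measureU2 P (mB i) mU)).
  by rewrite -natr1 addrC mulrDl mul1r EFinD; apply: leeD => //; have [] := hB i.
exists (\big[setU/set0]_(i <- enum I) B i); first by have [] := key (enum I).
split; last by rewrite cardE; have [] := key (enum I).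
move=> i w Ew; rewrite -bigcup_seq; exists i; first by rewrite /= mem_enum.
by have [+ _] := hB i; apply.
Qed.

End union_bound.

Section mle_rate.
Context {R : realType} {d : nat}.
Variables (S : 'M[R]_d) (r : R) (k : nat) (Theta : set 'rV[R]_d) (m : nat).
Hypothesis symS : S^T = S.
Hypothesis posS : forall v : 'rV[R]_d, v != 0 -> 0 < qform S v.
Hypothesis r0 : 0 < r.
Hypothesis d0 : (0 < d)%N.
Hypothesis Theta_ball : Theta `<=` [set x | enorm x <= r].
Hypothesis m1 : (1 <= m)%N.
Hypothesis rm : r + r <= m%:R.
Implicit Types G H : mixing R d k.

Definition nparam : nat := (k * d.+1)%N.
(** There are of order n^(2 nparam) cells; one more power of n is left over as the
    probability. *)
Definition mle_exponent : nat := (2 * nparam).+1.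
Definition mle_constant : R := Num.sqrt (mle_exponent%:R / d%:R).

Lemma parameter_bounds G t : mix_class Theta G -> 0 <= parameter r G t <= m%:R.
Proof.
move=> [bG wG _]; rewrite /parameter; case: t => i [a|] /=; last first.
  by have /andP[-> h] := wG i; rewrite (le_trans h)// ler1n.
have := le_trans (enorm_entry (atom G i) a) (Theta_ball (bG i)).
rewrite ler_norml => /andP[h1 h2]; apply/andP; split; first by lra.
by apply: le_trans rm; lra.
Qed.

(** This identity determines [mle_constant]: exp (- n h^2) at the threshold h is
    n to the power - [mle_exponent]. *)
Lemma rate_sqr (n : nat) : (1 <= n)%N ->
  n%:R * (mle_constant * rate R d n) ^+ 2 = mle_exponent%:R * ln n%:R.
Proof.
move=> n1; have dN : d%:R != 0 :> R by rewrite pnatr_eq0 -lt0n.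
have nN : n%:R != 0 :> R by rewrite pnatr_eq0 -lt0n.
have ln0 : 0 <= ln n%:R :> R by apply: ln_ge0; rewrite ler1n.
rewrite exprMn sqr_sqrtr ?divr_ge0// sqr_sqrtr ?divr_ge0 ?mulr_ge0//.
by field; rewrite dN nN.
Qed.

Section one_sample.
Context dO (O : measurableType dO) (P : probability O R).
Variables (n : nat) (X : 'I_n -> {RV P >-> 'rV[R]_d}) (H : mixing R d k).
Hypothesis n1 : (1 <= n)%N.
Hypothesis iidX : iid_sample X (mix_density S H).
Hypothesis pH : prob_weights H.
Variable A : R.
Hypothesis ratioA : forall (l : R) (theta theta' x : 'rV[R]_d),
  1 <= l -> enorm theta <= r ->
  (forall a, `|theta ord0 a - theta' ord0 a| <= l^-1 ^+ 2) ->
  (forall a, `|x ord0 a| <= l) ->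
  gauss_density S theta x <= expR (A / l) * gauss_density S theta' x.

Let bad G := mix_class Theta G /\ mle_constant * rate R d n < dH S G H.

Let likely (w : O) G :=
  (forall i a, `|X i w ord0 a| <= n%:R) /\
  log_lik S (fun i => X i w) H <= log_lik S (fun i => X i w) G.

Let b : R := expR (k%:R + 1) * expR (A / 2) * (n%:R ^+ mle_exponent)^-1.

Let nR0 : 0 < n%:R :> R. Proof. by rewrite ltr0n. Qed.

Let sqrt_ln (y : R) : 0 < y -> Num.sqrt y = expR (ln y / 2).
Proof.
move=> y0; rewrite -[in LHS](lnK y0) -[ln y in LHS](divfK (_ : 2 != 0))//.
by rewrite mulr_natr mulr2n expRD -expr2 sqrtr_sqr ger0_norm ?expR_ge0.
Qed.

(** If G is at least as likely as H, the likelihood ratio of the envelope of a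
    neighbour G' of G is at least exp (- A), since the envelope loses a factor
    exp (A / n) at each of the n observations. *)
Lemma likely_envelope w G G' : prob_weights G -> prob_weights G' -> likely w G ->
  (forall i, enorm (atom G i) <= r) ->
  (forall i, `|weight G i - weight G' i| <= n%:R^-1 ^+ 2) ->
  (forall i a, `|atom G i ord0 a - atom G' i ord0 a| <= n%:R^-1 ^+ 2) ->
  expR (- (A / 2)) <= \prod_i Num.sqrt (envelope S n%:R^-1 G' (X i w) / mix_density S H (X i w)).
Proof.
move=> pG pG' [cube lik] bG hw ha.
have G0 x : 0 < mix_density S G x by apply: mix_density_gt0 => //; [exact: pG.1|exact: pG.2].
have H0 x : 0 < mix_density S H x by apply: mix_density_gt0 => //; [exact: pH.1|exact: pH.2].
have le_env i : mix_density S G (X i w) <= expR (A / n%:R) * envelope S n%:R^-1 G' (X i w).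
  apply: mix_le_envelope => // j; apply: ratioA => //; first by rewrite ler1n.
have env0 i : 0 < envelope S n%:R^-1 G' (X i w).
  have := lt_le_trans (G0 _) (le_env i).
  by rewrite pmulr_rgt0// expR_gt0.
have ln_le i : ln (mix_density S G (X i w)) <= A / n%:R + ln (envelope S n%:R^-1 G' (X i w)).
  rewrite -[A / _]expRK -lnM ?posrE ?expR_gt0//.
  by rewrite ler_ln ?posrE ?mulr_gt0 ?expR_gt0.
rewrite (eq_bigr (fun i => expR ((ln (envelope S n%:R^-1 G' (X i w))
    - ln (mix_density S H (X i w))) / 2))); last first.
  by move=> i _; rewrite sqrt_ln ?divr_gt0// ln_div ?posrE.
rewrite -expR_sum ler_expR -mulr_suml -mulNr ler_wpM2r ?invr_ge0// sumrB.
move: lik; rewrite /log_lik ler_pM2l ?invr_gt0// => lik.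
have : \sum_i ln (mix_density S G (X i w)) <=
    A + \sum_i ln (envelope S n%:R^-1 G' (X i w)).
  rewrite (_ : A = \sum_(i < n) A / n%:R); last first.
    by rewrite sumr_const card_ord -[RHS]mulr_natr divfK// gt_eqF.
  by rewrite -big_split/=; apply: ler_sum => i _.
by move=> /(le_trans lik) h; rewrite lerBrDr [leLHS]addrC lerBlDl.
Qed.

(** Since e <= 1 - h^2 + O(1 / n), the power e^n is at most a constant times
    exp (- n h^2). *)
Lemma bad_affinity G' e : bad G' ->
  0 <= e <= gauss_mass S - dH S G' H ^+ 2 + n%:R^-1 * (gauss_mass S * (k%:R + 1)) ->
  e ^+ n / expR (- (A / 2)) <= b.
Proof.
move=> [mG' hG'] /andP[e0 he].
rewrite (gauss_mass_sample symS posS iidX pH (Ordinal n1)) in he.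
rewrite /b expRN invrK mulrAC ler_wpM2r ?expR_ge0//.
apply: (@le_trans _ _ (expR (e - 1) ^+ n)).
  by rewrite lerXn2r ?nnegrE ?expR_ge0//; have := expR_ge1Dx (e - 1); lra.
have -> : (n%:R ^+ mle_exponent)^-1 = expR (- (mle_exponent%:R * ln n%:R)) :> R.
  by rewrite expRN expRM_natl lnK// posrE.
rewrite -expRM_natl -expRD ler_expR.
have rate0 : 0 <= mle_constant * rate R d n by rewrite mulr_ge0 ?sqrtr_ge0.
have : n%:R * (mle_constant * rate R d n) ^+ 2 <= n%:R * dH S G' H ^+ 2.
  rewrite ler_wpM2l ?(ltW nR0)//; apply: lerXn2r; rewrite ?nnegrE ?sqrtr_ge0//.
  exact: ltW.
rewrite rate_sqr// => hr.
have : n%:R * (e - 1) <= n%:R * (- dH S G' H ^+ 2 + n%:R^-1 * (k%:R + 1)).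
  by rewrite ler_wpM2l ?(ltW nR0)//; lra.
rewrite [in X in _ <= X -> _]mulrDr mulVKf ?gt_eqF// mulrN.
by move: hr; move: (_ * ln _) (_ * _ ^+ 2) => u v; lra.
Qed.

(** The representative G' of the cell is itself chosen among the measures far from
    H, so that its own affinity with H is small. *)
Lemma cell_bound t : exists2 B, measurable B &
  [set w | exists G, [/\ bad G, likely w G & cell r (m * n ^ 2) n G = t]] `<=` B /\
  (P B <= b%:E)%E.
Proof.
have b0 : 0 <= b by rewrite !mulr_ge0 ?expR_ge0// invr_ge0 exprn_ge0.
have [[G' [bG' cG']]|nobad] := pselect (exists G', bad G' /\ cell r (m * n ^ 2) n G' = t); last first.
  exists set0 => //; split; last by rewrite measure0 lee_fin.
  by move=> w [G [bG _ cG]]; apply: nobad; exists G.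
have mG' := bG'.1; have pG' := mix_class_prob mG'.
have t0 : 0 <= n%:R^-1 :> R by rewrite invr_ge0.
have [e he eE] := envelope_affinity symS posS t0 pG' pH.
have [mB PB] := likelihood_ratio_tail posS iidX pH (measurable_envelope S _ G')
  (fun x => envelope_ge0 posS _ x pG') eE (expR_gt0 (- (A / 2))).
eexists; first exact: mB.
split; last by apply: (le_trans PB); rewrite lee_fin; exact: bad_affinity he.
move=> w [G [[mG _] lG cG]] /=.
have same t' := same_cell n1 (parameter_bounds t' mG) (parameter_bounds t' mG')
  (etrans cG (esym cG')).
have [bG _ _] := mG.
apply: likely_envelope lG _ _ _ => //.
- exact: mix_class_prob mG.
- by move=> i; exact: Theta_ball.
- by move=> i; exact: (same (i, None)).
- move=> i a; have := same (i, Some a); rewrite /parameter/=.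
  by rewrite opprD addrACA subrr addr0.
Qed.

End one_sample.

(** If the estimator is far from H, then either an observation leaves the cube of
    size n, or the estimator, which is at least as likely as H, makes its cell
    exceptional.  The first event has probability at most K1 n exp (- n), and the
    second is a union over the cells. *)
Lemma mle_dH_rate : exists2 K : R, 0 < K &
  forall H, true_mixing Theta H -> forall n, (1 <= n)%N ->
  mle_prob_le S Theta H n [set G | mle_constant * rate R d n < dH S G H]
    (K * n%:R^-1).
Proof.
have [A A0 ratioA] := gauss_ratio S r0.
have [K1 K10 tail] := cube_tail symS posS k r.
pose K2 := m.+1%:R ^+ nparam * (expR (k%:R + 1) * expR (A / 2)) : R.
have K20 : 0 < K2 by rewrite !mulr_gt0 ?expR_gt0// exprn_gt0.
exists (4 * K1 + K2); first by rewrite ltr_pwDr// mulr_ge0.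
move=> H tH n n1 dO O P X Gh iidX mle.
have pH := true_mixing_prob tH.
have bH j : enorm (atom H j) <= r by have [bH _ _ _] := tH; exact: Theta_ball.
have cH : mix_class Theta H.
  have [hb hw h1 _] := tH; split => // i; rewrite ltW//=.
  by apply: weights_le1 => // j; rewrite ltW.
have nR0 : 0 < n%:R :> R by rewrite ltr0n.
have [B1 mB1 [sB1 PB1]] := union_bound (fun i => tail H pH bH dO O P n X iidX i n%:R).
have [B2 mB2 [sB2 PB2]] := union_bound (cell_bound n1 iidX pH ratioA).
apply: (@le_trans _ _ ((P^*)%mu (B1 `|` B2))).
  apply: le_mu_ext => w /= bad.
  have [lGh opt] := mle w.
  have [cube|] := pselect (forall i a, `|X i w ord0 a| <= n%:R).
    right; apply: (sB2 (cell r (m * n ^ 2) n (Gh w))).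
    exists (Gh w); split; [exact: conj lGh bad | | exact: erefl].
    exact: conj cube (opt H cH).
  move=> /existsNP[i /existsNP[a /negP]]; rewrite -ltNge => big.
  by left; apply: (sB1 i); exists a.
rewrite measurable_mu_extE; last exact: measurableU.
apply: (le_trans (measureU2 P mB1 mB2)).
apply: (le_trans (leeD PB1 PB2)); rewrite -EFinD lee_fin mulrDl.
apply: lerD.
  rewrite card_ord mulrCA -[4 * K1]mulrC -mulrA ler_wpM2l//.
  rewrite ler_pdivlMr// expRN mulrAC ler_pdivrMr ?expR_gt0//.
  (* n^2 exp (- n) <= 4, from x <= exp x at x = n / 2 *)
  have h : 1 + n%:R / 2 <= expR (n%:R / 2) :> R by exact: expR_ge1Dx.
  have -> : expR n%:R = expR (n%:R / 2) ^+ 2 :> R.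
    by rewrite expr2 -expRD -splitr.
  have h2 : (n%:R / 2) ^+ 2 <= expR (n%:R / 2) ^+ 2 :> R.
    apply: lerXn2r; rewrite ?nnegrE ?expR_ge0 ?divr_ge0//; lra.
  by move: h2; rewrite exprMn exprVn; lra.
rewrite card_ffun card_ord card_prod card_ord card_option card_ord -/nparam natrX.
have n2p : 0 < n%:R ^+ (2 * nparam) :> R by rewrite exprn_gt0.
apply: (@le_trans _ _ ((m.+1%:R * n%:R ^+ 2) ^+ nparam *
    (expR (k%:R + 1) * expR (A / 2) / n%:R ^+ mle_exponent))).
  rewrite ler_wpM2r ?mulr_ge0 ?expR_ge0 ?invr_ge0 ?exprn_ge0 ?(ltW nR0)//.
  apply: lerXn2r; rewrite ?nnegrE ?mulr_ge0 ?exprn_ge0//.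
  by rewrite -natrX -natrM ler_nat mulSn addnC -addn1 leq_add2l expn_gt0 n1.
rewrite exprMn -exprM /mle_exponent exprSr /K2 le_eqVlt; apply/orP; left; apply/eqP.
move: n2p nR0; set u := n%:R ^+ (2 * nparam); set v : R := n%:R.
move: u v (m.+1%:R ^+ nparam : R) (expR (k%:R + 1) : R) (expR (A / 2)) => u v x y z u0 v0.
by field; rewrite !gt_eqF.
Qed.

End mle_rate.

(** * Rates of the estimator *)

Section rate_bounds.
Context {R : realType} {d : nat}.

(** The logarithm is at most twice the square root. *)
Lemma rate_small (C e : R) : 0 <= C -> 0 < e ->
  exists2 N, (1 <= N)%N & forall n, (N <= n)%N -> C * rate R d n < e.
Proof.
move=> C0 e0; pose B := 2 * d%:R * C ^+ 2 / e ^+ 2.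
have B0 : 0 <= B by rewrite divr_ge0 ?sqr_ge0// mulr_ge0 ?sqr_ge0// mulr_ge0.
exists (Num.truncn (B ^+ 2)).+1 => // n Nn.
have n1 : (1 <= n)%N by exact: leq_trans Nn.
have nR : 0 < n%:R :> R by rewrite ltr0n.
have Bn : B < Num.sqrt n%:R.
  rewrite -(ltr_pXn2r (n := 2))// ?nnegrE ?sqrtr_ge0// sqr_sqrtr//.
  have /andP[_ h] := truncn_itv (sqr_ge0 B).
  by apply: (lt_le_trans h); rewrite ler_nat.
have s0 : 0 < Num.sqrt n%:R :> R by rewrite sqrtr_gt0.
have lnn : ln n%:R <= 2 * Num.sqrt n%:R :> R.
  rewrite -[in ln _](sqr_sqrtr (ltW nR)) lnXn// -[leLHS]mulr_natl ler_wpM2l//.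
  exact/ltW/ln_sublinear.
have ln0 : 0 <= ln n%:R :> R by apply: ln_ge0; rewrite ler1n.
rewrite -(ltr_pXn2r (n := 2))// ?nnegrE ?(ltW e0) ?mulr_ge0 ?sqrtr_ge0//.
rewrite exprMn sqr_sqrtr ?divr_ge0 ?mulr_ge0//.
apply: (@le_lt_trans _ _ (C ^+ 2 * (d%:R * (2 * Num.sqrt n%:R) / n%:R))).
  by rewrite ler_wpM2l ?sqr_ge0// ler_wpM2r ?invr_ge0// ler_wpM2l.
rewrite -[X in _ / X](sqr_sqrtr (ltW nR)).
rewrite (_ : _ * _ = (B / Num.sqrt n%:R) * e ^+ 2); last first.
  by rewrite /B; field; rewrite !gt_eqF.
by rewrite gtr_pMl ?exprn_gt0// ltr_pdivrMr// mul1r.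
Qed.

Lemma mle_prob_le_sub (S : 'M[R]_d) Theta k (H : mixing R d k) n E E' (b : R) :
  (forall G, mix_class Theta G -> E G -> E' G) ->
  mle_prob_le S Theta H n E' b -> mle_prob_le S Theta H n E b.
Proof.
move=> EE' h dO O P X Gh iidX mle; apply: le_trans (h dO O P X Gh iidX mle).
by apply: le_mu_ext => w /=; apply: EE'; have [] := mle w.
Qed.

Lemma lee_of_mul (a b : R) (W : \bar R) : 0 < a -> (a%:E * W <= b%:E)%E ->
  (W <= (b / a)%:E)%E.
Proof. by move=> a0; rewrite EFinM lee_pdivlMr// muleC. Qed.

Lemma true_mixing_sub (Theta Theta' : set 'rV[R]_d) k (H : mixing R d k) :
  Theta `<=` Theta' -> true_mixing Theta H -> true_mixing Theta' H.
Proof. by move=> TT [h1 h2 h3 h4]; split => // j; exact: TT. Qed.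

Lemma mix_class_sub (Theta Theta' : set 'rV[R]_d) k (H : mixing R d k) :
  Theta `<=` Theta' -> mix_class Theta H -> mix_class Theta' H.
Proof. by move=> TT [h1 h2 h3]; split => // j; exact: TT. Qed.

Lemma local_nbhd_covering k (H G : mixing R d k) : local_nbhd H G -> covering H G.
Proof. by move=> loc j; have [[i ij] near] := loc j; exists i; exact: near. Qed.

End rate_bounds.

Section constants.
Context {R : realType} {d : nat}.

(** The constants of the theorem depend on the radius, k and S only: they are chosen
    in these sets, which are nonempty by [dH_ge_covering] and [dH_ge_W1]. *)
Definition local_constants (r : R) (k : nat) (S : 'M[R]_d) : set R :=
  [set c | 0 < c /\ forall H G : mixing R d k,
    true_mixing (eball r) H -> mix_class (eball r) G -> covering H G ->
    ((c * sep H ^+ (4 * k - 3))%:E * W1 G H <= (dH S G H)%:E)%E].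

Definition global_constants (r : R) (k : nat) (S : 'M[R]_d) : set R :=
  [set c | 0 < c /\ forall H G : mixing R d k,
    true_mixing (eball r) H -> mix_class (eball r) G ->
    ((c * min_weight H * sep H ^+ (4 * k - 3))%:E * W1 G H <= (dH S G H)%:E)%E].

End constants.

Theorem corollary3 (R : realType) (d : nat) (hd : (0 < d)%N) (lmin lmax : R)
    (hlmin : 0 < lmin) (hlmax : lmin <= lmax) :
  exists (Cdens cdens : set 'rV[R]_d -> nat -> R)
         (Cloc Cglob : R -> nat -> 'M[R]_d -> R),
  forall (Sigma : 'M[R]_d) (rad : R) (Theta : set 'rV[R]_d) (k : nat),
  covariance_matrix Sigma lmin lmax ->
  0 < rad ->
  compact Theta ->
  Theta `<=` [set x | enorm x <= rad] ->
  (2 <= k)%N ->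
  let C := Cdens Theta k in
  let c := cdens Theta k in
  let Cl := Cloc rad k Sigma in
  let Cg := Cglob rad k Sigma in
  [/\ [/\ 0 < C, 0 < c, 0 < Cl & 0 < Cg],
      (* the defining properties of the constants *)
      [/\ exists2 K : R, 0 < K &
            forall Gs : mixing R d k, true_mixing Theta Gs ->
            forall n, (1 <= n)%N ->
            mle_prob_le Sigma Theta Gs n
              [set G | C * rate R d n < dH Sigma G Gs] (K * n%:R `^ (- c)),
          forall Gs G : mixing R d k, true_mixing Theta Gs -> mix_class Theta G ->
            ((Cg * min_weight Gs * sep Gs ^+ (4 * k - 3))%:E * W1 G Gs
              <= (dH Sigma G Gs)%:E)%E &
          forall Gs G : mixing R d k, true_mixing Theta Gs -> mix_class Theta G ->
            local_nbhd Gs G ->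
            ((Cl * sep Gs ^+ (4 * k - 3))%:E * W1 G Gs <= (dH Sigma G Gs)%:E)%E],
      (* (a) global rate *)
      exists2 K : R, 0 < K &
        forall Gs : mixing R d k, true_mixing Theta Gs ->
        forall n, (1 <= n)%N ->
        mle_prob_le Sigma Theta Gs n
          [set G | ((C / Cg * rate R d n * (min_weight Gs)^-1
                     * sep Gs ^- (4 * k - 3))%:E < W1 G Gs)%E]
          (K * expR (- c * ln n%:R)) &
      (* (b) local rate *)
      exists2 K : R, 0 < K &
        forall Gs : mixing R d k, true_mixing Theta Gs ->
        exists N3 : nat, forall n, (N3 <= n)%N ->
        mle_prob_le Sigma Theta Gs n
          [set G | ((C / Cl * rate R d n * sep Gs ^- (4 * k - 3))%:E < W1 G Gs)%E]
          (K * expR (- c * ln n%:R))].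
Proof.
exists (fun _ k => @mle_constant R d k), (fun _ _ => 1),
  (fun rad k Sigma => xget 1 (local_constants rad k Sigma)),
  (fun rad k Sigma => xget 1 (global_constants rad k Sigma)).
move=> Sigma rad Theta k [symS posS _] r0 _ Theta_ball k2 C c Cl Cg.
have [Cl0 hCl] : local_constants rad k Sigma Cl.
  by apply: xgetPex; have [x x0 hx] := dH_ge_covering symS posS r0 k2; exists x.
have [Cg0 hCg] : global_constants rad k Sigma Cg.
  by apply: xgetPex; have [x x0 hx] := dH_ge_W1 symS posS r0 k2; exists x.
have tball Gs := @true_mixing_sub _ _ Theta (eball rad) k Gs Theta_ball.
have mball G := @mix_class_sub _ _ Theta (eball rad) k G Theta_ball.
have C0 : 0 < C.
  by rewrite sqrtr_gt0 divr_gt0 ?ltr0n.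
pose m := (Num.truncn (rad + rad)).+1.
have rm : rad + rad <= m%:R.
  have /andP[_ h] := truncn_itv (addr_ge0 (ltW r0) (ltW r0)); exact: ltW.
have [K K0 hK] := mle_dH_rate k symS posS r0 hd Theta_ball (ltn0Sn _) rm.
have Kn n : (1 <= n)%N -> K * expR (- c * ln n%:R) = K * n%:R^-1.
  by move=> n1; rewrite mulN1r expRN lnK// posrE ltr0n.
split=> //.
- split.
  + exists K => // Gs tGs n n1; rewrite powR_inv1//; exact: hK.
  + by move=> Gs G tGs mG; apply: hCg; [exact: tball|exact: mball].
  + move=> Gs G tGs mG loc; apply: hCl; [exact: tball|exact: mball|].
    exact: local_nbhd_covering.
- exists K => // Gs tGs n n1; rewrite Kn//.
  apply: mle_prob_le_sub (hK Gs tGs n n1) => G mG /=.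
  have [_ wGs _ sep0] := tGs.
  have mw0 := min_weight_gt0 (ltnW k2) wGs.
  move=> WG; rewrite ltNge; apply/negP => h; move: WG; apply/negP; rewrite -leNgt.
  have a0 : 0 < Cg * min_weight Gs * sep Gs ^+ (4 * k - 3).
    by rewrite !mulr_gt0// exprn_gt0.
  have := hCg Gs G (tball _ tGs) (mball _ mG).
  have hE : ((dH Sigma G Gs)%:E <= (C * rate R d n)%:E)%E by rewrite lee_fin.
  move=> /le_trans/(_ hE) /(lee_of_mul a0) /le_trans; apply.
  rewrite lee_fin le_eqVlt; apply/orP; left; apply/eqP.
  by field; rewrite !gt_eqF// exprn_gt0.
- exists K => // Gs tGs.
  have [_ wGs _ sep0] := tGs.
  have mw0 := min_weight_gt0 (ltnW k2) wGs.
  have [cf cf0 hcf] := dH_ge_not_covering symS posS r0 k2.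
  have eps0 : 0 < cf * min_weight Gs * sep Gs ^+ (4 * k - 3).
    by rewrite !mulr_gt0// exprn_gt0.
  (* from N on, the threshold on dH is too small for an atom of Gs to be missed *)
  have [N N1 hN] := @rate_small R d C _ (ltW C0) eps0.
  exists N => n Nn; have n1 : (1 <= n)%N by exact: leq_trans Nn.
  rewrite Kn//; apply: mle_prob_le_sub (hK Gs tGs n n1) => G mG /=.
  move=> WG; rewrite ltNge; apply/negP => h; move: WG; apply/negP; rewrite -leNgt.
  have cov : covering Gs G.
    apply: contrapT => ncov.
    have := hcf Gs G (tball _ tGs) (mball _ mG) ncov.
    by rewrite leNgt (le_lt_trans h (hN n Nn)).
  have a0 : 0 < Cl * sep Gs ^+ (4 * k - 3) by rewrite mulr_gt0// exprn_gt0.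
  have := hCl Gs G (tball _ tGs) (mball _ mG) cov.
  have hE : ((dH Sigma G Gs)%:E <= (C * rate R d n)%:E)%E by rewrite lee_fin.
  move=> /le_trans/(_ hE) /(lee_of_mul a0) /le_trans; apply.
  rewrite lee_fin le_eqVlt; apply/orP; left; apply/eqP.
  by field; rewrite !gt_eqF// exprn_gt0.
Qed.
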